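(* Let $(\mathbb N,E)$ be a self-similar graph satisfying the assumption that for every $e\in E^1$ there is $m\in\mathbb N$ with $m|_e\neq0$. The C*-envelope of the universal non-selfadjoint operator algebra $\mathcal A_{\mathbb N,E}$ is the self-similar graph C*-algebra $\mathcal O_{\mathbb Z,E}$, which is also the universal C*-algebra generated by a unitary + CK type Toeplitz representation of $(\mathbb N,E)$.
   Context: Graphs. $E=(E^0,E^1,r,s)$ is a finite directed graph (vertices $E^0$, edges $E^1$, range and source maps $r,s$), source-free: $vE^1:=\{e\in E^1: r(e)=v\}\neq\emptyset$ for every $v\in E^0$. $E^*$ is the set of finite paths (vertices are paths of length $0$; $\mu\nu$ is a path when $s(\mu)=r(\nu)$). $\mathbb N=\{0,1,2,\dots\}$. $\operatorname{Aut}(E)$ is the group of bijections of $E^0\cup E^1$ preserving $E^0$ and $E^1$ and commuting with $r$ and $s$. Self-similar graph $(P,E)$ for $P=\mathbb N$ or $P=\mathbb Z$ (additive): a homomorphism $P\to\operatorname{Aut}(E)$, written $p\cdot\mu$, together with a restriction map $P\times(E^0\cup E^1)\to P$, $(p,\mu)\mapsto p|_\mu$, such that $(p+q)|_\mu=p|_{q\cdot\mu}+q|_\mu$; $p|_v=p$ for $v\in E^0$; $0|_e=0$ for $e\in E^1$; and $p|_e\cdot v=p\cdot v$ whenever $s(e)=v$. A self-similar graph $(\mathbb N,E)$ extends uniquely to a self-similar graph $(\mathbb Z,E)$ (with $(-p)|_{\mu}=-(p|_{(-p)\cdot\mu})$). TCK families. A Toeplitz-Cuntz-Krieger (TCK)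 $E$-family $\mathcal S=\{S_\mu:\mu\in E^0\cup E^1\}$ consists of pairwise orthogonal projections $S_v$ ($v\in E^0$) and operators $S_e$ ($e\in E^1$) with $S_e^*S_e=S_{s(e)}$ and $\sum_{e\in vE^1}S_eS_e^*\le S_v$ for all $v$. It is Cuntz-Krieger (CK) if equality holds for all $v$. For $\mu=e_1\cdots e_k$, $S_\mu=S_{e_1}\cdots S_{e_k}$. Families are taken nondegenerate: $\sum_{v\in E^0}S_v=I$. Toeplitz representation of $(\mathbb N,E)$ on a Hilbert space: a pair $(\mathcal V,\mathcal S)$ with $\mathcal V=\{V_p\}_{p\in\mathbb N}$ isometries, $V_pV_q=V_{p+q}$, $V_0=I$, and $\mathcal S$ a TCK $E$-family, such that $V_pS_\mu=S_{p\cdot\mu}V_{p|_\mu}$ and $V_p^*S_{p\cdot\mu}=S_\mu V_{p|_\mu}^*$ for all $p\in\mathbb N$, $\mu\in E^0\cup E^1$. It is of unitary + CK type if $V_1$ is unitary and $\mathcal S$ is CK. $\mathcal A_{\mathbb N,E}$: the norm-closed (non-selfadjoint) operator algebra generated by the operators $S_\mu V_p$ ($\mu\in E^*$, $p\in\mathbb N$) in the universal Toeplitz representation, i.e. the direct sum of all Toeplitz representations of $(\mathbb N,E)$ (up to the usual set-theoretic restriction). C*-envelope of an operator algebra $\mathcal A$: the smallest C*-algebra generated by a completely isometric copy of $\mathcal A$ (the C*-cover which is a quotient of every other C*-cover, compatibly with the embeddings of $\mathcal A$). $\mathcal O_{\mathbb Z,E}$: the universal unital C*-algebra generated by a CK $E$-family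 $\{s_\mu:\mu\in E^0\cup E^1\}$ (with $\sum_v s_v=1$) and a unitary representation $\{u_g\}_{g\in\mathbb Z}$ such that $u_gs_\mu=s_{g\cdot\mu}u_{g|_\mu}$ for all $g\in\mathbb Z$, $\mu\in E^0\cup E^1$. *)

(* Defs.v *)
From HB Require Import structures.
From mathcomp Require Import all_boot all_order all_fingroup all_algebra.
From mathcomp Require Import complex.
From mathcomp Require Import all_classical.
From mathcomp Require Import reals topology normedtype.

Set Implicit Arguments.
Unset Strict Implicit.
Unset Printing Implicit Defensive.

Import Order.TTheory GRing.Theory Num.Theory Num.Def.
Import numFieldNormedType.Exports.

Local Open Scope classical_set_scope.
Local Open Scope complex_scope.
Local Open Scope ring_scope.

Record graph := Graph {
  vertex : finType;
  edge : finType;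
  rng : edge -> vertex;
  src : edge -> vertex }.

Definition source_free (E : graph) := forall v : vertex E, exists e, rng e = v.

(* The disjoint union of E^0 (left) and E^1 (right). *)
Definition cell (E : graph) := (vertex E + edge E)%type.

Definition cell_map (E : graph) (f : {perm vertex E}) (g : {perm edge E})
    (m : cell E) : cell E :=
  match m with inl v => inl (f v) | inr e => inr (g e) end.

(* [act0] and [act1] are the components on E^0 and E^1 of the homomorphism from
   P to Aut(E); an element of Aut(E) is a pair of permutations of E^0 and E^1
   commuting with the range and source maps. *)
Record self_similar (P : nmodType) (E : graph) := SelfSimilar {
  act0 : P -> {perm vertex E};
  act1 : P -> {perm edge E};
  act := fun p => cell_map (act0 p) (act1 p);
  act_id : forall m, act 0 m = m;
  act_comp : forall p q m, act (p + q) m = act p (act q m);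
  act_rng : forall p e, rng (act1 p e) = act0 p (rng e);
  act_src : forall p e, src (act1 p e) = act0 p (src e);
  res : P -> cell E -> P;
  res_add : forall p q m, res (p + q) m = res p (act q m) + res q m;
  res_vertex : forall p v, res p (inl v) = p;
  res_edge0 : forall e, res 0 (inr e) = 0;
  res_act : forall p e, act0 (res p (inr e)) (src e) = act0 p (src e) }.

Section Extension.
Variables (E : graph) (X : self_similar nat E).

Definition ext_act0 (g : int) : {perm vertex E} :=
  match g with Posz n => act0 X n | Negz n => (act0 X n.+1)^-1%g end.

Definition ext_act1 (g : int) : {perm edge E} :=
  match g with Posz n => act1 X n | Negz n => (act1 X n.+1)^-1%g end.

Definition ext_act (g : int) : cell E -> cell E :=
  cell_map (ext_act0 g) (ext_act1 g).

Definition ext_res (g : int) (m : cell E) : int :=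
  match g with
  | Posz n => (res X n m)%:Z
  | Negz n => - (res X n.+1 (ext_act (Negz n) m))%:Z
  end.

(* The action of N on E^0 + E^1 and its restriction map are combined into a
   single action of N by bijections of (E^0 + E^1) * Z. *)
Let T (n : nat) (x : cell E * int) : cell E * int :=
  (act X n x.1, (res X n x.1)%:Z + x.2).
Let iact (n : nat) : cell E -> cell E :=
  cell_map (act0 X n)^-1%g (act1 X n)^-1%g.
Let T' (n : nat) (x : cell E * int) : cell E * int :=
  (iact n x.1, x.2 - (res X n (iact n x.1))%:Z).
Let TZ (g : int) : cell E * int -> cell E * int :=
  match g with Posz n => T n | Negz n => T' n.+1 end.

Let actK n : cancel (iact n) (act X n).
Proof. by case=> x; rewrite /act /= permKV. Qed.

Let iactK n : cancel (act X n) (iact n).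
Proof. by case=> x; rewrite /act /= permK. Qed.

Let TK n : cancel (T' n) (T n).
Proof. by move=> [m k]; rewrite /T /T' /= actK addrC subrK. Qed.

Let T'K n : cancel (T n) (T' n).
Proof. by move=> [m k]; rewrite /T /T' /= iactK addrC addKr. Qed.

Let TD n1 n2 x : T (n1 + n2)%N x = T n1 (T n2 x).
Proof.
rewrite /T /= -[(n1 + n2)%N]/((n1 : nat) + n2 : nat).
by rewrite -act_comp res_add PoszD addrA.
Qed.

Let TC n1 n2 x : T n1 (T n2 x) = T n2 (T n1 x).
Proof. by rewrite -!TD addnC. Qed.

Let T'D n1 n2 x : T' (n1 + n2)%N x = T' n1 (T' n2 x).
Proof. by apply: (can_inj (T'K (n1 + n2)%N)); rewrite TK addnC TD !TK. Qed.

Let TT'C n1 n2 x : T n1 (T' n2 x) = T' n2 (T n1 x).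
Proof. by apply: (can_inj (T'K n2)); rewrite TK TC TK. Qed.

Let T0 x : T 0 x = x.
Proof.
case: x => m k; rewrite /T /= (act_id X).
by case: m => [v|e]; rewrite ?res_vertex ?(res_edge0 X) add0r.
Qed.

Let T'0 x : T' 0 x = x.
Proof. by rewrite -[in LHS](T0 x) T'K. Qed.

Let TZB (n1 n2 : nat) x : TZ (n1%:Z - n2%:Z) x = T n1 (T' n2 x).
Proof.
case: (leqP n2 n1) => [le21|/ltnW le12].
  by rewrite subzn //= -[in RHS](subnK le21) TD TK.
rewrite -opprB subzn // TT'C -[in RHS](subnK le12) T'D T'K.
by case: (n2 - n1)%N => [|d] //=; rewrite T0 T'0.
Qed.

Let TZD g h x : TZ (g + h) x = TZ g (TZ h x).
Proof.
have split_int (k : int) : exists a b : nat, k = a%:Z - b%:Z.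
  case: k => n; first by exists n, 0%N; rewrite subr0.
  by exists 0%N, n.+1; rewrite sub0r NegzE.
have [a [b ->]] := split_int g; have [c [d ->]] := split_int h.
rewrite addrACA -opprD -!PoszD !TZB TD T'D -!TT'C TT'C.
by rewrite TT'C -!TT'C -!T'D addnC.
Qed.

Let TZE g m : TZ g (m, 0) = (ext_act g m, ext_res g m).
Proof.
case: g => n /=; first by rewrite /T /= addr0; case: m.
by rewrite /T' /= add0r; case: m.
Qed.

Let TZ2 g m k : (TZ g (m, k)).2 = (TZ g (m, 0)).2 + k.
Proof. by case: g => n /=; rewrite ?addr0 // add0r addrC. Qed.

Fact ext_act_id m : ext_act 0 m = m.
Proof. by have := act_id X m; case: m. Qed.

Fact ext_act_comp g h m : ext_act (g + h) m = ext_act g (ext_act h m).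
Proof.
have := TZD g h (m, 0); rewrite !TZE => /(congr1 fst) /= ->.
by case: g => n; case: (ext_act h m).
Qed.

Fact ext_act_rng g e : rng (ext_act1 g e) = ext_act0 g (rng e).
Proof.
case: g => n /=; first exact: act_rng.
by apply: (canRL (permK _)); rewrite -act_rng permKV.
Qed.

Fact ext_act_src g e : src (ext_act1 g e) = ext_act0 g (src e).
Proof.
case: g => n /=; first exact: act_src.
by apply: (canRL (permK _)); rewrite -act_src permKV.
Qed.

Fact ext_res_add g h m :
  ext_res (g + h) m = ext_res g (ext_act h m) + ext_res h m.
Proof.
have := TZD g h (m, 0); rewrite !TZE => /(congr1 snd) /= ->.
by rewrite TZ2 TZE.
Qed.

Fact ext_res_vertex g v : ext_res g (inl v) = g.
Proof. by case: g => n; rewrite ?NegzE /= res_vertex. Qed.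

Fact ext_res_edge0 e : ext_res 0 (inr e) = 0.
Proof. by rewrite /= (res_edge0 X). Qed.

Fact ext_act0N (n : nat) v : ext_act0 (- n%:Z) v = (act0 X n)^-1%g v.
Proof.
case: n => [|n]; last by rewrite -NegzE.
have act00 w : act0 X 0 w = w by have [] := act_id X (inl w).
by apply: (canRL (permK _)); rewrite oppr0 /= !act00.
Qed.

Fact ext_res_act g e :
  ext_act0 (ext_res g (inr e)) (src e) = ext_act0 g (src e).
Proof.
case: g => n; first exact: res_act.
rewrite /= ext_act0N; set e' := (act1 X n.+1)^-1%g e.
have srce' : src e = act0 X n.+1 (src e') by rewrite -act_src permKV.
by rewrite {2}srce' permK [in LHS]srce' -[in LHS]res_act permK.
Qed.

Definition extend : self_similar int E :=
  @SelfSimilar int E ext_act0 ext_act1 ext_act_id ext_act_comp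
    ext_act_rng ext_act_src ext_res ext_res_add ext_res_vertex ext_res_edge0
    ext_res_act.

End Extension.

(* The form is linear in its first argument. *)
Record hilbert (R : realType) := Hilbert {
  hspace :> completeNormedModType R[i];
  hdot : {dot hspace for conjC};
  hdot_norm : forall x : hspace, hdot x x = `|x| ^+ 2 }.

Section Operators.
Variables (R : realType) (H : hilbert R).
Implicit Types S T : H -> H.

Definition bounded_op T := linear T /\ continuous T.

(* Bounded operators have exactly one adjoint (Riesz). *)
Definition adj T : H -> H :=
  xget 0 [set T' | forall x y, hdot H (T x) y = hdot H x (T' y)].

Definition op_le S T := forall x, hdot H (S x) x <= hdot H (T x) x.

Definition projection T := T \o T = T /\ adj T = T.

Definition isometry_op T := adj T \o T = idfun.

Definition unitary_op T := adj T \o T = idfun /\ T \o adj T = idfun.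

(* The norm of M as an operator on the direct sum of n copies of H. *)
Definition mx_opnorm n (M : 'M[H -> H]_n) : R :=
  inf [set c : R | 0 <= c /\ forall x : 'I_n -> H,
    \sum_i `| \sum_j M i j (x j) | ^+ 2 <= c%:C ^+ 2 * \sum_j `|x j| ^+ 2].

Definition op_norm_closed (A : set (H -> H)) :=
  forall T, bounded_op T ->
    (forall eps : R, 0 < eps ->
       exists2 S, A S & forall x, `|T x - S x| <= eps%:C * `|x|) ->
    A T.

Definition operator_algebra (A : set (H -> H)) :=
  [/\ A `<=` bounded_op,
      A 0,
      forall (a : R[i]) S T, A S -> A T -> A (a *: S + T),
      forall S T, A S -> A T -> A (S \o T)
    & op_norm_closed A].

(* Concrete C*-algebras; the identity operator need not belong to A. *)
Definition cstar_algebra (A : set (H -> H)) :=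
  operator_algebra A /\ forall T, A T -> A (adj T).

Definition algebra_generated (G : set (H -> H)) := smallest operator_algebra G.

Definition cstar_generated (G : set (H -> H)) := smallest cstar_algebra G.

End Operators.

Section Morphisms.
Variables (R : realType) (H K : hilbert R).
Implicit Types (A : set (H -> H)) (B : set (K -> K)).
Implicit Types (phi : (H -> H) -> (K -> K)).

(* Homomorphisms A -> B are total functions, constrained on A only. *)
Definition alg_hom A B phi :=
  [/\ forall T, A T -> B (phi T),
      forall (a : R[i]) S T, A S -> A T -> phi (a *: S + T) = a *: phi S + phi T
    & forall S T, A S -> A T -> phi (S \o T) = phi S \o phi T].

Definition star_hom A B phi :=
  alg_hom A B phi /\ forall T, A T -> phi (adj T) = adj (phi T).

Definition completely_isometric A phi :=
  forall n (M : 'M[H -> H]_n),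
    (forall i j, A (M i j)) -> mx_opnorm (map_mx phi M) = mx_opnorm M.

Definition cstar_cover A B phi :=
  [/\ cstar_algebra B, alg_hom A B phi, completely_isometric A phi
    & cstar_generated (phi @` A) = B].

End Morphisms.

Definition cstar_envelope (R : realType) (H K : hilbert R)
    (A : set (H -> H)) (B : set (K -> K)) (iota : (H -> H) -> (K -> K)) :=
  cstar_cover A B iota /\
  forall (L : hilbert R) (C : set (L -> L)) (j : (H -> H) -> (L -> L)),
    cstar_cover A C j ->
    exists q : (L -> L) -> (K -> K),
      [/\ star_hom C B q, q @` C = B & forall T, A T -> q (j T) = iota T].

(* [rel H t] says that the family of operators t on H satisfies the relations
   of a given type; t is universal for them if C*(t) is the universal C*-algebra
   generated by such families. *)
Definition universal_family (R : realType) (I : Type)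
    (rel : forall H : hilbert R, (I -> H -> H) -> Prop)
    (H : hilbert R) (t : I -> H -> H) :=
  rel H t /\
  forall (K : hilbert R) (t' : I -> K -> K), rel K t' ->
    exists phi, star_hom (cstar_generated (range t)) (@bounded_op R K) phi /\
      forall i, phi (t i) = t' i.

Section Families.
Variables (R : realType) (E : graph) (H : hilbert R).

Definition range_sum (S : cell E -> H -> H) (v : vertex E) : H -> H :=
  \sum_(e | rng e == v) (S (inr e) \o adj (S (inr e))).

Record tck_family (S : cell E -> H -> H) : Prop := TCKFamily {
  tck_bounded : forall m, bounded_op (S m);
  tck_proj : forall v, projection (S (inl v));
  tck_orth : forall v w, v != w -> S (inl v) \o S (inl w) = 0;
  tck_src : forall e, adj (S (inr e)) \o S (inr e) = S (inl (src e));
  tck_le : forall v, op_le (range_sum S v) (S (inl v));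
  tck_nondegenerate : \sum_v S (inl v) = idfun }.

Definition ck_family (S : cell E -> H -> H) :=
  tck_family S /\ forall v, range_sum S v = S (inl v).

Record toeplitz_rep (X : self_similar nat E)
    (V : nat -> H -> H) (S : cell E -> H -> H) : Prop := ToeplitzRep {
  toeplitz_bounded : forall p, bounded_op (V p);
  toeplitz_isometry : forall p, isometry_op (V p);
  toeplitz_id : V 0%N = idfun;
  toeplitz_add : forall p q, V (p + q)%N = V p \o V q;
  toeplitz_tck : tck_family S;
  toeplitz_comm : forall p m, V p \o S m = S (act X p m) \o V (res X p m);
  toeplitz_adj : forall p m,
    adj (V p) \o S (act X p m) = S m \o adj (V (res X p m)) }.

Definition unitary_ck_type (V : nat -> H -> H) (S : cell E -> H -> H) :=
  unitary_op (V 1%N) /\ ck_family S.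

Record unitary_ck_rep (Y : self_similar int E)
    (u : int -> H -> H) (s : cell E -> H -> H) : Prop := UnitaryCKRep {
  uck_bounded : forall g, bounded_op (u g);
  uck_unitary : forall g, unitary_op (u g);
  uck_id : u 0 = idfun;
  uck_add : forall g h, u (g + h) = u g \o u h;
  uck_ck : ck_family s;
  uck_comm : forall g m, u g \o s m = s (act Y g m) \o u (res Y g m) }.

(* The operators S_mu V_p, where mu is a vertex or mu = e e_1 ... e_k with each
   edge starting where the next one ends. *)
Definition path_generators (V : nat -> H -> H) (S : cell E -> H -> H) :
    set (H -> H) :=
  [set T | exists v p, T = S (inl v) \o V p] `|`
  [set T | exists e es p, path (fun f f' => src f == rng f') e es /\
     T = foldr (fun f U => S (inr f) \o U) (V p) (e :: es)].

End Families.

Definition rep_family (P T : Type) (E : graph)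
    (V : P -> T) (S : cell E -> T) (i : P + cell E) : T :=
  match i with inl p => V p | inr m => S m end.

Section Universal.
Variables (R : realType) (E : graph).

Definition separable_space (T : topologicalType) :=
  exists2 D : set T, countable D & dense D.

Definition closed_subspace (H : hilbert R) (W : set H) :=
  [/\ closed W, W 0 & forall (a : R[i]) x y, W x -> W y -> W (a *: x + y)].

Definition linear_isometry (H K : hilbert R) (U : H -> K) :=
  linear U /\ forall x y, hdot K (U x) (U y) = hdot H x y.

Definition intertwines (H K : hilbert R) (U : H -> K)
    (V : nat -> H -> H) (S : cell E -> H -> H)
    (V' : nat -> K -> K) (S' : cell E -> K -> K) :=
  (forall p, U \o V p = V' p \o U) /\ (forall m, U \o S m = S' m \o U).

(* (V, S) is the (internal) Hilbert space direct sum of a family of Toeplitz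
   representations. Set-theoretic restriction: the family is indexed by a type,
   and contains, up to unitary equivalence, all Toeplitz representations on
   separable Hilbert spaces. These suffice, because every Toeplitz
   representation is a direct sum of cyclic ones and the latter are separable,
   E being finite. *)
Definition universal_toeplitz_rep (X : self_similar nat E) (H : hilbert R)
    (V : nat -> H -> H) (S : cell E -> H -> H) :=
  toeplitz_rep X V S /\
  exists (I : Type) (K : I -> hilbert R) (V' : forall i, nat -> K i -> K i)
      (S' : forall i, cell E -> K i -> K i) (iota : forall i, K i -> H),
    [/\ forall i, toeplitz_rep X (@V' i) (@S' i),
        forall (L : hilbert R) (VL : nat -> L -> L) (SL : cell E -> L -> L),
          separable_space L -> toeplitz_rep X VL SL ->
          exists i (U : L -> K i),
            [/\ linear_isometry U, range U = setT
              & intertwines U VL SL (@V' i) (@S' i)],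
        forall i, linear_isometry (@iota i) /\
          intertwines (@iota i) (@V' i) (@S' i) V S,
        forall i j, i <> j -> forall x y, hdot H (@iota i x) (@iota j y) = 0
      & smallest (@closed_subspace H) (\bigcup_i range (@iota i)) = setT].

(* C*(u, s) is the self-similar graph C*-algebra of (Z, E). *)
Definition universal_unitary_ck_rep (Y : self_similar int E) (K : hilbert R)
    (u : int -> K -> K) (s : cell E -> K -> K) :=
  universal_family
    (fun L t => unitary_ck_rep Y (fun g => t (inl g)) (fun m => t (inr m)))
    (rep_family u s).

Definition universal_unitary_ck_toeplitz_rep (X : self_similar nat E)
    (K : hilbert R) (V : nat -> K -> K) (S : cell E -> K -> K) :=
  universal_family
    (fun L t => toeplitz_rep X (fun p => t (inl p)) (fun m => t (inr m)) /\
       unitary_ck_type (fun p => t (inl p)) (fun m => t (inr m)))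
    (rep_family V S).

Definition toeplitz_algebra (H : hilbert R)
    (V : nat -> H -> H) (S : cell E -> H -> H) : set (H -> H) :=
  algebra_generated (path_generators V S).

Definition family_cstar (K : hilbert R) (P : Type)
    (u : P -> K -> K) (s : cell E -> K -> K) : set (K -> K) :=
  cstar_generated (range (rep_family u s)).

End Universal.

(* Main.v *)
(* A Toeplitz representation (V, S) on H is compressed, asymptotically, from a
   unitary and Cuntz-Krieger representation on l2(I; H), I a set of infinite
   paths decorated with a rational phase: averaging over long stretches of
   translates and of levels gives isometries Y_k with u_p Y_k - Y_k V_p and
   s_m Y_k - Y_k S_m tending to 0.  Hence polynomials in (V, S) have at most the
   matrix norms of the corresponding polynomials in the universal (u, s).  The
   converse holds because a separable reducing subspace of (u, s) is a summand of
   the universal Toeplitz representation.  So V_p |-> u_p, S_m |-> s_m extends to a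
   complete isometry phi of A.

   Let j be another completely isometric homomorphism of A.  The map
   j(a) |-> phi(a) is completely positive, so its matrix coefficients are
   approximated by sums of coefficients <j(a) xi, eta>: each finite set of vectors
   y is mimicked by vectors Psi(y) in a finite multiple of the space of j.  As u_p
   is unitary, s_v and s_e are partial isometries, and the ranges of the s_e
   exhaust the space, the relation j(g) Psi(y) ~ Psi(phi(g) y) holds for the
   generators g (equality in Cauchy-Schwarz) and for their adjoints.  This relation
   passes to *-polynomials, and yields |phi-polynomial| <= |j-polynomial|, which
   is the quotient map of the envelope. *)
Require Import Defs.
From HB Require Import structures.
From mathcomp Require Import all_boot all_order all_fingroup all_algebra.
From mathcomp Require Import complex.
From mathcomp Require Import all_classical.
From mathcomp Require Import reals topology normedtype sequences.
From mathcomp Require Import ring lra.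

Set Implicit Arguments.
Unset Strict Implicit.
Unset Printing Implicit Defensive.

Import Order.TTheory GRing.Theory Num.Theory Num.Def.
Import numFieldNormedType.Exports.

Local Open Scope classical_set_scope.
Local Open Scope complex_scope.
Local Open Scope ring_scope.

(** * Hilbert spaces and bounded operators *)

(** Two obstacles shape the construction. To model an isometry by shifts along orbits, Z has to act
    freely on the indices, and on infinite paths alone it need not. A rational phase translated by Z
    restores freeness, but then prepending e has to turn translation by p|_e into translation by p.
    An affine map whose slope is the inverse of the mean growth rate of p|_e does this, and the
    assumption that some m|_e is nonzero makes that rate positive.

    On the side of an arbitrary cover, j(A) is not self-adjoint and j need not be unital. Extension
    and dilation of the completely positive map are replaced by statements about finitely many
    matrix coefficients, obtained by separating a point from a cone in finite dimension; properties
    of all sufficiently fine approximants play the role of a limit representation. The rigidity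
    comes from comparing equalities with inequalities: u and s are coisometric and partially
    isometric exactly where complete isometry gives j only a contraction, and a defect bounded by
    the difference of the two sides must vanish. *)

Section ComplexScalars.
Variable R : realType.
Implicit Types (a b z : R[i]) (r : R).

Definition cmod a : R := complex.Re `|a|.

Lemma cmodE a : `|a| = (cmod a)%:C.
Proof. by rewrite /cmod RRe_real // normr_real. Qed.

Lemma cmod_ge0 a : 0 <= cmod a.
Proof. by rewrite -lecR -cmodE normr_ge0. Qed.

Lemma cmodM a b : cmod (a * b) = cmod a * cmod b.
Proof. by apply: complexI; rewrite -cmodE normrM !cmodE rmorphM. Qed.

Lemma cmodD a b : cmod (a + b) <= cmod a + cmod b.
Proof. by rewrite -lecR rmorphD /= -!cmodE ler_normD. Qed.

Lemma cmod_real r : cmod r%:C = `|r|.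
Proof. by rewrite /cmod normc_def /= expr0n addr0 sqrtr_sqr. Qed.

Lemma cmod0 : cmod 0 = 0.
Proof. by rewrite /cmod normr0. Qed.

Lemma cmodN a : cmod (- a) = cmod a.
Proof. by rewrite /cmod normrN. Qed.

Lemma cmod_sqr a : cmod a ^+ 2 = complex.Re a ^+ 2 + complex.Im a ^+ 2.
Proof. by apply: complexI; rewrite rmorphXn /= -cmodE -add_Re2_Im2. Qed.

Lemma conj_conjc a : (a^*)%R = (a^*)%C.
Proof. by []. Qed.

Lemma cReD a b : complex.Re (a + b) = complex.Re a + complex.Re b.
Proof. by case: a b => ? ? []. Qed.

Lemma cReN a : complex.Re (- a) = - complex.Re a.
Proof. by case: a. Qed.

Lemma cReMr r a : complex.Re (r%:C * a) = r * complex.Re a.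
Proof. by case: a => x y /=; rewrite mul0r subr0. Qed.

Lemma cRe_conj a : complex.Re (a^*)%R = complex.Re a.
Proof. by rewrite conj_conjc; case: a. Qed.

Lemma cRe_sum (I : Type) (s : seq I) (P : pred I) (F : I -> R[i]) :
  complex.Re (\sum_(i <- s | P i) F i) = \sum_(i <- s | P i) complex.Re (F i).
Proof. exact: (big_morph _ cReD (erefl _)). Qed.

Lemma Re_le_cmod a : complex.Re a <= cmod a.
Proof.
have [h|h] := leP (complex.Re a) 0; first by rewrite (le_trans h) ?cmod_ge0.
rewrite -(ler_pXn2r (ltn0Sn 1)) ?nnegrE ?cmod_ge0 //; last exact: ltW.
by rewrite cmod_sqr lerDl sqr_ge0.
Qed.

End ComplexScalars.

Section Hilbert.
Variables (R : realType) (H : hilbert R).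
Implicit Types (x y z : H) (a b : R[i]) (r : R).

(** The norm and the form take values in [R[i]]. Their real versions [hn] and [rip] let order
    arguments be settled by arithmetic over [R]; [hdotE] recovers the form from [rip]. *)
Definition hn x : R := complex.Re `|x|.
Definition rip x y : R := complex.Re (hdot H x y).

Lemma hnE x : `|x| = (hn x)%:C.
Proof. by rewrite /hn RRe_real // ger0_real. Qed.

Lemma hn_ge0 x : 0 <= hn x.
Proof. by rewrite -lecR -hnE normr_ge0. Qed.

Lemma hn0 : hn 0 = 0.
Proof. by rewrite /hn normr0. Qed.

Lemma hn_eq0 x : hn x = 0 -> x = 0.
Proof. by move=> h; apply/normr0_eq0; rewrite hnE h. Qed.

Lemma hnN x : hn (- x) = hn x.
Proof. by rewrite /hn normrN. Qed.

Lemma hnBC x y : hn (x - y) = hn (y - x).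
Proof. by rewrite -hnN opprB. Qed.

Lemma hnZ a x : hn (a *: x) = cmod a * hn x.
Proof. by apply: complexI; rewrite -hnE normrZ cmodE hnE rmorphM. Qed.

Lemma hnZr r x : hn (r%:C *: x) = `|r| * hn x.
Proof. by rewrite hnZ cmod_real. Qed.

Lemma hnD x y : hn (x + y) <= hn x + hn y.
Proof. by rewrite -lecR rmorphD /= -!hnE ler_normD. Qed.

Lemma hnB x y : hn (x - y) <= hn x + hn y.
Proof. by rewrite -(hnN y) hnD. Qed.

Lemma hnBD y x z : hn (x - z) <= hn (x - y) + hn (y - z).
Proof. by rewrite (le_trans _ (hnD _ _)) // addrA subrK. Qed.

Lemma hn_sum (I : Type) (s : seq I) (P : pred I) (F : I -> H) :
  hn (\sum_(i <- s | P i) F i) <= \sum_(i <- s | P i) hn (F i).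
Proof.
elim/big_ind2: _ => //; first by rewrite hn0.
by move=> x r y r' h h'; rewrite (le_trans (hnD _ _)) ?lerD.
Qed.

Lemma hdotDl x y z : hdot H (x + y) z = hdot H x z + hdot H y z.
Proof. exact: linearDl. Qed.
Lemma hdotDr x y z : hdot H z (x + y) = hdot H z x + hdot H z y.
Proof. exact: linearD. Qed.
Lemma hdotZl a x y : hdot H (a *: x) y = a * hdot H x y.
Proof. exact: linearZl_LR. Qed.
Lemma hdotZr a x y : hdot H x (a *: y) = (a^*)%R * hdot H x y.
Proof. exact: linearZr_LR. Qed.
Lemma hdotNl x y : hdot H (- x) y = - hdot H x y.
Proof. exact: linearNl. Qed.
Lemma hdotNr x y : hdot H x (- y) = - hdot H x y.
Proof. exact: linearN. Qed.
Lemma hdot0l x : hdot H 0 x = 0.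
Proof. exact: linear0l. Qed.
Lemma hdot0r x : hdot H x 0 = 0.
Proof. exact: linear0r. Qed.
Lemma hdotC x y : hdot H x y = ((hdot H y x)^*)%R.
Proof. by rewrite (hermC (hdot H) x y) /= expr0 mul1r. Qed.

Lemma hdot_suml (I : Type) (s : seq I) (P : pred I) (F : I -> H) y :
  hdot H (\sum_(i <- s | P i) F i) y = \sum_(i <- s | P i) hdot H (F i) y.
Proof. exact: (big_morph (fun x => hdot H x y) (fun u v => hdotDl u v y) (hdot0l y)). Qed.

Lemma hdot_sumr (I : Type) (s : seq I) (P : pred I) (F : I -> H) y :
  hdot H y (\sum_(i <- s | P i) F i) = \sum_(i <- s | P i) hdot H y (F i).
Proof. exact: (big_morph (fun x => hdot H y x) (fun u v => hdotDr u v y) (hdot0r y)). Qed.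

Lemma hdotxx x : hdot H x x = (hn x ^+ 2)%:C.
Proof. by rewrite hdot_norm hnE rmorphXn. Qed.

Lemma ripxx x : rip x x = hn x ^+ 2.
Proof. by rewrite /rip hdotxx. Qed.

Lemma ripC x y : rip x y = rip y x.
Proof. by rewrite /rip hdotC cRe_conj. Qed.

Lemma ripDl x y z : rip (x + y) z = rip x z + rip y z.
Proof. by rewrite /rip hdotDl cReD. Qed.
Lemma ripDr x y z : rip z (x + y) = rip z x + rip z y.
Proof. by rewrite /rip hdotDr cReD. Qed.
Lemma ripNl x y : rip (- x) y = - rip x y.
Proof. by rewrite /rip hdotNl cReN. Qed.
Lemma ripNr x y : rip x (- y) = - rip x y.
Proof. by rewrite /rip hdotNr cReN. Qed.
Lemma ripZl r x y : rip (r%:C *: x) y = r * rip x y.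
Proof. by rewrite /rip hdotZl cReMr. Qed.
Lemma ripZr r x y : rip x (r%:C *: y) = r * rip x y.
Proof. by rewrite ripC ripZl ripC. Qed.
Lemma rip_suml (I : Type) (s : seq I) (P : pred I) (F : I -> H) y :
  rip (\sum_(i <- s | P i) F i) y = \sum_(i <- s | P i) rip (F i) y.
Proof. by rewrite /rip hdot_suml cRe_sum. Qed.

Lemma rip_sumr (I : Type) (s : seq I) (P : pred I) (F : I -> H) y :
  rip y (\sum_(i <- s | P i) F i) = \sum_(i <- s | P i) rip y (F i).
Proof. by rewrite /rip hdot_sumr cRe_sum. Qed.

Lemma hn_sqrD x y : hn (x + y) ^+ 2 = hn x ^+ 2 + 2 * rip x y + hn y ^+ 2.
Proof. by rewrite -!ripxx !(ripDl, ripDr) (ripC y x); ring. Qed.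

Lemma hn_sqrB x y : hn (x - y) ^+ 2 = hn x ^+ 2 - 2 * rip x y + hn y ^+ 2.
Proof. by rewrite hn_sqrD hnN ripNr; ring. Qed.

(** Cauchy-Schwarz is read off the triangle inequality of the given norm, squared and expanded. *)
Lemma rip_le x y : rip x y <= hn x * hn y.
Proof.
have h := hn_sqrD x y; have := hnD x y.
have := hn_ge0 (x + y); have := hn_ge0 x; have := hn_ge0 y.
move: (hn _) (hn _) (hn _) h => a b c h; nra.
Qed.

Lemma rip_abs x y : `|rip x y| <= hn x * hn y.
Proof.
rewrite ler_norml rip_le andbT -[- _ <= _]lerN2 opprK -ripNl.
by rewrite (le_trans (rip_le _ _)) // hnN.
Qed.

Lemma hdotE x y : hdot H x y = rip x y +i* rip x ('i *: y).
Proof.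
rewrite /rip hdotZr; case: (hdot H x y) => a b /=; congr (_ +i* _).
by rewrite mul0r sub0r mulN1r opprK.
Qed.

Lemma cmod_hdot x y : cmod (hdot H x y) <= hn x * hn y.
Proof.
set z := hdot H x y; have [->|z0] := eqVneq (cmod z) 0.
  by rewrite mulr_ge0 ?hn_ge0.
have zp : 0 < cmod z by rewrite lt_def z0 cmod_ge0.

(* Rotating [x] by the conjugate of [z] makes the pairing real, equal to the square of [cmod z]. *)
have := rip_le ((z^*)%R *: x) y; rewrite /rip hdotZl -/z mulrC -normCK.
have -> : complex.Re (`|z| ^+ 2) = cmod z ^+ 2 by rewrite cmodE -rmorphXn.
by rewrite hnZ /cmod norm_conjC -mulrA expr2 ler_pM2l.
Qed.

Lemma hdotI x y : (forall z, hdot H z x = hdot H z y) -> x = y.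
Proof.
move=> h; apply/eqP; rewrite -subr_eq0; apply/eqP/hn_eq0.
have : hn (x - y) ^+ 2 = 0.
  by rewrite -ripxx /rip hdotDr hdotNr h subrr.
by move=> /eqP; rewrite sqrf_eq0 => /eqP.
Qed.

Lemma hn_lim0 x (c : R) : (forall e : R, 0 < e -> hn x <= e * c) -> x = 0.
Proof.
move=> h; apply/hn_eq0/eqP; rewrite eq_le hn_ge0 andbT leNgt; apply/negP => x0.
have := h (hn x / (2 * (`|c| + 1))).
have c0 : 0 < `|c| + 1 by have := normr_ge0 c; lra.
rewrite divr_gt0 ?mulr_gt0 // => /(_ isT).
have : c / (2 * (`|c| + 1)) < 1.
  by rewrite ltr_pdivrMr ?mulr_gt0 //; have := ler_norm c; have := normr_ge0 c; lra.
set k := (2 * _); rewrite -mulrA (mulrC k^-1); set q := c / k => q1.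
by rewrite -[X in X <= _]mulr1 ler_pM2l // leNgt q1.
Qed.

End Hilbert.

Section LinearMaps.
Variables (R : realType) (U W : lmodType R[i]) (T : U -> W).
Hypothesis linT : linear T.

Lemma linearD_of x y : T (x + y) = T x + T y.
Proof. by have := linT 1 x y; rewrite !scale1r. Qed.
Lemma linear0_of : T 0 = 0.
Proof. by apply: (addIr (T 0)); rewrite -linearD_of !add0r. Qed.
Lemma linearZ_of a x : T (a *: x) = a *: T x.
Proof. by have := linT a x 0; rewrite linear0_of !addr0. Qed.
Lemma linearN_of x : T (- x) = - T x.
Proof. by rewrite -scaleN1r linearZ_of scaleN1r. Qed.
Lemma linearB_of x y : T (x - y) = T x - T y.
Proof. by rewrite linearD_of linearN_of. Qed.
Lemma linear_sum_of (I : Type) (s : seq I) (P : pred I) (F : I -> U) :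
  T (\sum_(i <- s | P i) F i) = \sum_(i <- s | P i) T (F i).
Proof. exact: (big_morph T linearD_of linear0_of). Qed.

End LinearMaps.

Lemma invS_le (R : realType) (e : R) : 0 < e ->
  exists N, forall n, (N <= n)%N -> n.+1%:R^-1 <= e.
Proof.
move=> e0; exists (truncn e^-1) => n hn.
rewrite -[leRHS]invrK lef_pV2 ?posrE ?invr_gt0 //.
by rewrite (le_trans (ltW (truncnS_gt _))) // ler_nat.
Qed.

Lemma le_of_sqr (R : realType) (a b : R) : 0 <= b -> a ^+ 2 <= b ^+ 2 -> a <= b.
Proof.
move=> b0 h; have [a0|/ltW a0] := leP a 0; first exact: le_trans a0 b0.
by rewrite -(ler_pXn2r (ltn0Sn 1)) ?nnegrE.
Qed.

Section Convergence.
Variables (R : realType) (H : hilbert R).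

Definition hcvg (x_ : nat -> H) (z : H) := forall e : R, 0 < e ->
  exists N, forall n, (N <= n)%N -> hn (x_ n - z) <= e.

Definition hcauchy (x_ : nat -> H) := forall e : R, 0 < e ->
  exists N, forall m n, (N <= m)%N -> (N <= n)%N -> hn (x_ m - x_ n) <= e.

Lemma hcomplete x_ : hcauchy x_ -> exists z, hcvg x_ z.
Proof.
move=> cx; have /cvg_ex[z hz] : cvg (x_ @ \oo).
  apply: cauchy_cvg; apply: cauchy_exP => e e0.
  have eE : e = (complex.Re e)%:C by rewrite RRe_real // gtr0_real.
  have e20 : 0 < complex.Re e / 2 by rewrite divr_gt0 // -ltcR -eE.
  have [N hN] := cx _ e20; exists (x_ N); exists N => // n /= Nn.
  rewrite -ball_normE /= hnE eE ltcR (le_lt_trans (hN _ _ _ _)) //.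
  by lra.
exists z => e e0.
have e0' : (0 : R[i]) < e%:C by rewrite ltcR.
have [N _ hN] := (cvgrPdist_le _ _).1 hz _ e0'; exists N => n Nn.
by have := hN n Nn; rewrite /= hnE lecR hnBC.
Qed.

End Convergence.

Section Bounded.
Variables (R : realType) (H K : hilbert R).

Definition bnd (T : H -> K) (c : R) := forall x, hn (T x) <= c * hn x.

Lemma bnd_le T c d : c <= d -> bnd T c -> bnd T d.
Proof. by move=> cd h x; rewrite (le_trans (h x)) // ler_wpM2r ?hn_ge0. Qed.

Lemma bnd_norm T c : bnd T c -> bnd T `|c|.
Proof. by apply: bnd_le; rewrite ler_norm. Qed.

Lemma bnd0 : bnd 0 0.
Proof. by move=> x; rewrite mul0r -[X in X x]/(0 : H -> K) hn0. Qed.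

Lemma bnd_lin (a : R[i]) S T c d : bnd S c -> bnd T d ->
  bnd (a *: S + T) (cmod a * c + d).
Proof.
move=> hS hT x; rewrite (le_trans (hnD _ _)) // mulrDl lerD // hnZ -mulrA.
by rewrite ler_wpM2l ?cmod_ge0.
Qed.

Lemma bndD S T c d : bnd S c -> bnd T d -> bnd (S + T) (c + d).
Proof. by move=> hS hT x; rewrite (le_trans (hnD _ _)) // mulrDl lerD. Qed.

Lemma bndB S T c d : bnd S c -> bnd T d -> bnd (S - T) (c + d).
Proof. by move=> hS hT x; rewrite (le_trans (hnB _ _)) // mulrDl lerD. Qed.

End Bounded.

Lemma bnd_comp (R : realType) (H K L : hilbert R) (S : K -> L) (T : H -> K) c d :
  0 <= c -> bnd S c -> bnd T d -> bnd (S \o T) (c * d).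
Proof.
by move=> c0 hS hT x; rewrite (le_trans (hS _)) // -mulrA ler_wpM2l.
Qed.

Lemma bnd_id (R : realType) (H : hilbert R) : bnd (@idfun H) 1.
Proof. by move=> x; rewrite mul1r. Qed.

Section BoundedOp.
Variables (R : realType) (H : hilbert R).
Implicit Types (S T : H -> H).

Lemma bounded_opP T :
  bounded_op T <-> linear T /\ exists2 c, 0 <= c & bnd T c.
Proof.
split=> [[lT cT]|[lT [c c0 hc]]]; split => //; last first.
  move=> x; apply/(@cvgrPdist_lt _ _ _ (nbhs x)) => e e0.
  have eE : e = (complex.Re e)%:C by rewrite RRe_real // gtr0_real.
  have er : 0 < complex.Re e by rewrite -ltcR -eE.
  have c1 : 0 < c + 1 by lra.
  apply/nbhs_ballP; exists (complex.Re e / (c + 1))%:C => /=.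
    by rewrite ltcR divr_gt0.
  move=> y; rewrite -ball_normE /= hnE ltcR -(linearB_of lT) hnE eE ltcR.
  rewrite ltr_pdivlMr // => h; rewrite (le_lt_trans (hc _)) //.
  by rewrite (le_lt_trans _ h) // mulrC ler_wpM2l ?hn_ge0 //; lra.
pose f := HB.pack_for {linear H -> H} T (GRing.isLinear.Build _ _ _ _ T lT).
have /continuous_linear_bounded : {for 0, continuous f} by apply: cT.
move=> /(_ 0)/linear_boundedP/pinfty_ex_gt0 [e e0 he].
have eE : e = (complex.Re e)%:C by rewrite RRe_real // gtr0_real.
exists (complex.Re e); first by rewrite ltW // -ltcR -eE.
by move=> x; rewrite -lecR rmorphM /= -eE -!hnE; apply: he.
Qed.

Lemma bop_linear T : bounded_op T -> linear T.
Proof. by case. Qed.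

Lemma bop_bnd T : bounded_op T -> exists2 c, 0 <= c & bnd T c.
Proof. by case/bounded_opP. Qed.

Lemma bop_of T c : linear T -> bnd T c -> bounded_op T.
Proof.
move=> lT hT; apply/bounded_opP; split=> //.
by exists `|c|; [exact: normr_ge0|exact: bnd_norm].
Qed.

Lemma bop_lin a S T : bounded_op S -> bounded_op T -> bounded_op (a *: S + T).
Proof.
move=> /bounded_opP[lS [c c0 hS]] /bounded_opP[lT [d d0 hT]].
apply: bop_of (bnd_lin a hS hT) => b x y.
rewrite -![(a *: S + T) _]/(a *: S _ + T _) lS lT !scalerDr addrACA; congr (_ + _ + _).
by rewrite !scalerA mulrC.
Qed.

Lemma bop_comp S T : bounded_op S -> bounded_op T -> bounded_op (S \o T).
Proof.
move=> /bounded_opP[lS [c c0 hS]] /bounded_opP[lT [d d0 hT]].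
by apply: bop_of (bnd_comp c0 hS hT) => b x y /=; rewrite lT lS.
Qed.

Lemma bop0 : bounded_op (0 : H -> H).
Proof. by apply: bop_of (@bnd0 _ H H) => a x y; rewrite -![(0 : H -> H) _]/(0 : H) scaler0 addr0. Qed.

Lemma bopD S T : bounded_op S -> bounded_op T -> bounded_op (S + T).
Proof. by move=> hS hT; rewrite -[S]scale1r; apply: bop_lin. Qed.

Lemma bopZ a T : bounded_op T -> bounded_op (a *: T).
Proof. by move=> hT; rewrite -[_ *: _]addr0; apply: bop_lin => //; apply: bop0. Qed.

Lemma bopN T : bounded_op T -> bounded_op (- T).
Proof. by move=> hT; rewrite -scaleN1r; apply: bopZ. Qed.

Lemma bopB S T : bounded_op S -> bounded_op T -> bounded_op (S - T).
Proof. by move=> hS hT; apply: bopD => //; apply: bopN. Qed.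

End BoundedOp.

Lemma fct_sum (I : Type) (s : seq I) (P : pred I) (U : Type) (W : zmodType)
    (F : I -> U -> W) x :
  (\sum_(i <- s | P i) F i) x = \sum_(i <- s | P i) F i x.
Proof. by elim/big_rec2: _ => // i y1 y2 _ <-. Qed.

(** * Riesz representation and adjoints *)

Section Riesz.
Variables (R : realType) (H : hilbert R).

(** For [B <> 0] the value at [t = - B / (A + 1)] is negative; the summand [1] covers [A = 0]. *)
Lemma real_affine_ge0 (A B : R) : 0 <= A ->
  (forall t, 0 <= t ^+ 2 * A + 2 * t * B) -> B = 0.
Proof.
move=> A0 h; apply/eqP/negP => /negP B0; have := h (- B / (A + 1)).
have A1 : 0 < A + 1 by lra.
have -> : (- B / (A + 1)) ^+ 2 * A + 2 * (- B / (A + 1)) * B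
   = - ((A + 2) * (B / (A + 1)) ^+ 2).
  by field; rewrite gt_eqF.
rewrite oppr_ge0 leNgt mulr_gt0 //; first by lra.
by rewrite exprn_even_gt0 //= mulf_neq0 // invr_neq0 // gt_eqF.
Qed.

(** The representing vector minimises [J x = |x|^2 - 2 Re f(x)]. Minimising sequences are Cauchy by
    the parallelogram law, the first variation of [J] at the limit gives [Re f], and rotation by
    [-i] gives the imaginary part. *)
Lemma riesz (f : H -> R[i]) c : (forall a x y, f (a *: x + y) = a * f x + f y) ->
  (forall x, cmod (f x) <= c * hn x) -> exists z, forall x, f x = hdot H x z.
Proof.
move=> lf bf.
have fD x y : f (x + y) = f x + f y by have := lf 1 x y; rewrite scale1r mul1r.
have f0 : f 0 = 0 by apply: (addIr (f 0)); rewrite -fD !add0r.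
have fZ a x : f (a *: x) = a * f x by have := lf a x 0; rewrite f0 !addr0.
pose g x := complex.Re (f x); pose J x := hn x ^+ 2 - 2 * g x.
have gD x y : g (x + y) = g x + g y by rewrite /g fD cReD.
have gZ t x : g (t%:C *: x) = t * g x by rewrite /g fZ cReMr.
have gb x : g x <= c * hn x by rewrite (le_trans (Re_le_cmod _)).
have Jlb x : - c ^+ 2 <= J x.
  have := gb x; rewrite /J; have := hn_ge0 x; have := sqr_ge0 (hn x - c); nra.
have hE : has_inf (range J).
  by split; [exists (J 0), 0|exists (- c ^+ 2) => _ [x _ <-]].
pose m := inf (range J).
have mJ x : m <= J x by apply: ge_inf; [case: hE|exists x].
have /choice[x_ hx] : forall n : nat, exists x, J x <= m + n.+1%:R^-1.
  move=> n; have e0 : 0 < n.+1%:R^-1 :> R by rewrite invr_gt0.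
  by have [_ [x _ <-] /ltW] := inf_adherent e0 hE; exists x.
(* Parallelogram law, with the midpoint of [x_ p] and [x_ q] as competitor for the infimum. *)
have hJ p q : hn (x_ p - x_ q) ^+ 2 <= 2 * p.+1%:R^-1 + 2 * q.+1%:R^-1.
  have := mJ ((2^-1)%:C *: (x_ p + x_ q)); rewrite {1}/J gZ gD hnZr.
  rewrite ger0_norm ?invr_ge0 // exprMn hn_sqrB hn_sqrD.
  have := hx p; have := hx q; rewrite /J.
  have -> : 2^-1 ^+ 2 = 4^-1 :> R by field.
  by move: (p.+1%:R^-1) (q.+1%:R^-1) => *; lra.
have [z hz] : exists z, hcvg x_ z.
  apply: hcomplete => e e0.
  have [N hN] := @invS_le _ (e ^+ 2 / 4) (divr_gt0 (exprn_gt0 2 e0) (ltr0Sn _ _)).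
  exists N => p q /hN hp /hN hq.
  apply: le_of_sqr; first exact: ltW.
  rewrite (le_trans (hJ p q)) //; move: hp hq.
  by move: (p.+1%:R^-1) (q.+1%:R^-1) => *; lra.
have key v : g v = rip v z.
  apply/eqP; rewrite -subr_eq0 -oppr_eq0 opprB; apply/eqP.
  apply: (@real_affine_ge0 (hn v ^+ 2)); first exact: sqr_ge0.
  move=> t; rewrite leNgt; apply/negP; set D := (X in X < 0) => D0.
  have D1 : 0 < - D by rewrite oppr_gt0.
  have k0 : 0 < 4 * (`|t| * hn v + 1).
    by rewrite mulr_gt0 // ltr_wpDl // mulr_ge0 ?hn_ge0.
  have [N hN] := hz (- D / (4 * (`|t| * hn v + 1))) (divr_gt0 D1 k0).
  have [N' hN'] := @invS_le _ (- D / 4) (divr_gt0 D1 (ltr0Sn _ _)).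
  pose n := maxn N N'.
  have := hN n (leq_maxl _ _); rewrite ler_pdivlMr // => h1.
  have h2 := hN' n (leq_maxr _ _).
  have := mJ (x_ n + t%:C *: v); rewrite /J hn_sqrD gD gZ ripZr hnZr exprMn.
  rewrite real_normK ?num_real // => h3; have := hx n; rewrite /J => h4.
  have := rip_abs (x_ n - z) (t%:C *: v); rewrite hnZr ripDl ripNl !ripZr ler_norml.
  move=> /andP[_ h5]; have hv := hn_ge0 (x_ n - z).
  rewrite (ripC z v) in h5; have tv : 0 <= `|t| * hn v by rewrite mulr_ge0 ?hn_ge0.
  suff : (0 : R) < 0 by rewrite ltxx.
  move: h1 h2 h3 h4 h5 hv tv D0; rewrite /D.
  by move: (hn (x_ n - z)) (`|t| * hn v : R) (n.+1%:R^-1 : R) => u w k *; lra.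
exists z => v; rewrite hdotE -key /g.
have -> : rip v ('i *: z) = complex.Re (f (- 'i *: v)).
  rewrite -/(g _) key /rip hdotZl hdotZr; congr (complex.Re (_ * _)).
  by rewrite conj_conjc; apply/eqP; rewrite eq_complex /= oppr0 !eqxx.
by rewrite fZ; case: (f v) => a b /=; rewrite oppr0 mul0r mulN1r opprK add0r.
Qed.

End Riesz.

Section Adjoint.
Variables (R : realType) (H : hilbert R).
Implicit Types (S T : H -> H).

Lemma adjP T : bounded_op T -> forall x y, hdot H (T x) y = hdot H x (adj T y).
Proof.
move=> /bounded_opP[lT [c c0 hT]].
suff : [set T' | forall x y, hdot H (T x) y = hdot H x (T' y)] (adj T) by [].
apply: xgetPex.
have /choice[T' hT'] : forall y, exists z, forall x, hdot H (T x) y = hdot H x z.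
  move=> y; apply: (@riesz _ _ _ (c * hn y)) => [a u v|x].
    by rewrite lT hdotDl hdotZl.
  rewrite (le_trans (cmod_hdot _ _)) // mulrAC ler_wpM2r ?hn_ge0 //.
by exists T' => x y.
Qed.

Lemma adj_unique T T' :
  (forall x y, hdot H (T x) y = hdot H x (T' y)) -> adj T = T'.
Proof.
move=> h; apply: xget_unique => // S hS.
by apply/funext => y; apply: hdotI => x; rewrite -h -hS.
Qed.

Lemma adjPr T : bounded_op T -> forall x y, hdot H (adj T x) y = hdot H x (T y).
Proof. by move=> hT x y; rewrite hdotC -adjP // -hdotC. Qed.

Lemma rip_adj T : bounded_op T -> forall x y, rip (T x) y = rip x (adj T y).
Proof. by move=> hT x y; rewrite /rip adjP. Qed.

Lemma rip_adjr T : bounded_op T -> forall x y, rip (adj T x) y = rip x (T y).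
Proof. by move=> hT x y; rewrite ripC -rip_adj // ripC. Qed.

Lemma bnd_adj T c : bounded_op T -> bnd T c -> bnd (adj T) c.
Proof.
move=> bT hT x; have [->|/negbTE n0] := eqVneq (hn (adj T x)) 0.
  by rewrite (le_trans _ (hT x)) ?hn_ge0.
have p0 : 0 < hn (adj T x) by rewrite lt_def n0 hn_ge0.
rewrite -(ler_pM2r p0) -expr2 -ripxx rip_adjr //.
by rewrite (le_trans (rip_le _ _)) // mulrC [leRHS]mulrAC ler_wpM2r ?hn_ge0.
Qed.

Lemma linear_adj T : bounded_op T -> linear (adj T).
Proof.
move=> bT a x y; apply: hdotI => z.
by rewrite hdotDr hdotZr -!adjP // hdotDr hdotZr.
Qed.

Lemma bop_adj T : bounded_op T -> bounded_op (adj T).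
Proof.
move=> bT; have [c c0 hT] := bop_bnd bT.
exact: bop_of (linear_adj bT) (bnd_adj bT hT).
Qed.

Lemma adjK T : bounded_op T -> adj (adj T) = T.
Proof. by move=> bT; apply: adj_unique => x y; rewrite adjPr. Qed.

Lemma adj_comp S T : bounded_op S -> bounded_op T -> adj (S \o T) = adj T \o adj S.
Proof. by move=> bS bT; apply: adj_unique => x y /=; rewrite -!adjP. Qed.

Lemma adj_lin a S T : bounded_op S -> bounded_op T ->
  adj (a *: S + T) = (a^*)%R *: adj S + adj T.
Proof.
move=> bS bT; apply: adj_unique => x y.
rewrite -[(a *: S + T) x]/(a *: S x + T x).
rewrite -[((a^*)%R *: adj S + adj T) y]/((a^*)%R *: adj S y + adj T y).
by rewrite hdotDl hdotZl hdotDr hdotZr conjCK !adjP.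
Qed.

Lemma adj0 : adj (0 : H -> H) = 0.
Proof. by apply: adj_unique => x y /=; rewrite hdot0l hdot0r. Qed.

Lemma adj_id : adj (@idfun H) = idfun.
Proof. exact: adj_unique. Qed.

Lemma adjD S T : bounded_op S -> bounded_op T -> adj (S + T) = adj S + adj T.
Proof. by move=> bS bT; rewrite -[S]scale1r adj_lin // conjC1 !scale1r. Qed.

Lemma hn_comp_adj T x : bounded_op T -> hn (T x) ^+ 2 = rip x (adj T (T x)).
Proof. by move=> bT; rewrite -ripxx rip_adj. Qed.

End Adjoint.

(** * Norm limits and fixed points of operators *)

Lemma geometric_le (R : realType) (k C e : R) : 0 <= k -> k < 1 -> 0 < e ->
  exists N, forall n, (N <= n)%N -> C * k ^+ n <= e.
Proof.
move=> k0 k1 e0; have : geometric C k @ \oo --> 0.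
  by apply: cvg_geometric; rewrite ger0_norm.
move=> /(@cvgrPdist_le _ _ _ _) /(_ e e0) [N _ hN]; exists N => n /hN /=.
by rewrite sub0r normrN; apply: le_trans; rewrite ler_norm.
Qed.

Section OpLimits.
Variables (R : realType) (H K : hilbert R).
Implicit Types S T : H -> K.

Lemma op_eq S T (C : R) : (forall e : R, 0 < e -> bnd (S - T) (e * C)) -> S = T.
Proof.
move=> h; apply/funext => x; apply/eqP; rewrite -subr_eq0; apply/eqP.
by apply: (@hn_lim0 _ _ _ (C * hn x)) => e /h/(_ x); rewrite mulrA.
Qed.

Lemma bndBC S T c : bnd (S - T) c -> bnd (T - S) c.
Proof. by move=> h x; rewrite -[(T - S) x]/(T x - S x) hnBC; apply: h. Qed.

Lemma bnd_trans U S T c d :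
  bnd (S - U) c -> bnd ((U : H -> K) - T) d -> bnd (S - T) (c + d).
Proof.
move=> h h' x; rewrite (le_trans (hnBD (U x) (S x) (T x))) // mulrDl.
by apply: lerD; [apply: h|apply: h'].
Qed.

Lemma bndK S T c d : bnd (T - S) d -> bnd S c -> bnd T (c + d).
Proof.
by move=> h h'; rewrite -(subrK S T) addrC; apply: bndD.
Qed.

Lemma bnd_lim T c : (forall e : R, 0 < e -> exists2 S, bnd S c & bnd (T - S) e) ->
  bnd T c.
Proof.
move=> h x; apply/ler_addgt0Pr => e e0.
have x0 : 0 < hn x + 1 by rewrite ltr_wpDl ?hn_ge0.
have [S hS hTS] := h _ (divr_gt0 e0 x0).
have := bndK hTS hS x; rewrite mulrDl => /le_trans; apply.
rewrite lerD2l mulrAC ler_pdivrMr // ler_pM2l //; lra.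
Qed.

End OpLimits.

Section OpClosed.
Variables (R : realType) (H : hilbert R).
Implicit Types (S T : H -> H) (A : set (H -> H)).

Lemma op_closedP A T : op_norm_closed A -> bounded_op T ->
  (forall e : R, 0 < e -> exists2 S, A S & bnd (T - S) e) -> A T.
Proof.
move=> cA bT h; apply: cA => // e /h[S AS hS]; exists S => // x.
by rewrite !hnE -rmorphM /= lecR; apply: hS.
Qed.

Lemma op_complete (T_ : nat -> H -> H) : (forall n, bounded_op (T_ n)) ->
  (forall e : R, 0 < e -> exists N, forall m n, (N <= m)%N -> (N <= n)%N ->
     bnd (T_ m - T_ n) e) ->
  exists2 T, bounded_op T & forall e : R, 0 < e ->
    exists N, forall n, (N <= n)%N -> bnd (T_ n - T) e.
Proof.
move=> bT cT.
have /choice[T hT] : forall x, exists z, hcvg (fun n => T_ n x) z.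
  move=> x; apply: hcomplete => e e0.
  have x0 : 0 < hn x + 1 by rewrite ltr_wpDl ?hn_ge0.
  have [N hN] := cT _ (divr_gt0 e0 x0); exists N => m n hm hn'.
  rewrite (le_trans (hN m n hm hn' x)) // mulrAC ler_pdivrMr // ler_pM2l //; lra.
have uT e : 0 < e -> exists N, forall n, (N <= n)%N -> bnd (T_ n - T) e.
  move=> e0; have [N hN] := cT e e0; exists N => n Nn x.
  apply/ler_addgt0Pr => d d0; have [M hM] := hT x d d0.
  rewrite (le_trans (hnBD (T_ (maxn N M) x) _ _)) // lerD //.
    by apply: hN => //; apply: leq_maxl.
  by apply: hM; apply: leq_maxr.
exists T => //.
have [N hN] := uT 1 ltr01.
have [c c0 hc] := bop_bnd (bT N).
have hb : bnd T (c + 1) by apply: bndK hc; apply/bndBC/hN.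
apply: bop_of hb => a x y; apply/eqP; rewrite -subr_eq0; apply/eqP.
apply: (@hn_lim0 _ _ _ (1 + cmod a + 1)) => e e0.
have [N0 h0] := hT (a *: x + y) e e0; have [N1 h1] := hT x e e0.
have [N2 h2] := hT y e e0; pose n := maxn N0 (maxn N1 N2).
have n0 : (N0 <= n)%N by rewrite leq_maxl.
have n1 : (N1 <= n)%N by rewrite /n maxnA leq_max leq_maxr.
have n2 : (N2 <= n)%N by rewrite /n !leq_max leqnn !orbT.
rewrite (le_trans (hnBD (T_ n (a *: x + y)) _ _)) // hnBC.
have -> : T_ n (a *: x + y) - (a *: T x + T y) =
   a *: (T_ n x - T x) + (T_ n y - T y).
  by rewrite (bop_linear (bT n)) opprD addrACA scalerBr.
rewrite !mulrDr mulr1 -addrA lerD ?h0 // (le_trans (hnD _ _)) // lerD ?h2 //.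
by rewrite hnZ mulrC ler_wpM2r ?cmod_ge0 // h1.
Qed.

Lemma op_geo_lim A (s_ : nat -> H -> H) (C k : R) : A `<=` bounded_op (H:=H) ->
  op_norm_closed A -> 0 <= C -> 0 <= k -> k < 1 ->
  (forall n, A (s_ n)) -> (forall n, bnd (s_ n.+1 - s_ n) (C * k ^+ n)) ->
  exists2 s, A s & forall e : R, 0 < e ->
    exists N, forall n, (N <= n)%N -> bnd (s_ n - s) e.
Proof.
move=> bA cA C0 k0 k1 As hs.
have k1' : 0 < 1 - k by lra.
have hd n m : bnd (s_ (n + m)%N - s_ n) (C / (1 - k) * k ^+ n).
  elim: m n => [|m IH] n.
    rewrite addn0 subrr; apply: bnd_le (@bnd0 _ H H).
    by rewrite !mulr_ge0 ?invr_ge0 ?exprn_ge0 // ltW.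
  have := bnd_trans (IH n.+1) (hs n); rewrite addSnnS; apply: bnd_le.
  rewrite exprS le_eqVlt; apply/orP; left; apply/eqP; field; exact: lt0r_neq0.
have [s bs hlim] : exists2 s, bounded_op s & forall e : R, 0 < e ->
    exists N, forall n, (N <= n)%N -> bnd (s_ n - s) e.
  apply: op_complete => [n|e e0]; first exact: bA.
  have [N hN] := geometric_le (C / (1 - k)) k0 k1 e0; exists N => m n Nm Nn.
  have [le|/ltnW le] := leqP n m.
    by rewrite -(subnKC le); apply: bnd_le (hd n _); apply: hN.
  by apply: bndBC; rewrite -(subnKC le); apply: bnd_le (hd m _); apply: hN.
exists s => //; apply: op_closedP => // e e0.
have [N hN] := hlim e e0; exists (s_ N) => //.
by apply: bndBC; apply: hN.
Qed.

(** The contraction principle inside a norm-closed set of operators. The predicate [P], closed under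
    norm limits, carries the bound under which [F] contracts, so that quadratic equations can be
    solved without leaving the algebra. *)
Lemma op_fixpoint A (P : (H -> H) -> Prop) (F : (H -> H) -> H -> H) (k : R) :
  A `<=` bounded_op (H:=H) -> op_norm_closed A -> A 0 -> P 0 ->
  (forall T, (forall e : R, 0 < e -> exists2 S, P S & bnd (T - S) e) -> P T) ->
  (forall T, A T -> P T -> A (F T) /\ P (F T)) -> 0 <= k -> k < 1 ->
  (forall S T (c : R), 0 <= c -> A S -> P S -> A T -> P T -> bnd (S - T) c ->
     bnd (F S - F T) (k * c)) ->
  exists T, [/\ A T, P T & F T = T].
Proof.
move=> bA cA A0 P0 cP AF k0 k1 hF.
pose s_ n := iter n F 0.
have hs n : A (s_ n) /\ P (s_ n) by elim: n => //= n [? ?]; apply: AF.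
have [c c0 hc] := bop_bnd (bA _ (hs 1%N).1).
have hd n : bnd (s_ n.+1 - s_ n) (c * k ^+ n).
  elim: n => [|n IH]; first by rewrite expr0 mulr1 /= subr0.
  rewrite exprS mulrCA.
  apply: hF => //; [by rewrite mulr_ge0 ?exprn_ge0|by have [] := hs n.+1|by have [] := hs n.+1|by have [] := hs n|by have [] := hs n].
have [s As hlim] := op_geo_lim bA cA c0 k0 k1 (fun n => (hs n).1) hd.
have Ps : P s.
  apply: cP => e /hlim[N hN]; exists (s_ N); first by have [] := hs N.
  exact/bndBC/hN.
exists s; split=> //; apply: (@op_eq _ _ _ _ _ (k + 1)) => e e0.
have [N hN] := hlim e e0; rewrite mulrDr mulr1 mulrC.
apply: (@bnd_trans _ _ _ (s_ N.+1)); last exact: hN.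
apply: hF => //; [exact: ltW|by have [] := hs N|by have [] := hs N|exact/bndBC/hN].
Qed.

Lemma op_contr_eq S T (c k : R) : 0 <= c -> 0 <= k -> k < 1 -> bnd (S - T) c ->
  (forall d, 0 <= d -> bnd (S - T) d -> bnd (S - T) (k * d)) -> S = T.
Proof.
move=> c0 k0 k1 h0 hk.
have h n : bnd (S - T) (c * k ^+ n).
  elim: n => [|n IH]; first by rewrite mulr1.
  by rewrite exprS mulrCA; apply: hk => //; rewrite mulr_ge0 ?exprn_ge0.
apply: (@op_eq _ _ _ _ _ 1) => e e0; rewrite mulr1.
by have [N hN] := geometric_le c k0 k1 e0; apply: bnd_le (h N); apply: hN.
Qed.

End OpClosed.

(** * Homomorphisms of C*-algebras *)

Section Algebras.
Variables (R : realType) (H : hilbert R) (A : set (H -> H)).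
Hypothesis algA : operator_algebra A.

Lemma oa_bop T : A T -> bounded_op T. Proof. by case: algA => h _ _ _ _; apply: h. Qed.
Lemma oa0 : A 0. Proof. by case: algA. Qed.
Lemma oa_lin a S T : A S -> A T -> A (a *: S + T).
Proof. by case: algA => _ _ h _ _; apply: h. Qed.
Lemma oa_comp S T : A S -> A T -> A (S \o T).
Proof. by case: algA => _ _ _ h _; apply: h. Qed.
Lemma oa_closed : op_norm_closed A. Proof. by case: algA. Qed.
Lemma oaD S T : A S -> A T -> A (S + T).
Proof. by move=> AS AT; rewrite -[S]scale1r; apply: oa_lin. Qed.
Lemma oaZ a T : A T -> A (a *: T).
Proof. by move=> AT; rewrite -[_ *: _]addr0; apply: oa_lin => //; apply: oa0. Qed.
Lemma oaN T : A T -> A (- T).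
Proof. by move=> AT; rewrite -scaleN1r; apply: oaZ. Qed.
Lemma oaB S T : A S -> A T -> A (S - T).
Proof. by move=> AS AT; apply: oaD => //; apply: oaN. Qed.
Lemma oa_sum (I : Type) (s : seq I) (P : pred I) (F : I -> H -> H) :
  (forall i, P i -> A (F i)) -> A (\sum_(i <- s | P i) F i).
Proof. by move=> h; elim/big_ind: _ => //; [exact: oa0|exact: oaD]. Qed.
End Algebras.

Section Homs.
Variables (R : realType) (H K : hilbert R) (A : set (H -> H)) (B : set (K -> K)).
Variable phi : (H -> H) -> (K -> K).
Hypotheses (algA : operator_algebra A) (hphi : alg_hom A B phi).

Lemma hom_in T : A T -> B (phi T). Proof. by case: hphi => h _ _; apply: h. Qed.
Lemma hom_lin a S T : A S -> A T -> phi (a *: S + T) = a *: phi S + phi T.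
Proof. by case: hphi => _ h _; apply: h. Qed.
Lemma hom_comp S T : A S -> A T -> phi (S \o T) = phi S \o phi T.
Proof. by case: hphi => _ _; apply. Qed.
Lemma homD S T : A S -> A T -> phi (S + T) = phi S + phi T.
Proof. by move=> AS AT; rewrite -[S in LHS]scale1r hom_lin // scale1r. Qed.
Lemma hom0 : phi 0 = 0.
Proof.
apply: (addIr (phi 0)); rewrite -homD ?add0r //; exact: (oa0 algA).
Qed.
Lemma homZ a T : A T -> phi (a *: T) = a *: phi T.
Proof.
move=> AT; rewrite -[a *: T]addr0 hom_lin // ?hom0 ?addr0 //; exact: (oa0 algA).
Qed.
Lemma homN T : A T -> phi (- T) = - phi T.
Proof. by move=> AT; rewrite -scaleN1r homZ // scaleN1r. Qed.
Lemma homB S T : A S -> A T -> phi (S - T) = phi S - phi T.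
Proof. by move=> AS AT; rewrite homD ?homN //; apply: oaN. Qed.
Lemma hom_sum (I : Type) (s : seq I) (P : pred I) (F : I -> H -> H) :
  (forall i, P i -> A (F i)) ->
  phi (\sum_(i <- s | P i) F i) = \sum_(i <- s | P i) phi (F i).
Proof.
move=> h; elim: s => [|i s IH]; first by rewrite !big_nil hom0.
rewrite !big_cons; case: ifP => // Pi; rewrite homD ?IH //; first exact: h.
exact: oa_sum.
Qed.
End Homs.

Section StarHoms.
Variables (R : realType) (H K : hilbert R) (A : set (H -> H)) (B : set (K -> K)).
Variable phi : (H -> H) -> (K -> K).
Hypotheses (csA : cstar_algebra A) (bB : B `<=` bounded_op (H := K)).
Hypothesis hphi : star_hom A B phi.

Let algA : operator_algebra A := csA.1.
Let bphi T : A T -> bounded_op (phi T).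
Proof. by move=> AT; apply: bB; apply: (hom_in hphi.1). Qed.
Let adjA T : A T -> A (adj T). Proof. exact: csA.2. Qed.
Let phi_adj T : A T -> phi (adj T) = adj (phi T). Proof. exact: hphi.2. Qed.

(* The solution C of 2C = T^*T + C^2 is 1 - (1 - T^*T)^(1/2); it gives
   |x|^2 - |phi(T)x|^2 = |x - phi(C)x|^2. *)
Lemma star_hom_contr T (c : R) : A T -> 0 <= c -> c < 1 -> bnd T c ->
  bnd (phi T) 1.
Proof.
move=> AT c0 c1 hT; pose N := adj T \o T.
have AN : A N by apply: oa_comp => //; apply: adjA.
pose al := c ^+ 2; have al0 : 0 <= al by apply: sqr_ge0.
have al1 : al < 1 by rewrite /al expr_lt1.
have hN : bnd N al.
  by rewrite /al expr2; apply: bnd_comp => //; apply: bnd_adj => //; apply: oa_bop AT.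
pose F (C : H -> H) : H -> H := (2^-1 : R)%:C *: (N + (C \o C)).
have FA C : A C -> A (F C).
  by move=> AC; apply: oaZ => //; apply: oaD => //; apply: oa_comp.
(* On the ball of radius [al] the square is Lipschitz with constant [2 al]; the factor 1/2 leaves
   [al < 1]. *)
have Fcontr S U d : 0 <= d -> A S -> bnd S al -> A U -> bnd U al -> bnd (S - U) d ->
    bnd (F S - F U) (al * d).
  move=> d0 AS hS AU hU hSU x.
  have -> : (F S - F U) x = (2^-1 : R)%:C *: (S ((S - U) x) + (S - U) (U x)).
    rewrite /F -[LHS]/(_ *: (N x + S (S x)) - _ *: (N x + U (U x))) -scalerBr.
    rewrite -[(S - U) x]/(S x - U x) -[(S - U) (U x)]/(S (U x) - U (U x)).
    rewrite (linearB_of (bop_linear (oa_bop algA AS))); congr (_ *: _).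
    by rewrite addrA subrK opprD addrACA subrr add0r.
  rewrite hnZr ger0_norm ?invr_ge0 // ler_pdivrMl //.
  have h1 := hS ((S - U) x); have h2 := hSU x; have h3 := hSU (U x); have h4 := hU x.
  have h5 : al * hn ((S - U) x) <= al * (d * hn x) by rewrite ler_wpM2l.
  have h6 : d * hn (U x) <= d * (al * hn x) by rewrite ler_wpM2l.
  by rewrite (le_trans (hnD _ _)) //; lra.
have [C [AC hC FC]] : exists C, [/\ A C, bnd C al & F C = C].
  apply: (op_fixpoint (k := al)) => //.
  - by move=> S; apply: oa_bop.
  - exact: oa_closed.
  - exact: oa0.
  - exact: bnd_le (@bnd0 _ H H).
  - by move=> S h; apply: bnd_lim.
  move=> S AS hS; split; first exact: FA.
  move=> x; rewrite /F -[X in hn X]/(_ *: (N x + S (S x))) hnZr.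
  rewrite ger0_norm ?invr_ge0 // ler_pdivrMl // (le_trans (hnD _ _)) //.
  have := hN x; have h1 := hS x; have := hS (S x).
  have h2 : al * hn (S x) <= al * (al * hn x) by rewrite ler_wpM2l.
  have h3 : al * (al * hn x) <= 1 * (al * hn x).
    by rewrite ler_wpM2r ?mulr_ge0 ?hn_ge0 // ltW.
  by lra.
have bC := oa_bop algA AC; have bT := oa_bop algA AT.
have FaC : F (adj C) = adj C.
  rewrite -[in RHS]FC /F -[_ *: _ in RHS]addr0 adj_lin //; last exact: bop0.
    rewrite adj0 addr0 conj_conjc conjc_real adjD //; last exact: bop_comp.
      by rewrite adj_comp // /N adj_comp ?adjK //; apply: bop_adj.
    by apply: oa_bop AN.
  by apply: bopD; [apply: oa_bop AN|apply: bop_comp].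
(* [adj C] solves the same equation under the same bound, so uniqueness of the fixed point gives
   self-adjointness. *)
have sC : C = adj C.
  have hC' := bnd_adj bC hC.
  apply: (op_contr_eq (addr_ge0 al0 al0) al0 al1 (bndB hC hC')) => d d0 hd.
  by rewrite -[X in X - _]FC -FaC; apply: Fcontr => //; apply: adjA.
have h1 := hphi.1; have bpC := bphi AC; have bpT := bphi AT.
have pN : phi N = adj (phi T) \o phi T.
  by rewrite (hom_comp h1) ?phi_adj //; apply: adjA.
have pC : phi C = (2^-1 : R)%:C *: (phi N + (phi C \o phi C)).
  have ACC : A (C \o C) by apply: oa_comp.
  have ANC : A (N + (C \o C)) by apply: oaD.
  have e1 : phi C = phi (F C) by rewrite FC.
  by rewrite {1}e1 /F (homZ algA h1 _ ANC) (homD h1 AN ACC) (hom_comp h1 AC AC).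
have spC : adj (phi C) = phi C by rewrite -phi_adj // -sC.
move=> x; rewrite mul1r; apply: le_of_sqr; first exact: hn_ge0.
have : hn (phi T x) ^+ 2 = 2 * rip x (phi C x) - hn (phi C x) ^+ 2.
  rewrite hn_comp_adj // -[adj _ _]/((adj (phi T) \o phi T) x) -pN.
  have -> : phi N x = (2 : R)%:C *: phi C x - phi C (phi C x).
    have pCx : phi C x = (2^-1 : R)%:C *: (phi N x + phi C (phi C x)) by rewrite {1}pC.
    have e2 : (2 : R)%:C * (2^-1 : R)%:C = 1.
      by rewrite -rmorphM /= mulfV ?pnatr_eq0.
    by rewrite {1}pCx scalerA e2 scale1r addrK.
  by rewrite ripDr ripZr ripNr -(rip_adjr bpC x (phi C x)) spC ripxx.
by move=> ->; have := sqr_ge0 (hn (x - phi C x)); rewrite hn_sqrB; lra.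
Qed.

(** [star_hom_contr] asks for a bound below [1], so [T] is divided by a [d] slightly above [c], and
    the excess tends to 0. *)
Lemma star_hom_bnd T (c : R) : A T -> 0 <= c -> bnd T c -> bnd (phi T) c.
Proof.
move=> AT c0 hT x; apply/ler_addgt0Pr => e e0.
have x0 : 0 < hn x + 1 by rewrite ltr_wpDl ?hn_ge0.
pose d := c + e / (hn x + 1); have e1 : 0 < e / (hn x + 1) by rewrite divr_gt0.
have d0 : 0 < d by rewrite /d; lra.
have h : bnd (phi ((d^-1)%:C *: T)) 1.
  apply: (@star_hom_contr _ (c / d)).
  - exact: oaZ.
  - by rewrite divr_ge0 // ltW.
  - by rewrite ltr_pdivrMr // mul1r /d; lra.
  move=> y; rewrite -[X in hn X]/((d^-1)%:C *: T y) hnZr ger0_norm ?invr_ge0 ?(ltW d0) //.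
  by rewrite [c / d]mulrC -mulrA ler_wpM2l ?invr_ge0 ?(ltW d0).
have := h x; rewrite (homZ algA hphi.1) // -[X in hn X]/((d^-1)%:C *: phi T x).
rewrite hnZr ger0_norm ?invr_ge0 ?(ltW d0) // mul1r ler_pdivrMl // => /le_trans; apply.
rewrite /d mulrDl lerD2l mulrAC ler_pdivrMr // ler_pM2l //; lra.
Qed.

(* T(1 + la T^*T)^{-1} is a bounded lift of an approximation of phi(T). *)
Lemma star_hom_lift T (be : R) : A T -> 0 < be -> bnd (phi T) be ->
  exists T', [/\ A T', bnd T' be & bnd (phi T - phi T') (be / 4)].
Proof.
move=> AT be0 hT.
have bT := oa_bop algA AT; have [c c0 hc] := bop_bnd bT.
have bTT := bop_comp (bop_adj bT) bT.
pose h := adj T \o T; have Ah : A h by apply: oa_comp => //; apply: adjA.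
(* With [la be^2 = 1/4] the function [t / (1 + la t^2)] never exceeds [be] and differs from [t] by
   at most [be / 4] on [[0, be]]. *)
pose la := (4 * be ^+ 2)^-1; have la0 : 0 < la.
  by rewrite invr_gt0 mulr_gt0 // exprn_gt0.
have lab : la * be ^+ 2 = 4^-1 by rewrite /la; field; rewrite gt_eqF.
(* [Y (1 + la h) = T] is solved in the form [(1 + ka) Y = T + Y (ka - la h)]. As
   [0 <= la h <= 2 ka], the last factor has norm at most [ka], and the iteration contracts by
   [ka / (1 + ka)]. *)
pose ka := la * c ^+ 2 / 2; have ka0 : 0 <= ka.
  by rewrite divr_ge0 // mulr_ge0 ?sqr_ge0 // ltW.
have ka1 : 0 < 1 + ka by lra.
pose F (Y : H -> H) : H -> H :=
  ((1 + ka)^-1)%:C *: (T + (ka%:C *: Y - la%:C *: (Y \o h))).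
have hka x : hn (ka%:C *: x - la%:C *: h x) <= ka * hn x.
  apply: le_of_sqr; first by rewrite mulr_ge0 ?hn_ge0.
  rewrite hn_sqrB !hnZr !ger0_norm ?(ltW la0) // ripZl ripZr.
  rewrite -(hn_comp_adj x bT).
  have := bnd_adj bT hc (T x); rewrite -[adj T (T x)]/(h x) => h1.
  have h2 : hn (h x) ^+ 2 <= c ^+ 2 * hn (T x) ^+ 2.
    by rewrite -exprMn ler_sqr ?nnegrE ?mulr_ge0 ?hn_ge0.
  have h3 : la ^+ 2 * hn (h x) ^+ 2 <= la ^+ 2 * (c ^+ 2 * hn (T x) ^+ 2).
    by rewrite ler_wpM2l // sqr_ge0.
  rewrite !exprMn.
  have -> : 2 * (ka * (la * hn (T x) ^+ 2)) = la ^+ 2 * (c ^+ 2 * hn (T x) ^+ 2).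
    by rewrite /ka; field.
  by lra.
have FA Y : A Y -> A (F Y).
  move=> AY; apply: oaZ => //; apply: oaD => //; apply: oaB => //; apply: oaZ => //.
  exact: oa_comp.
have [Y [AY _ FY]] : exists Y, [/\ A Y, True & F Y = Y].
  apply: (op_fixpoint (k := ka / (1 + ka))) => //.
  - by move=> S; apply: oa_bop.
  - exact: oa_closed.
  - exact: oa0.
  - by move=> S AS _; split=> //; apply: FA.
  - by rewrite divr_ge0 // ltW.
  - by rewrite ltr_pdivrMr // mul1r ltrDr.
  move=> S U d d0 AS _ AU _ hSU x.
  have lS := bop_linear (oa_bop algA AS); have lU := bop_linear (oa_bop algA AU).
  pose z := ka%:C *: x - la%:C *: h x.
  have -> : (F S - F U) x = ((1 + ka)^-1)%:C *: (S z - U z).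
    rewrite /F -[LHS]/(_ *: (T x + (ka%:C *: S x - la%:C *: S (h x)))
                     - _ *: (T x + (ka%:C *: U x - la%:C *: U (h x)))).
    rewrite -scalerBr opprD addrACA subrr add0r /z.
    by rewrite (linearB_of lS) (linearB_of lU) !(linearZ_of lS) !(linearZ_of lU).
  rewrite hnZr ger0_norm ?invr_ge0 ?(ltW ka1) // ler_pdivrMl //.
  have -> : (1 + ka) * (ka / (1 + ka) * d * hn x) = d * (ka * hn x).
    by field; rewrite gt_eqF.
  by rewrite (le_trans (hSU z)) // ler_wpM2l // hka.
have bY := oa_bop algA AY.
have eqY x : Y x + la%:C *: Y (h x) = T x.
  have : (1 + ka)%:C *: Y x = T x + (ka%:C *: Y x - la%:C *: Y (h x)).
    rewrite -[in LHS]FY -[in LHS]/(((1 + ka)^-1)%:C *: (T x + (ka%:C *: Y x - la%:C *: Y (h x)))).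
    by rewrite scalerA -rmorphM /= mulfV ?gt_eqF // scale1r.
  rewrite rmorphD /= scalerDl scale1r => e.
  apply: (addIr (ka%:C *: Y x - la%:C *: Y (h x))); rewrite -e.
  by rewrite addrACA subrr addr0.
have eqYo : Y + la%:C *: (Y \o h) = T by apply/funext => x; apply: eqY.
have sh : adj h = h by rewrite /h adj_comp ?adjK //; apply: bop_adj.
have bh : bounded_op h by [].
have eqYa z : adj Y z + la%:C *: h (adj Y z) = adj T z.
  apply: hdotI => x; rewrite -adjP // -eqY hdotDl hdotDr hdotZl hdotZr.
  have e : hdot H x (h (adj Y z)) = hdot H (Y (h x)) z.
    by rewrite -[h (adj Y z)]/((h : H -> H) _) -{1}sh -(adjP bh) (adjP bY).
  by rewrite conj_conjc conjc_real -(adjP bY) e.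
exists Y; split=> //.
  rewrite -(adjK bY); apply: bnd_adj; first exact: bop_adj.
  move=> z; apply: le_of_sqr; first by rewrite mulr_ge0 ?hn_ge0 // ltW.
  have : rip (adj Y z + la%:C *: h (adj Y z)) (adj Y z) = rip (adj T z) (adj Y z).
    by rewrite eqYa.
  rewrite ripDl ripZl ripxx (rip_adjr bT) exprMn.
  rewrite [rip (h _) _]ripC -[h (adj Y z)]/(adj T (T (adj Y z))) -(hn_comp_adj _ bT) => e1.
  have := rip_le z (T (adj Y z)); have := sqr_ge0 (2 * la * hn (T (adj Y z)) - hn z).
  rewrite -e1; set t := hn (T _); set a := hn (adj Y z); set b := hn z => h1 h2.
  have h3 : 4 * la * (a ^+ 2 + la * t ^+ 2) <= 4 * la * (b * t).
    by rewrite ler_pM2l // mulr_gt0.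
  have h4 : 4 * la * a ^+ 2 <= b ^+ 2 by lra.
  have h5 : be ^+ 2 * (4 * la * a ^+ 2) <= be ^+ 2 * b ^+ 2.
    by rewrite ler_pM2l // exprn_gt0.
  have -> // : a ^+ 2 = be ^+ 2 * (4 * la * a ^+ 2).
  rewrite mulrCA -!mulrA (mulrA la) mulrA -mulrA; rewrite (mulrC _ (a ^+ 2)).
  by transitivity (4 * (la * be ^+ 2) * a ^+ 2); [rewrite lab; field|ring].
have h1 := hphi.1; have bpT := bphi AT; have bpY := bphi AY.
have AYh : A (Y \o h) by apply: oa_comp.
have AlYh : A (la%:C *: (Y \o h)) by apply: oaZ.
have ph : phi h = adj (phi T) \o phi T.
  by rewrite /h (hom_comp h1 (adjA AT) AT) phi_adj.
have bph : bounded_op (phi h) by apply: bphi.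
have eqP' x : phi Y x + la%:C *: phi Y (phi h x) = phi T x.
  have e1 : phi Y + la%:C *: (phi Y \o phi h) = phi T.
    by rewrite -[in RHS]eqYo (homD h1 AY AlYh) (homZ algA h1 _ AYh) (hom_comp h1 AY Ah).
  by rewrite -e1.
have sph : adj (phi h) = phi h by rewrite -phi_adj // sh.
have eqPa z : adj (phi Y) z + la%:C *: phi h (adj (phi Y) z) = adj (phi T) z.
  apply: hdotI => x; rewrite -(adjP bpT) -eqP' hdotDl hdotDr hdotZl hdotZr.
  have e : hdot K x (phi h (adj (phi Y) z)) = hdot K (phi Y (phi h x)) z.
    by rewrite -{1}sph -(adjP bph) (adjP bpY).
  by rewrite conj_conjc conjc_real -(adjP bpY) e.
have bE : bounded_op (phi T - phi Y) by apply: bopB.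
rewrite -(adjK bE); apply: bnd_adj; first exact: bop_adj.
move=> z.
have -> : adj (phi T - phi Y) z = la%:C *: phi h (adj (phi Y) z).
  apply: hdotI => x; rewrite -(adjP bE) -[(phi T - phi Y) x]/(phi T x - phi Y x).
  by rewrite hdotDl hdotNl (adjP bpT) (adjP bpY) -eqPa hdotDr addrAC subrr add0r.
rewrite hnZr ger0_norm ?(ltW la0) // ph /=.
set x := adj (phi Y) z; set b := phi T in ph bpT *.
have h2 := bnd_adj bpT hT (b x); have h3 := hT x.
have h4 : hn x <= be * hn z.
  have [->|x0] := eqVneq (hn x) 0; first by rewrite mulr_ge0 ?hn_ge0 // ltW.
  have xp : 0 < hn x by rewrite lt_def x0 hn_ge0.
  rewrite -(ler_pM2r xp) -expr2.
  have : rip (x + la%:C *: phi h x) x = rip (adj b z) x by rewrite eqPa.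
  rewrite ripDl ripZl ripxx (rip_adjr bpT).
  rewrite ph [rip ((_ \o _) _) _]ripC /= -(hn_comp_adj _ bpT) => e1.
  have := rip_le z (b x); rewrite -e1 => h5.
  have h6 : 0 <= la * hn (b x) ^+ 2 by rewrite mulr_ge0 ?sqr_ge0 // ltW.
  have h7 : hn z * hn (b x) <= hn z * (be * hn x) by rewrite ler_wpM2l ?hn_ge0.
  by lra.
rewrite (le_trans (ler_wpM2l (ltW la0) h2)) //.
have h5 : be * hn (b x) <= be * (be * (be * hn z)).
  rewrite ler_wpM2l ?(ltW be0) // (le_trans h3) // ler_wpM2l ?(ltW be0) //.
rewrite (le_trans (ler_wpM2l (ltW la0) h5)) //.
have -> : la * (be * (be * (be * hn z))) = la * be ^+ 2 * (be * hn z) by ring.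
by rewrite lab; lra.
Qed.

(** Successive approximation. A preimage of an approximation may be large, so [star_hom_lift]
    replaces it by one of norm comparable to the residual [d]; the new residual
    [d / 8 + (9/8) d / 4] is below [d / 2], and the corrections sum geometrically. *)
Lemma star_hom_range_closed b : bounded_op b ->
  (forall e : R, 0 < e -> exists2 T, A T & bnd (phi T - b) e) ->
  exists2 T, A T & phi T = b.
Proof.
move=> bb hb; have h1 := hphi.1.
have [be0 be00 hbe0] := bop_bnd bb; pose be := be0 + 1.
have bep : 0 < be by rewrite /be; lra.
pose Q (n : nat) S := A S /\ bnd (b - phi S) (be / 2 ^+ n).
have step n S : exists S', Q n S -> Q n.+1 S' /\ bnd (S' - S) (2 * be * 2^-1 ^+ n).
  have [[AS hS]|nQ] := pselect (Q n S); last by exists 0 => /nQ.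
  pose d := be / 2 ^+ n; have d0 : 0 < d by rewrite divr_gt0 // exprn_gt0.
  have d80 : 0 < d / 8 by lra.
  have [a Aa ha] := hb _ d80; pose a' := a - S.
  have Aa' : A a' by apply: oaB.
  have pa' : phi a' = phi a - phi S by rewrite (homB algA h1).
  have e1 : bnd (phi a' - (b - phi S)) (d / 8).
    by rewrite pa' opprB addrA subrK.
  have e2 : bnd (phi a') (d + d / 8) by apply: bndK e1 hS.
  have d90 : 0 < d + d / 8 by lra.
  have [T [AT hT hT']] := star_hom_lift Aa' d90 e2.
  exists (S + T) => _; split; last first.
    by rewrite [S + T]addrC addrK; apply: bnd_le hT; rewrite exprVn -mulrA -/d; lra.
  split; first exact: oaD.
  rewrite (homD h1 AS AT) opprD addrA.
  apply: bnd_le (bnd_trans (bndBC e1) hT').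
  have -> : be / 2 ^+ n.+1 = d / 2 by rewrite /d exprS invfM; ring.
  by lra.
have /choice[f hf] : forall p : nat * (H -> H), exists S',
    Q p.1 p.2 -> Q p.1.+1 S' /\ bnd (S' - p.2) (2 * be * 2^-1 ^+ p.1).
  by move=> [n S]; apply: step.
pose s_ := fix s_ n := if n is m.+1 then f (m, s_ m) else (0 : H -> H).
have Qs n : Q n (s_ n).
  elim: n => [|n IH]; last by have [] := hf (n, s_ n) IH.
  split; first exact: oa0.
  rewrite /= (hom0 algA h1) subr0 expr0 divr1; apply: bnd_le hbe0; rewrite /be; lra.
have hs n : bnd (s_ n.+1 - s_ n) (2 * be * 2^-1 ^+ n).
  by have [] := hf (n, s_ n) (Qs n).
have be20 : 0 <= 2 * be by lra.
have k0 : 0 <= 2^-1 :> R by lra.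
have k1 : 2^-1 < 1 :> R by lra.
have [s As hlim] := op_geo_lim (fun T => oa_bop algA (T:=T)) (oa_closed algA)
  be20 k0 k1 (fun n => (Qs n).1) hs.
exists s => //; apply: (@op_eq _ _ _ _ _ 2) => e e0.
have [N hN] := hlim e e0; have [M hM] := geometric_le be k0 k1 e0.
pose n := maxn N M; have hn1 := hN n (leq_maxl _ _); have hn2 := hM n (leq_maxr _ _).
have [AS hS] := Qs n.
have e1 : bnd (phi s - phi (s_ n)) e.
  rewrite -(homB algA h1 As AS); apply: star_hom_bnd; [exact: oaB|exact: ltW|].
  exact: bndBC.
apply: bnd_le (bnd_trans e1 (bndBC hS)).
by move: hn2; rewrite exprVn; lra.
Qed.

End StarHoms.

(** * The Hilbert space l2(I; H) and matrices of operators *)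

Section InnerProductSubspace.
Variables (R : realType) (V : lmodType R[i]).

(** One construction for both kinds of Hilbert space built below: a subset of an ambient vector
    space with a form that is constrained on the subset only. The ambient space is [I -> H] for
    [l2], and a given Hilbert space for its separable closed subspaces. *)
Record ipsub := IpSub {
  ip_car : set V;
  ip_dot : V -> V -> R[i];
  ip_car0 : ip_car 0;
  ip_car_lin : forall (a : R[i]) x y, ip_car x -> ip_car y -> ip_car (a *: x + y);
  ip_dot_lin : forall (a : R[i]) x y z, ip_car x -> ip_car y -> ip_car z ->
    ip_dot (a *: x + y) z = a * ip_dot x z + ip_dot y z;
  ip_dotC : forall x y, ip_car x -> ip_car y -> ip_dot x y = ((ip_dot y x)^*)%R;
  ip_dot_gt0 : forall x, ip_car x -> x != 0 -> 0 < ip_dot x x;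
  ip_complete : forall x_ : nat -> V, (forall n, ip_car (x_ n)) ->
    (forall e : R, 0 < e -> exists N, forall m n, (N <= m)%N -> (N <= n)%N ->
       complex.Re (ip_dot (x_ m - x_ n) (x_ m - x_ n)) <= e ^+ 2) ->
    exists2 z, ip_car z & forall e : R, 0 < e -> exists N, forall n, (N <= n)%N ->
       complex.Re (ip_dot (x_ n - z) (x_ n - z)) <= e ^+ 2 }.

Variable D : ipsub.

Definition ip_pred : {pred V} := [pred x | `[< ip_car D x >]].

Lemma ip_predP x : reflect (ip_car D x) (x \in ip_pred).
Proof. exact: asboolP. Qed.

Lemma ip_submod : submod_closed ip_pred.
Proof.
split; first by apply/ip_predP; exact: ip_car0.
by move=> a x y /ip_predP hx /ip_predP hy; apply/ip_predP; apply: ip_car_lin.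
Qed.

HB.instance Definition _ := GRing.isSubmodClosed.Build _ _ ip_pred ip_submod.

Record ipt := Ipt { ival : V; ivalP : ival \in ip_pred }.

HB.instance Definition _ := [isSub for ival].
HB.instance Definition _ := [Choice of ipt by <:].
HB.instance Definition _ := [SubChoice_isSubLmodule of ipt by <:].

Lemma ival_car (x : ipt) : ip_car D (ival x).
Proof. exact/ip_predP/ivalP. Qed.

Definition ipd (x y : ipt) : R[i] := ip_dot D (ival x) (ival y).

Lemma ipd_lin a x y z : ipd (a *: x + y) z = a * ipd x z + ipd y z.
Proof. by apply: ip_dot_lin; apply: ival_car. Qed.

Lemma ipdC x y : ipd x y = ((ipd y x)^*)%R.
Proof. by apply: ip_dotC; apply: ival_car. Qed.

Lemma ipd_gt0 x : x != 0 -> 0 < ipd x x.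
Proof. by move=> x0; apply: ip_dot_gt0; first exact: ival_car. Qed.

Lemma ipd_bilinear : bilinear_for
  (GRing.Scale.Law.clone _ _ *%R _) (GRing.Scale.Law.clone _ _ (conjC \; *%R) _) ipd.
Proof.
split=> [z|z] a x y /=; first exact: ipd_lin.
by rewrite ipdC ipd_lin rmorphD rmorphM /= -!ipdC.
Qed.

HB.instance Definition _ := bilinear_isBilinear.Build R[i] ipt ipt R[i] _ _ ipd ipd_bilinear.
HB.instance Definition _ := @isHermitianSesquilinear.Build R[i] ipt false conjC ipd
  (fun x y => etrans (ipdC x y) (esym (etrans (congr1 ( *%R^~ _) (expr0 _)) (mul1r _)))).
HB.instance Definition _ := @isDotProduct.Build R[i] ipt ipd ipd_gt0.

Definition ipn (x : ipt) : R := Num.sqrt (complex.Re (ipd x x)).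

Lemma ipd_ge0 x : 0 <= complex.Re (ipd x x).
Proof.
have [->|/ipd_gt0/ltW] := eqVneq x 0; last by rewrite lecE => /andP[].
by rewrite linear0l.
Qed.

Lemma ipn_ge0 x : 0 <= ipn x. Proof. exact: sqrtr_ge0. Qed.

Lemma ipn_sqr x : ipn x ^+ 2 = complex.Re (ipd x x).
Proof. by rewrite sqr_sqrtr // ipd_ge0. Qed.

Lemma ipn0_eq0 x : ipn x = 0 -> x = 0.
Proof.
move=> h; apply/eqP; apply/negP => /negP /ipd_gt0; rewrite ltcE => /andP[_].
by rewrite -ipn_sqr h expr0n ltxx.
Qed.

Lemma ipdDZ (r q : R) x y :
  complex.Re (ipd (r%:C *: x + q%:C *: y) (r%:C *: x + q%:C *: y)) =
  r ^+ 2 * ipn x ^+ 2 + 2 * (r * q * complex.Re (ipd x y)) + q ^+ 2 * ipn y ^+ 2.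
Proof.
rewrite linearDl !linearD /= !linearZl_LR !linearZr_LR /= !conj_conjc !conjc_real.
rewrite !cReMr (ipdC y x) cRe_conj !ipn_sqr; ring.
Qed.

Lemma ipn_CS x y : complex.Re (ipd x y) <= ipn x * ipn y.
Proof.
have [x0|x0] := eqVneq (ipn x) 0.
  by rewrite (ipn0_eq0 x0) linear0l -(ipn0_eq0 x0) x0 mul0r.
have [y0|y0] := eqVneq (ipn y) 0.
  by rewrite (ipn0_eq0 y0) linear0r -(ipn0_eq0 y0) y0 mulr0.
have xp : 0 < ipn x by rewrite lt_def x0 ipn_ge0.
have yp : 0 < ipn y by rewrite lt_def y0 ipn_ge0.
have := ipd_ge0 ((ipn y)%:C *: x + (- ipn x)%:C *: y); rewrite ipdDZ => h.
by rewrite -(ler_pM2l (mulr_gt0 xp yp)); lra.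
Qed.

Lemma ipnD x y : ipn (x + y) <= ipn x + ipn y.
Proof.
apply: le_of_sqr; first by rewrite addr_ge0 ?ipn_ge0.
rewrite [leLHS]ipn_sqr; have := ipdDZ 1 1 x y; rewrite !scale1r => ->.
by have := ipn_CS x y; lra.
Qed.

Lemma ipnZ a x : ipn (a *: x) = cmod a * ipn x.
Proof.
apply/eqP; rewrite -(eqrXn2 (ltn0Sn 1)) ?ipn_ge0 ?mulr_ge0 ?cmod_ge0 ?ipn_ge0 //.
rewrite exprMn !ipn_sqr linearZl_LR linearZr_LR /= mulrA -normCK.
have -> : `|a| ^+ 2 = (cmod a ^+ 2)%:C by rewrite cmodE -rmorphXn.
by rewrite cReMr.
Qed.

Let normC (x : ipt) : R[i] := (ipn x)%:C.

Let normC_D x y : normC (x + y) <= normC x + normC y.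
Proof. by rewrite /normC -rmorphD lecR; apply: ipnD. Qed.

Let normC_Z a x : normC (a *: x) = `|a| * normC x.
Proof. by rewrite /normC ipnZ rmorphM /= cmodE. Qed.

Let normC_eq0 x : normC x = 0 -> x = 0.
Proof. by move=> [/ipn0_eq0]. Qed.

HB.instance Definition _ := @Lmodule_isNormed.Build R[i] ipt normC normC_D normC_Z normC_eq0.

Lemma ipt_norm (x : ipt) : `|x| = (ipn x)%:C.
Proof. by []. Qed.

Lemma ipt_seq_complete (x_ : nat -> ipt) :
  (forall e : R, 0 < e -> exists N, forall m n, (N <= m)%N -> (N <= n)%N ->
     ipn (x_ m - x_ n) <= e) ->
  exists z, forall e : R, 0 < e -> exists N, forall n, (N <= n)%N ->
     ipn (x_ n - z) <= e.
Proof.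
move=> h; have [n|e e0|z cz hz] := @ip_complete D (fun n => ival (x_ n)).
- exact: ival_car.
- have [N hN] := h e e0; exists N => m n Nm Nn.
  rewrite -[ival _ - ival _]/(ival (x_ m - x_ n)) -/(ipd _ _) -ipn_sqr.
  by rewrite ler_sqr ?nnegrE ?ipn_ge0 ?hN // ltW.
have hz' : z \in ip_pred by apply/ip_predP.
exists (Ipt hz') => e e0; have [N hN] := hz e e0; exists N => n Nn.
by apply: le_of_sqr; [exact: ltW|rewrite ipn_sqr; apply: hN].
Qed.

(** A Cauchy filter contains a ball of radius [1 / (n + 1)] for every [n]; the centres form a Cauchy
    sequence whose limit is that of the filter. *)
Lemma ipt_complete (F : set_system ipt) : ProperFilter F -> cauchy F -> cvg F.
Proof.
move=> FF /cauchyP cF.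
have eps n : (0 : R[i]) < (n.+1%:R^-1)%:C by rewrite ltcR invr_gt0.
have /choice[x_ hx] : forall n, exists x, F (ball x (n.+1%:R^-1 : R)%:C).
  by move=> n; apply: cF.
have hb x y (r : R) : ball x r%:C y -> ipn (x - y) < r.
  by rewrite -ball_normE /= ipt_norm ltcR.
have [z hz] : exists z, forall e : R, 0 < e -> exists N, forall n, (N <= n)%N ->
     ipn (x_ n - z) <= e.
  apply: ipt_seq_complete => e e0.
  have [N hN] := @invS_le _ (e / 2) (divr_gt0 e0 (ltr0Sn _ _)).
  exists N => m n /hN hm /hN hn.
  have [y [/hb h1 /hb h2]] := filter_ex (filterI (hx m) (hx n)).
  have -> : x_ m - x_ n = (x_ m - y) + (- 1) *: (x_ n - y).
    by rewrite scaleN1r opprB addrA subrK.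
  rewrite (le_trans (ipnD _ _)) // ipnZ cmodN -[cmod 1]/(cmod (1%:C)) cmod_real.
  by rewrite normr1 mul1r (le_trans (lerD (ltW h1) (ltW h2))) // (splitr e) lerD.
apply/cvg_ex; exists z; apply/cvg_ballP => e e0.
have eE : e = (complex.Re e)%:C by rewrite RRe_real // gtr0_real.
have e20 : 0 < complex.Re e / 2 by rewrite divr_gt0 // -ltcR -eE.
have [N hN] := @invS_le _ _ e20; have [M hM] := hz _ e20.
pose n := maxn N M; have h1 := hN n (leq_maxl _ _); have h2 := hM n (leq_maxr _ _).
apply: filterS (hx n) => y /hb hy.
rewrite -ball_normE /= ipt_norm eE ltcR.
have -> : z - y = (x_ n - y) + (- 1) *: (x_ n - z).
  by rewrite scaleN1r opprB [RHS]addrC addrA subrK.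
rewrite (le_lt_trans (ipnD _ _)) // ipnZ cmodN -[cmod 1]/(cmod (1%:C)) cmod_real.
by rewrite normr1 mul1r (splitr (complex.Re e)) ltr_leD // (lt_le_trans hy).
Qed.

HB.instance Definition _ := Uniform_isComplete.Build ipt ipt_complete.

Lemma ipt_hdot_norm (x : ipt) : ipd x x = `|x| ^+ 2.
Proof.
rewrite ipt_norm -rmorphXn /= ipn_sqr.
by have [->|/ipd_gt0/gtr0_real/RRe_real->//] := eqVneq x 0; rewrite linear0l.
Qed.

Definition ip_hilbert : hilbert R :=
  @Hilbert R (ipt : completeNormedModType R[i]) (ipd : {dot ipt for conjC}) ipt_hdot_norm.

End InnerProductSubspace.

Section IpHilbert.
Variables (R : realType) (V : lmodType R[i]) (D : ipsub V).

Definition ipmk v (h : ip_car D v) : ip_hilbert D :=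
  Ipt (introT (ip_predP D v) h).

Lemma ip_eq (x y : ip_hilbert D) : ival x = ival y -> x = y.
Proof. exact: val_inj. Qed.

Lemma ip_hn_sqr (x : ip_hilbert D) :
  hn x ^+ 2 = complex.Re (ip_dot D (ival x) (ival x)).
Proof. by rewrite -ripxx. Qed.

Lemma ivalD (x y : ip_hilbert D) : ival (x + y) = ival x + ival y.
Proof. by []. Qed.
Lemma ival0 : ival (0 : ip_hilbert D) = 0.
Proof. by []. Qed.
Lemma ival_sum (I : Type) (s : seq I) (P : pred I) (F : I -> ip_hilbert D) :
  ival (\sum_(i <- s | P i) F i) = \sum_(i <- s | P i) ival (F i).
Proof. exact: (big_morph _ ivalD ival0). Qed.

End IpHilbert.

(** * Unconditional sums and the space l2(I; H) *)

Section FiniteSubsetLimits.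
Variables (R : realType) (I : eqType).
Implicit Types (F G : seq I -> R[i]) (z w : R[i]).

(** Limit along the finite subsets of [I], coded as duplicate-free lists: unconditional convergence
    over an index set of any cardinality. *)
Definition finlim F z := forall e : R, 0 < e -> exists s0, uniq s0 /\
  forall s, uniq s -> {subset s0 <= s} -> cmod (F s - z) <= e.

Lemma finlim_unique F z w : finlim F z -> finlim F w -> z = w.
Proof.
move=> hz hw; apply/eqP; rewrite -subr_eq0 -normr_eq0 cmodE.
suff -> : cmod (z - w) = 0 by [].
apply/eqP; rewrite eq_le cmod_ge0 andbT; apply/ler_addgt0Pr => e e0; rewrite add0r.
have e20 : 0 < e / 2 by lra.
have [s [us hs]] := hz _ e20; have [t [ut ht]] := hw _ e20.
have h1 := hs (undup (s ++ t)) (undup_uniq _) _.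
have h2 := ht (undup (s ++ t)) (undup_uniq _) _.
have -> : z - w = (F (undup (s ++ t)) - w) - (F (undup (s ++ t)) - z).
  by ring.
rewrite (le_trans (cmodD _ _)) // cmodN (splitr e) lerD ?h1 ?h2 //.
  by move=> i it; rewrite mem_undup mem_cat it orbT.
by move=> i it; rewrite mem_undup mem_cat it.
Qed.

Lemma finlim_lin a F G z w : finlim F z -> finlim G w ->
  finlim (fun s => a * F s + G s) (a * z + w).
Proof.
move=> hz hw e e0; have a0 := cmod_ge0 a.
have e1 : 0 < e / 2 / (cmod a + 1) by rewrite !divr_gt0 // ltr_wpDl.
have e2 : 0 < e / 2 by lra.
have [s [us hs]] := hz _ e1; have [t [ut ht]] := hw _ e2.
exists (undup (s ++ t)); split=> [|r ur hr]; first exact: undup_uniq.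
have {}hs := hs r ur _; have {}ht := ht r ur _.
rewrite opprD addrACA -mulrBr (le_trans (cmodD _ _)) // (splitr e) lerD //.
  rewrite cmodM (le_trans (ler_wpM2l a0 (hs _))) //.
    by move=> i it; apply: hr; rewrite mem_undup mem_cat it.
  rewrite mulrA ler_pdivrMr ?ltr_wpDl // mulrC ler_pM2l //; lra.
by apply: ht => i it; apply: hr; rewrite mem_undup mem_cat it orbT.
Qed.

Lemma finlim_eq F G z : (forall s, F s = G s) -> finlim F z -> finlim G z.
Proof. by move=> h hF; rewrite (_ : G = F) //; apply/funext => s; rewrite h. Qed.

Lemma cl0 : finlim (fun=> 0) 0.
Proof. by move=> e e0; exists [::]; split=> // s _ _; rewrite subrr cmod0 ltW. Qed.

Lemma finlim_conj F z : finlim F z -> finlim (fun s => ((F s)^*)%R) ((z^*)%R).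
Proof.
move=> hF e /hF[s [us hs]]; exists s; split=> // t ut hst.
by rewrite -rmorphB /cmod norm_conjC; apply: hs.
Qed.

Lemma finlim_monotone (f : I -> R) c : (forall i, 0 <= f i) ->
  (forall s, uniq s -> \sum_(i <- s) f i <= c) ->
  let E := [set x | exists2 s, uniq s & x = \sum_(i <- s) f i] in
  (forall s, uniq s -> \sum_(i <- s) f i <= sup E) /\
  finlim (fun s => (\sum_(i <- s) f i)%:C) (sup E)%:C.
Proof.
move=> f0 fc E.
have hE : has_sup E.
  split; first by exists 0, [::] => //; rewrite big_nil.
  by exists c => _ [s us ->]; apply: fc.
have lE s : uniq s -> \sum_(i <- s) f i <= sup E.
  by move=> us; apply: ub_le_sup; [case: hE|exists s].
split=> // e e0; have [_ [s us ->] hs] := sup_adherent e0 hE.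
exists s; split=> // t ut st; rewrite -rmorphB cmod_real distrC ger0_norm ?subr_ge0 ?lE //.
suff : \sum_(i <- s) f i <= \sum_(i <- t) f i by move: hs; lra.
have pe : perm_eq t (s ++ [seq i <- t | i \notin s]).
  apply: uniq_perm => //; first rewrite cat_uniq us filter_uniq // andbT /=.
    by apply/hasPn => i; rewrite mem_filter => /andP[].
  move=> i; rewrite mem_cat mem_filter; case: (boolP (i \in s)) => //= /st ->//.
by rewrite [leRHS](perm_big _ pe) big_cat lerDl sumr_ge0.
Qed.

End FiniteSubsetLimits.

Section L2.
Variables (R : realType) (I : choiceType) (H : hilbert R).
Implicit Types (f g : I -> H) (s : seq I).

Definition l2_car : set (I -> H) :=
  [set f | exists c : R, forall s, uniq s -> \sum_(i <- s) hn (f i) ^+ 2 <= c].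

Definition l2_psum f g s := \sum_(i <- s) hdot H (f i) (g i).

Definition l2_dot f g : R[i] := xget 0 [set z | finlim (l2_psum f g) z].

Lemma l2_car_lin (a : R[i]) f g : l2_car f -> l2_car g -> l2_car (a *: f + g).
Proof.
move=> [c hc] [d hd]; exists (2 * cmod a ^+ 2 * c + 2 * d) => s us.
have h : \sum_(i <- s) hn ((a *: f + g) i) ^+ 2 <=
    2 * cmod a ^+ 2 * (\sum_(i <- s) hn (f i) ^+ 2) + 2 * \sum_(i <- s) hn (g i) ^+ 2.
  rewrite !mulr_sumr -big_split /=; apply: ler_sum => i _.
  rewrite -[(a *: f + g) i]/(a *: f i + g i) -mulrA -exprMn -hnZ.
  have := rip_le (a *: f i) (g i); rewrite hn_sqrD => h1.
  have := sqr_ge0 (hn (a *: f i) - hn (g i)); lra.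
apply: le_trans h _; apply: lerD; last by rewrite ler_pM2l ?hd.
by rewrite ler_wpM2l ?hc // mulr_ge0 ?sqr_ge0.
Qed.

Lemma l2_car0 : l2_car 0.
Proof.
exists 0 => s _; rewrite big1 // => i _.
by rewrite -[(0 : I -> H) i]/(0 : H) hn0 expr0n.
Qed.

Definition l2_n2 f := sup [set x : R | exists2 s, uniq s & x = \sum_(i <- s) hn (f i) ^+ 2].

Lemma l2_n2P f : l2_car f ->
  (forall s, uniq s -> \sum_(i <- s) hn (f i) ^+ 2 <= l2_n2 f) /\
  finlim (fun s => (\sum_(i <- s) hn (f i) ^+ 2)%:C) (l2_n2 f)%:C.
Proof. by move=> [c hc]; apply: finlim_monotone hc => i; apply: sqr_ge0. Qed.

(** Polarisation reduces the pairing to sums of squared norms, which converge by monotonicity. *)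
Lemma l2_dotP f g : l2_car f -> l2_car g -> finlim (l2_psum f g) (l2_dot f g).
Proof.
move=> cf cg; suff [z hz] : exists z, finlim (l2_psum f g) z.
  by rewrite /l2_dot; case: xgetP => // /(_ z).
pose ig := (fun i => 'i *: g i : H).
have cig : l2_car ig.
  have -> : ig = 'i *: g + 0 by rewrite addr0.
  by apply: l2_car_lin => //; apply: l2_car0.
have cfg : l2_car (f + g) by rewrite -[f]scale1r; apply: l2_car_lin.
have cfig : l2_car (f + ig) by rewrite -[f]scale1r; apply: l2_car_lin.
have [_ h1] := l2_n2P cf; have [_ h2] := l2_n2P cg.
have [_ h3] := l2_n2P cfg; have [_ h4] := l2_n2P cfig; have [_ h5] := l2_n2P cig.
pose k : R[i] := 2^-1; pose j : R[i] := 'i * 2^-1.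
have := finlim_lin k h3 (finlim_lin (- k) h1 (finlim_lin (- k) h2 (finlim_lin j h4
  (finlim_lin (- j) h1 (finlim_lin (- j) h5 (@cl0 R I)))))).
move=> h; eexists; apply: finlim_eq h => s.
rewrite /l2_psum !rmorph_sum /= !mulr_sumr addr0 -!big_split /=; apply: eq_bigr => i _.
rewrite -[(f + g) i]/(f i + g i) -[(f + ig) i]/(f i + 'i *: g i) -/(ig i) !hn_sqrD.
rewrite hdotE /ig; move: (rip _ _) (rip _ _) (hn _) (hn _) (hn _) => a b p q r.
rewrite [RHS]complexE /=.
have c2 : (2 : R)%:C = 2 by rewrite rmorph_nat.
rewrite !rmorphD !rmorphM /= c2 complexiE /k /j.
have t2 : (2 : R[i]) != 0 by rewrite pnatr_eq0.
by field.
Qed.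

Lemma l2_dotE f g z : l2_car f -> l2_car g -> finlim (l2_psum f g) z -> l2_dot f g = z.
Proof. by move=> cf cg; apply: finlim_unique; apply: l2_dotP. Qed.

Lemma l2_dot_self f : l2_car f -> l2_dot f f = (l2_n2 f)%:C.
Proof.
move=> cf; apply: l2_dotE => //; have [_] := l2_n2P cf; apply: finlim_eq => s.
by rewrite rmorph_sum; apply: eq_bigr => i _; rewrite hdotxx.
Qed.

Lemma l2_dot_lin (a : R[i]) f g h : l2_car f -> l2_car g -> l2_car h ->
  l2_dot (a *: f + g) h = a * l2_dot f h + l2_dot g h.
Proof.
move=> cf cg ch; apply: l2_dotE => //; first exact: l2_car_lin.
apply: finlim_eq (finlim_lin a (l2_dotP cf ch) (l2_dotP cg ch)) => s.
rewrite /l2_psum mulr_sumr -big_split /=; apply: eq_bigr => i _.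
by rewrite -[(a *: f + g) i]/(a *: f i + g i) hdotDl hdotZl.
Qed.

Lemma l2_dotC f g : l2_car f -> l2_car g -> l2_dot f g = ((l2_dot g f)^*)%R.
Proof.
move=> cf cg; apply: l2_dotE => //; apply: finlim_eq (finlim_conj (l2_dotP cg cf)) => s.
by rewrite /l2_psum rmorph_sum; apply: eq_bigr => i _; rewrite [RHS]hdotC.
Qed.

Lemma l2_dot_gt0 f : l2_car f -> f != 0 -> 0 < l2_dot f f.
Proof.
move=> cf f0; rewrite l2_dot_self // ltcR.
have [i fi0] : exists i, f i != 0.
  apply: contrapT => h; case/negP: f0; apply/eqP/funext => i.
  by apply/eqP/negP => /negP fi0; apply: h; exists i.
have [/(_ [:: i] isT)] := l2_n2P cf; rewrite big_seq1 => h _.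
apply: lt_le_trans h; rewrite exprn_even_gt0 //=.
by apply: contra fi0 => /eqP/hn_eq0/eqP.
Qed.

Lemma l2_complete (f_ : nat -> I -> H) : (forall n, l2_car (f_ n)) ->
  (forall e : R, 0 < e -> exists N, forall m n, (N <= m)%N -> (N <= n)%N ->
     complex.Re (l2_dot (f_ m - f_ n) (f_ m - f_ n)) <= e ^+ 2) ->
  exists2 f, l2_car f & forall e : R, 0 < e -> exists N, forall n, (N <= n)%N ->
     complex.Re (l2_dot (f_ n - f) (f_ n - f)) <= e ^+ 2.
Proof.
move=> cf hf.
have carB f g : l2_car f -> l2_car g -> l2_car (f - g).
  by move=> h1 h2; rewrite addrC -scaleN1r; apply: l2_car_lin.
have {}hf e : 0 < e -> exists N, forall m n, (N <= m)%N -> (N <= n)%N ->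
    forall s, uniq s -> \sum_(i <- s) hn (f_ m i - f_ n i) ^+ 2 <= e ^+ 2.
  move=> /hf[N hN]; exists N => m n Nm Nn s us; apply: le_trans (hN m n Nm Nn).
  rewrite l2_dot_self; last exact: carB.
  by have [/(_ s us)] := l2_n2P (carB _ _ (cf m) (cf n)).
have hfi e i : 0 < e -> exists N, forall m n, (N <= m)%N -> (N <= n)%N ->
    hn (f_ m i - f_ n i) <= e.
  move=> e0; have [N hN] := hf e e0; exists N => m n Nm Nn.
  have := hN m n Nm Nn [:: i] isT; rewrite big_seq1; apply: le_of_sqr.
  exact: ltW.
have /choice[f hcf] : forall i, exists z, hcvg (fun n => f_ n i) z.
  by move=> i; apply: hcomplete => e; apply: hfi.
have key e : 0 < e -> exists N, forall n, (N <= n)%N ->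
    forall s, uniq s -> \sum_(i <- s) hn (f_ n i - f i) ^+ 2 <= e ^+ 2.
  move=> e0; have [N hN] := hf e e0; exists N => n Nn s us.
  apply/ler_addgt0Pr => d d0.
  have p0 : 0 < 2 * e + 1 by lra.
  have s0 : 0 < (size s)%:R + 1 :> R by rewrite ltr_wpDl.
  (* For [y <= e] and [dl <= 1], replacing [y] by [y + dl] raises the square by at most
     [dl (2 e + 1)]; the choice makes the total over [s] at most [d]. *)
  pose dl := Num.min 1 (d / (2 * e + 1) / ((size s)%:R + 1)).
  have dl0 : 0 < dl by rewrite lt_min ltr01 !divr_gt0.
  have dl1 : dl <= 1 by rewrite ge_min lexx.
  have dl2 : dl * (2 * e + 1) * (size s)%:R <= d.
    have : dl <= d / (2 * e + 1) / ((size s)%:R + 1) by rewrite ge_min lexx orbT.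
    rewrite !ler_pdivlMr // => h; apply: le_trans h.
    have : 0 <= dl * (2 * e + 1) by rewrite mulr_ge0 ?ltW.
    by lra.
  have [M hM] : exists M, forall m, (M <= m)%N ->
      {in s, forall i, hn (f_ m i - f i) <= dl}.
    elim: s {us s0 dl2 dl dl0 dl1} (dl) (dl0) => [|i s IH] dl dl0; first by exists 0%N.
    have [M hM] := IH dl dl0; have [M' hM'] := hcf i dl dl0.
    exists (maxn M M') => m; rewrite geq_max => /andP[h1 h2] j.
    by rewrite inE => /orP[/eqP->|/(hM m h1)//]; apply: hM'.
  pose m := maxn N M.
  have h1 := hN n m Nn (leq_maxl _ _) s us.
  rewrite (le_trans _ (lerD h1 dl2)) //.
  have -> : dl * (2 * e + 1) * (size s)%:R = \sum_(i <- s) dl * (2 * e + 1).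
    by rewrite big_const_seq count_predT iter_addr_0 mulr_natr.
  rewrite -big_split /= big_seq [leRHS]big_seq; apply: ler_sum => i si.
  have h2 := hM m (leq_maxr _ _) i si.
  have h3 : hn (f_ n i - f_ m i) <= e.
    have := hN n m Nn (leq_maxl _ _) [:: i] isT; rewrite big_seq1.
    by apply: le_of_sqr; apply: ltW.
  have := hnBD (f_ m i) (f_ n i) (f i).
  move: h2 h3 (hn_ge0 (f_ n i - f_ m i)) (hn_ge0 (f_ n i - f i)).
  set x : R := hn (f_ n i - f i); set y : R := hn (f_ n i - f_ m i).
  set z : R := hn (f_ m i - f i) => zd ye y0 x0 xyz.
  have : x ^+ 2 <= (y + dl) ^+ 2.
    by rewrite ler_sqr ?nnegrE //; lra.
  have h4 : y * dl <= e * dl by rewrite ler_pM2r.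
  have h5 : dl * dl <= 1 * dl by rewrite ler_pM2r.
  by lra.
have carf n : (exists N, forall s, uniq s -> \sum_(i <- s) hn (f_ n i - f i) ^+ 2 <= N) ->
    l2_car (f_ n - f).
  by move=> [c hc]; exists c.
have [N0 h0] := key 1 ltr01.
have cfd : l2_car (f_ N0 - f) by apply: carf; exists (1 ^+ 2); apply: h0.
have cff : l2_car f by rewrite -(subKr (f_ N0) f); apply: carB.
exists f => // e e0; have [N hN] := key e e0; exists N => n Nn.
rewrite l2_dot_self; last exact: carB.
apply: ge_sup; first by exists 0, [::] => //; rewrite big_nil.
by move=> _ [s us ->]; apply: hN.
Qed.

Definition l2_ip : ipsub (I -> H) :=
  IpSub l2_car0 l2_car_lin l2_dot_lin l2_dotC l2_dot_gt0 l2_complete.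

Definition l2 : hilbert R := ip_hilbert l2_ip.

End L2.

Section L2Basics.
Variables (R : realType) (I : choiceType) (H : hilbert R).
Local Notation l2H := (l2 I H).
Implicit Types (F G : l2H).

Definition l2v F : I -> H := ival F.
Arguments l2v : simpl never.

Lemma l2_car_of F : l2_car (l2v F).
Proof. exact: (@ival_car _ _ (l2_ip I H)). Qed.

Lemma l2_eq F G : (forall i, l2v F i = l2v G i) -> F = G.
Proof. by move=> h; apply/ip_eq/funext. Qed.

Lemma l2vD F G i : l2v (F + G) i = l2v F i + l2v G i. Proof. by []. Qed.
Lemma l2vB F G i : l2v (F - G) i = l2v F i - l2v G i. Proof. by []. Qed.
Lemma l2vZ a F i : l2v (a *: F) i = a *: l2v F i. Proof. by []. Qed.
Lemma l2v0 i : l2v (0 : l2H) i = 0. Proof. by []. Qed.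
Lemma l2v_sum (J : Type) (s : seq J) (P : pred J) (F : J -> l2H) i :
  l2v (\sum_(j <- s | P j) F j) i = \sum_(j <- s | P j) l2v (F j) i.
Proof. by rewrite /l2v ival_sum fct_sum. Qed.

Lemma l2_hdot_cl F G : finlim (l2_psum (l2v F) (l2v G)) (hdot l2H F G).
Proof. by apply: l2_dotP; apply: l2_car_of. Qed.

Lemma l2_hn2 F : hn F ^+ 2 = l2_n2 (l2v F).
Proof. by rewrite ip_hn_sqr /= l2_dot_self //; apply: l2_car_of. Qed.

Lemma l2_hn_ge F s : uniq s -> \sum_(i <- s) hn (l2v F i) ^+ 2 <= hn F ^+ 2.
Proof. by rewrite l2_hn2; have [+ _] := l2_n2P (l2_car_of F); apply. Qed.

Lemma l2_hn_le F (c : R) : (forall s, uniq s -> \sum_(i <- s) hn (l2v F i) ^+ 2 <= c) ->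
  hn F ^+ 2 <= c.
Proof.
move=> h; rewrite l2_hn2; apply: ge_sup; first by exists 0, [::] => //; rewrite big_nil.
by move=> _ [s us ->]; apply: h.
Qed.

Lemma l2_hdot_disj F G : (forall i, l2v F i = 0 \/ l2v G i = 0) -> hdot l2H F G = 0.
Proof.
move=> h; apply: (finlim_unique (l2_hdot_cl F G)); apply: finlim_eq (@cl0 R I) => s.
rewrite /l2_psum big1 // => i _; have [->|->] := h i; first by rewrite hdot0l.
by rewrite hdot0r.
Qed.

Lemma l2_del_car (i : I) (x : H) : l2_car (fun j => if j == i then x else 0).
Proof.
exists (hn x ^+ 2) => s us; have [si|nsi] := boolP (i \in s).
  rewrite (bigD1_seq i) //= eqxx big1 ?addr0 // => j /negbTE ->.
  by rewrite hn0 expr0n.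
rewrite big_seq big1 ?sqr_ge0 // => j js; case: eqP => [ji|_].
  by rewrite -ji js in nsi.
by rewrite hn0 expr0n.
Qed.

Definition l2_del i x : l2H := ipmk (l2_del_car i x : ip_car (l2_ip I H) _).

Lemma l2_delE i x j : l2v (l2_del i x) j = if j == i then x else 0.
Proof. by []. Qed.

Lemma l2_del_lin i : linear (l2_del i).
Proof.
move=> a x y; apply: l2_eq => j; rewrite l2vD l2vZ !l2_delE.
by case: eqP; rewrite // scaler0 addr0.
Qed.

Lemma l2_hdot_del i x F : hdot l2H (l2_del i x) F = hdot H x (l2v F i).
Proof.
apply: (finlim_unique (l2_hdot_cl _ F)) => e e0; exists [:: i]; split=> // s us si.
have si' : i \in s by apply: si; rewrite mem_head.
have -> : l2_psum (l2v (l2_del i x)) (l2v F) s = hdot H x (l2v F i).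
  rewrite /l2_psum (bigD1_seq i si' us) l2_delE eqxx big1 /= ?addr0 //.
  by move=> j /negbTE ji; rewrite l2_delE ji hdot0l.
by rewrite subrr cmod0 (ltW e0).
Qed.

Lemma hn_l2_del i x : hn (l2_del i x) = hn x.
Proof.
apply/eqP; rewrite -(eqrXn2 (ltn0Sn 1)) ?hn_ge0 //.
by rewrite -!ripxx /rip l2_hdot_del l2_delE eqxx.
Qed.

Lemma hn_l2v F i : hn (l2v F i) <= hn F.
Proof.
apply: le_of_sqr; first exact: hn_ge0.
by have := @l2_hn_ge F [:: i] isT; rewrite big_seq1.
Qed.

End L2Basics.
Arguments l2v : simpl never.


(** * Operators induced by partial injections *)

Section PartialInjections.
Variables (R : realType) (I : choiceType) (H : hilbert R).

(** Vertex projections, edge partial isometries and unitaries of the combinatorial representation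
    all act by composition with a partial injection, cut off outside its domain. Boundedness and
    adjoints are thus proved once. *)
Record pinj := Pinj {
  pdom : pred I; pfun : I -> I; pcod : pred I; pbwd : I -> I;
  pfunK : forall i, pdom i -> pcod (pfun i) /\ pbwd (pfun i) = i;
  pbwdK : forall j, pcod j -> pdom (pbwd j) /\ pfun (pbwd j) = j }.

Definition pinv p := Pinj (@pbwdK p) (@pfunK p).

Lemma pio_car p (F : l2 I H) :
  l2_car (fun i => if pdom p i then l2v F (pfun p i) else 0).
Proof.
exists (hn F ^+ 2) => s us.
have -> : \sum_(i <- s) hn (if pdom p i then l2v F (pfun p i) else 0) ^+ 2 =
   \sum_(j <- [seq pfun p i | i <- s & pdom p i]) hn (l2v F j) ^+ 2.
  rewrite [RHS]big_map [RHS]big_filter [RHS]big_mkcond /=; apply: eq_bigr => i _.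
  by case: ifP => // _; rewrite hn0 expr0n.
apply: l2_hn_ge; rewrite map_inj_in_uniq ?filter_uniq // => i j.
rewrite !mem_filter => /andP[pi _] /andP[pj _] e.
by have [_ <-] := pfunK pi; have [_ <-] := pfunK pj; rewrite e.
Qed.

Definition pio p F : l2 I H := ipmk (pio_car p F : ip_car (l2_ip I H) _).

Lemma pioE p F i : l2v (pio p F) i = if pdom p i then l2v F (pfun p i) else 0.
Proof. by []. Qed.

Lemma pio_lin p : linear (pio p).
Proof.
move=> a F G; apply: l2_eq => i; rewrite l2vD l2vZ !pioE.
by case: ifP => // _; rewrite scaler0 addr0.
Qed.

Lemma pio_bnd p : bnd (pio p) 1.
Proof.
move=> F; rewrite mul1r; apply: le_of_sqr; first exact: hn_ge0.
apply: l2_hn_le => s us.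
have -> : \sum_(i <- s) hn (l2v (pio p F) i) ^+ 2 =
   \sum_(j <- [seq pfun p i | i <- s & pdom p i]) hn (l2v F j) ^+ 2.
  rewrite [RHS]big_map [RHS]big_filter [RHS]big_mkcond /=; apply: eq_bigr => i _.
  by rewrite pioE; case: ifP => // _; rewrite hn0 expr0n.
apply: l2_hn_ge; rewrite map_inj_in_uniq ?filter_uniq // => i j.
rewrite !mem_filter => /andP[pi _] /andP[pj _] e.
by have [_ <-] := pfunK pi; have [_ <-] := pfunK pj; rewrite e.
Qed.

Lemma pio_bop p : bounded_op (pio p).
Proof. exact: bop_of (@pio_lin p) (@pio_bnd p). Qed.

Lemma pio_hdot p F G : hdot (l2 I H) (pio p F) G = hdot (l2 I H) F (pio (pinv p) G).
Proof.
apply: (finlim_unique (l2_hdot_cl (pio p F) G)) => e e0.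
have [s0 [us0 hs0]] := l2_hdot_cl F (pio (pinv p) G) e0.
exists [seq pbwd p j | j <- s0 & pcod p j]; split.
  rewrite map_inj_in_uniq ?filter_uniq // => i j.
  rewrite !mem_filter => /andP[pi _] /andP[pj _] e'.
  by have [_ <-] := pbwdK pi; have [_ <-] := pbwdK pj; rewrite e'.
move=> s us hs.
(* [t] is the image of [s], completed by the points of [s0] outside the codomain, where the terms
   vanish; so it contains [s0] and has the same partial sum. *)
pose t := [seq pfun p i | i <- s & pdom p i] ++ [seq j <- s0 | ~~ pcod p j].
have -> : l2_psum (l2v (pio p F)) (l2v G) s =
          l2_psum (l2v F) (l2v (pio (pinv p) G)) t.
  rewrite /l2_psum big_cat /= [X in _ + X]big_filter [X in _ + X]big1 ?addr0; last first.
    by move=> j /negbTE; rewrite pioE /= => ->; rewrite hdot0r.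
  rewrite [RHS]big_map [RHS]big_filter [RHS]big_mkcond /=; apply: eq_bigr => i _.
  rewrite pioE; case: ifP => pi; last by rewrite hdot0l.
  by rewrite pioE /=; have [-> ->] := pfunK pi.
apply: hs0.
  rewrite cat_uniq filter_uniq // andbT map_inj_in_uniq ?filter_uniq //=.
    apply/hasPn => j; rewrite mem_filter => /andP[qj _]; apply/mapP => -[k].
    by rewrite mem_filter => /andP[/pfunK[pk _] _] ej; rewrite ej pk in qj.
  move=> i j; rewrite !mem_filter => /andP[pi _] /andP[pj _] e'.
  by have [_ <-] := pfunK pi; have [_ <-] := pfunK pj; rewrite e'.
move=> j js; rewrite mem_cat mem_filter js andbT; case: (boolP (pcod p j)) => qj.
  rewrite orbF; apply/mapP; have [pj ej] := pbwdK qj.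
  exists (pbwd p j) => //; rewrite mem_filter pj /=; apply: hs.
  by apply/mapP; exists j; rewrite // mem_filter qj.
by rewrite orbT.
Qed.

Lemma pio_adj p : adj (pio p) = pio (pinv p).
Proof. exact: adj_unique (@pio_hdot p). Qed.

End PartialInjections.

(** * Matrices of operators as operators on finite multiples *)

Section FiniteL2.
Variables (R : realType) (I : finType) (H : hilbert R).
Implicit Types (x y : I -> H) (F G : l2 I H).

Lemma l2_fin_car x : l2_car x.
Proof.
exists (\sum_i hn (x i) ^+ 2) => s us.
rewrite (big_uniq _ us) /= [leRHS](bigID [in s]) /= lerDl.
by rewrite sumr_ge0 // => i _; apply: sqr_ge0.
Qed.

Definition vec x : l2 I H := ipmk (l2_fin_car x : ip_car (l2_ip I H) _).

Lemma vecE x i : l2v (vec x) i = x i. Proof. by []. Qed.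

Lemma l2_hdot_fin F G : hdot (l2 I H) F G = \sum_i hdot H (l2v F i) (l2v G i).
Proof.
apply: (finlim_unique (l2_hdot_cl F G)) => e e0; exists (index_enum I).
split; first exact: index_enum_uniq.
move=> s us hs; rewrite /l2_psum.
have pe : perm_eq s (index_enum I).
  by apply: uniq_perm => //; [exact: index_enum_uniq|move=> i; rewrite mem_index_enum hs // mem_index_enum].
by rewrite (perm_big _ pe) /= subrr cmod0 (ltW e0).
Qed.

Lemma l2_hn_fin F : hn F ^+ 2 = \sum_i hn (l2v F i) ^+ 2.
Proof.
by rewrite -ripxx /rip l2_hdot_fin cRe_sum; apply: eq_bigr => i _; rewrite hdotxx.
Qed.

Lemma vec_decomp F : F = \sum_i l2_del i (l2v F i).
Proof.
apply: l2_eq => j; rewrite l2v_sum (bigD1 j) //= l2_delE eqxx big1 ?addr0 // => i ij.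
by rewrite l2_delE eq_sym (negbTE ij).
Qed.

End FiniteL2.

Section Amplification.
Variables (R : realType) (n : nat) (H : hilbert R).
Local Notation Hn := (l2 'I_n H).
Implicit Types (T S : Hn -> Hn) (M N : 'M[H -> H]_n).

Definition mx2op M : Hn -> Hn := fun x => vec (fun i => \sum_j M i j (l2v x j)).

Definition opmx T i j : H -> H := fun h => l2v (T (l2_del j h)) i.

Definition mxbnd M (c : R) := forall x : 'I_n -> H,
  \sum_i hn (\sum_j M i j (x j)) ^+ 2 <= c ^+ 2 * \sum_j hn (x j) ^+ 2.

Lemma mx2opE M x i : l2v (mx2op M x) i = \sum_j M i j (l2v x j).
Proof. by []. Qed.

Lemma mxbndP M c : 0 <= c -> mxbnd M c <-> bnd (mx2op M) c.
Proof.
move=> c0; split=> h x.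
  apply: le_of_sqr; first by rewrite mulr_ge0 ?hn_ge0.
  by rewrite exprMn !l2_hn_fin; apply: h.
have := h (vec x); rewrite -(ler_pXn2r (ltn0Sn 1)) ?nnegrE ?mulr_ge0 ?hn_ge0 //.
by rewrite exprMn !l2_hn_fin.
Qed.

Lemma mx2op_lin M : (forall i j, linear (M i j)) -> linear (mx2op M).
Proof.
move=> lM a x y; apply: l2_eq => i; rewrite l2vD l2vZ !mx2opE scaler_sumr -big_split /=.
by apply: eq_bigr => j _; rewrite l2vD l2vZ lM.
Qed.

Lemma mx2op_bop M : (forall i j, bounded_op (M i j)) -> bounded_op (mx2op M).
Proof.
move=> bM; have /choice[c hc] : forall ij : 'I_n * 'I_n, exists c : R, 0 <= c /\ bnd (M ij.1 ij.2) c.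
  by move=> [i j]; have [c] := bop_bnd (bM i j); exists c.
pose C := \sum_i (\sum_j c (i, j)) ^+ 2.
apply: (@bop_of _ _ _ (Num.sqrt C)); first by apply: mx2op_lin => i j; apply: bop_linear.
have C0 : 0 <= C by apply: sumr_ge0 => i _; apply: sqr_ge0.
move=> x; apply: le_of_sqr; first by rewrite mulr_ge0 ?sqrtr_ge0 ?hn_ge0.
rewrite exprMn (sqr_sqrtr C0) l2_hn_fin mulr_suml; apply: ler_sum => i _.
have s0 : 0 <= \sum_j c (i, j) by apply: sumr_ge0 => j _; have [] := hc (i, j).
rewrite -exprMn ler_sqr ?nnegrE ?hn_ge0 ?mulr_ge0 ?hn_ge0 //.
rewrite mx2opE (le_trans (hn_sum _ _ _)) // mulr_suml; apply: ler_sum => j _.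
have [c0 hij] := hc (i, j); rewrite (le_trans (hij _)) // ler_wpM2l // hn_l2v //.
Qed.

Lemma opmxE T x i : linear T -> l2v (T x) i = \sum_j opmx T i j (l2v x j).
Proof.
by move=> lT; rewrite {1}(vec_decomp x) (linear_sum_of lT) l2v_sum.
Qed.

Lemma mx2opK M i j : (forall i j, linear (M i j)) -> opmx (mx2op M) i j = M i j.
Proof.
move=> lM; apply/funext => h; rewrite /opmx mx2opE (bigD1 j) //= l2_delE eqxx.
by rewrite big1 ?addr0 // => k /negbTE kj; rewrite l2_delE kj (linear0_of (lM _ _)).
Qed.

Lemma opmx_lin (a : R[i]) S T i j : opmx (a *: S + T) i j = a *: opmx S i j + opmx T i j.
Proof. by []. Qed.

Lemma opmx_comp S T i j : linear S ->
  opmx (S \o T) i j = \sum_k (opmx S i k \o opmx T k j).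
Proof.
by move=> lS; apply/funext => h; rewrite fct_sum /opmx /= (opmxE _ _ lS).
Qed.

Lemma opmx_bnd T c i j : bnd T c -> bnd (opmx T i j) c.
Proof. by move=> hT h; rewrite -(hn_l2_del j h) (le_trans (hn_l2v _ _)). Qed.

Lemma opmx_bop T i j : bounded_op T -> bounded_op (opmx T i j).
Proof.
move=> bT; have [c _ hc] := bop_bnd bT; apply: bop_of (opmx_bnd i j hc) => a x y.
by rewrite /opmx l2_del_lin (bop_linear bT).
Qed.

Lemma opmx_adj T i j : bounded_op T -> opmx (adj T) i j = adj (opmx T j i).
Proof.
move=> bT; apply/esym/adj_unique => x y; rewrite /opmx.
by rewrite [LHS]hdotC -(l2_hdot_del j) -hdotC (adjP bT) l2_hdot_del.
Qed.

Section MxAlgebra.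
Variable (A : set (H -> H)).
Hypothesis csA : cstar_algebra A.

Definition mxalg : set (Hn -> Hn) :=
  [set T | bounded_op T /\ forall i j, A (opmx T i j)].

Lemma mxalg_cstar : cstar_algebra mxalg.
Proof.
have [algA adjA] := csA; split; first split.
- by move=> T [].
- by split=> [|i j]; [exact: bop0|apply: (oa0 algA)].
- move=> a S T [bS AS] [bT AT]; split=> [|i j]; first exact: bop_lin.
  by rewrite opmx_lin; apply: oa_lin.
- move=> S T [bS AS] [bT AT]; split=> [|i j]; first exact: bop_comp.
  rewrite (opmx_comp _ _ _ (bop_linear bS)).
  by apply: oa_sum => // k _; apply: oa_comp.
- move=> T bT hT; split=> // i j; apply: (oa_closed algA); first exact: opmx_bop.
  move=> e /hT[S [bS AS] hS]; exists (opmx S i j) => // x.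
  rewrite /opmx -l2vB !hnE -rmorphM /= lecR.
  rewrite -(hn_l2_del j x) (le_trans (hn_l2v _ _)) //.
  by rewrite -lecR rmorphM /= -!hnE; apply: hS.
move=> T [bT AT]; split=> [|i j]; first exact: bop_adj.
by rewrite opmx_adj //; apply: adjA.
Qed.

End MxAlgebra.

End Amplification.

(** The infimum in [mx_opnorm] is attained, so norm comparisons become comparisons of [mxbnd] with
    no loss of constants. *)
Lemma mx_opnorm_le (R : realType) (n : nat) (H : hilbert R) (M : 'M[H -> H]_n) (c : R) :
  (forall i j, bounded_op (M i j)) -> 0 <= c -> (mx_opnorm M <= c) <-> mxbnd M c.
Proof.
move=> bM c0; rewrite /mx_opnorm; set E := [set c | _].
have eN (J : finType) (y : J -> H) : \sum_i `|y i| ^+ 2 = (\sum_i hn (y i) ^+ 2)%:C.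
  by rewrite rmorph_sum; apply: eq_bigr => k _; rewrite hnE rmorphXn.
have EP d : E d <-> 0 <= d /\ mxbnd M d.
  split=> -[d0 h]; split=> // x; have := h x.
    by rewrite !eN -rmorphXn -rmorphM lecR.
  by rewrite !eN -rmorphXn -rmorphM lecR.
have hE : has_inf E.
  have [d d0 hd] := bop_bnd (mx2op_bop bM).
  by split; [exists d; apply/EP; split=> //; apply/mxbndP|exists 0 => e /EP[]].
split=> [h x|h]; last by apply: ge_inf; [case: hE|apply/EP].
pose N := \sum_j hn (x j) ^+ 2.
have N0 : 0 <= N by apply: sumr_ge0 => j _; apply: sqr_ge0.
apply/ler_addgt0Pr => e e0.
have k0 : 0 < (2 * c + 1) * (N + 1) by rewrite mulr_gt0; lra.
pose d := Num.min 1 (e / ((2 * c + 1) * (N + 1))).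
have d0 : 0 < d by rewrite lt_min ltr01 divr_gt0.
have d1 : d <= 1 by rewrite ge_min lexx.
have d2 : d * ((2 * c + 1) * (N + 1)) <= e.
  by rewrite -ler_pdivlMr // ge_min lexx orbT.
have [b /EP[b0 /(_ x)] hb hbd] := inf_adherent d0 hE.
have bc : b <= c + d by lra.
apply: le_trans hb _; rewrite -/N.
have h1 : b ^+ 2 <= (c + d) ^+ 2 by rewrite ler_sqr ?nnegrE //; lra.
have h2 : b ^+ 2 * N <= (c + d) ^+ 2 * N by rewrite ler_wpM2r.
have h3 : d * d <= 1 * d by rewrite ler_pM2r.
have h4 : (d * d) * N <= 1 * d * N by rewrite ler_wpM2r.
have h5 : 0 <= d * (2 * c + 1) by rewrite mulr_ge0; lra.
by lra.
Qed.

Section CompletelyContractive.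
Variables (R : realType) (H K : hilbert R) (A : set (H -> H)) (B : set (K -> K)).
Variable phi : (H -> H) -> (K -> K).
Hypotheses (csA : cstar_algebra A) (bB : B `<=` bounded_op (H := K)).
Hypothesis hphi : star_hom A B phi.

(** Matrices over [A] form a C*-algebra on [l2 'I_n H], on which [phi] applied entrywise is again a
    *-homomorphism; contractivity of that map is the claim. *)
Lemma star_hom_mxbnd n (M : 'M[H -> H]_n) (c : R) : 0 <= c ->
  (forall i j, A (M i j)) -> mxbnd M c -> mxbnd (map_mx phi M) c.
Proof.
move=> c0 AM /(mxbndP _ c0) hM; apply/(mxbndP _ c0).
have algA := csA.1; have h1 := hphi.1.
have bM i j : bounded_op (M i j) by apply: oa_bop (AM i j).
have bphi T : A T -> bounded_op (phi T) by move=> AT; apply/bB/(hom_in h1).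
pose psi (T : l2 'I_n H -> l2 'I_n H) := mx2op (\matrix_(i, j) phi (opmx T i j)).
have bpsi T i j : mxalg A T -> bounded_op ((\matrix_(i, j) phi (opmx T i j)) i j).
  by move=> [_ AT]; rewrite mxE; apply: bphi.
have hpsi : star_hom (mxalg A) (@bounded_op _ (l2 'I_n K)) psi.
  split; first split.
  - by move=> T AT; apply: mx2op_bop => i j; apply: bpsi.
  - move=> a S T [bS AS] [bT AT]; apply/funext => x; apply: l2_eq => i.
    rewrite -[(a *: psi S + psi T) x]/(a *: psi S x + psi T x) l2vD l2vZ !mx2opE.
    rewrite scaler_sumr -big_split /=; apply: eq_bigr => j _; rewrite !mxE.
    by rewrite opmx_lin (hom_lin h1).
  - move=> S T [bS AS] [bT AT]; apply/funext => x; apply: l2_eq => i /=.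
    rewrite !mx2opE.
    under eq_bigr => j _.
      rewrite mxE (opmx_comp _ _ _ (bop_linear bS)) (hom_sum algA h1); last first.
        by move=> k _; apply: oa_comp.
      rewrite fct_sum; under eq_bigr => k _ do rewrite (hom_comp h1) //=.
      over.
    rewrite exchange_big /=; apply: eq_bigr => k _; rewrite mx2opE mxE.
    rewrite (linear_sum_of (bop_linear (bphi _ (AS i k)))).
    by apply: eq_bigr => j _; rewrite mxE.
  move=> T AT; apply/esym/adj_unique => x y; have [bT AT'] := AT.
  rewrite !l2_hdot_fin.
  under eq_bigr => i _ do rewrite mx2opE hdot_suml.
  under [RHS]eq_bigr => i _ do rewrite mx2opE hdot_sumr.
  rewrite exchange_big /=; apply: eq_bigr => i _; apply: eq_bigr => j _.
  by rewrite !mxE opmx_adj // hphi.2 // adjP //; apply: bphi.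
have AM' : mxalg A (mx2op M).
  split=> [|i j]; first exact: mx2op_bop.
  by rewrite mx2opK // => ? ?; apply: bop_linear.
have := star_hom_bnd (mxalg_cstar n csA) (fun T h => h) hpsi AM' c0 hM.
rewrite /psi; congr (bnd (mx2op _) c).
apply/matrixP => i j; rewrite !mxE mx2opK // => ? ?; exact: bop_linear.
Qed.

End CompletelyContractive.

Lemma bnd_inf (R : realType) (H K : hilbert R) (T : H -> K) (c : R) :
  (forall d : R, 0 < d -> bnd T (c + d)) -> bnd T c.
Proof.
move=> h x; apply/ler_addgt0Pr => e e0.
have x0 : 0 < hn x + 1 by rewrite ltr_wpDl ?hn_ge0.
have := h _ (divr_gt0 e0 x0) x; rewrite mulrDl => /le_trans; apply.
rewrite lerD2l mulrAC ler_pdivrMr // ler_pM2l //; lra.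
Qed.

Lemma mx2op_bnd (R : realType) (H : hilbert R) n (M : 'M[H -> H]_n) (e : R) :
  0 <= e -> (forall i j, bnd (M i j) e) -> bnd (mx2op M) (n%:R * n%:R * e).
Proof.
move=> e0 hM x; have n0 : 0 <= n%:R :> R by [].
have x0 := hn_ge0 x.
have h0 : 0 <= n%:R * n%:R * e * hn x by rewrite !mulr_ge0.
apply: le_of_sqr => //; rewrite l2_hn_fin.
have hi i : hn (l2v (mx2op M x) i) <= n%:R * e * hn x.
  rewrite mx2opE (le_trans (hn_sum _ _ _)) //.
  apply: (@le_trans _ _ (\sum_(j < n) e * hn x)); last first.
    by rewrite sumr_const card_ord -[leLHS]mulr_natl mulrA.
  apply: ler_sum => j _; rewrite (le_trans (hM i j _)) //.
  by rewrite ler_wpM2l // hn_l2v.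
apply: (@le_trans _ _ (\sum_(i < n) (n%:R * e * hn x) ^+ 2)).
  by apply: ler_sum => i _; rewrite ler_sqr ?nnegrE ?hn_ge0 ?mulr_ge0.
rewrite sumr_const card_ord -[leLHS]mulr_natl.
have -> : (n%:R * n%:R * e * hn x) ^+ 2 = n%:R * (n%:R * (n%:R * e * hn x) ^+ 2) :> R.
  by ring.
have [n00|n1] := posnP n.
  by have -> : n%:R = 0 :> R; [rewrite n00|rewrite !mul0r].
by rewrite ler_wpM2l // ler_peMl ?sqr_ge0 // ler1n.
Qed.

(** * Homomorphisms determined on generators *)

Section PairAlgebra.
Variables (R : realType) (H K : hilbert R).
Variable G : (H -> H) -> (K -> K) -> Prop.

(* The graph of the homomorphism determined by G, as soon as it is known to be
   norm decreasing. *)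
Inductive palg : (H -> H) -> (K -> K) -> Prop :=
| palg_gen S T : G S T -> palg S T
| palg0 : palg 0 0
| palg_lin (a : R[i]) S S' T T' :
    palg S S' -> palg T T' -> palg (a *: S + T) (a *: S' + T')
| palg_comp S S' T T' : palg S S' -> palg T T' -> palg (S \o T) (S' \o T').

(** The closure of the graph in the product: a single pair of [palg] has to approximate both
    components at once. *)
Definition pcl T T' := [/\ bounded_op T, bounded_op T' &
  forall e : R, 0 < e -> exists S S', [/\ palg S S', bnd (T - S) e & bnd (T' - S') e]].

Definition pairdom := [set T | exists T', pcl T T'].

Definition pfunc T := xget 0 [set T' | pcl T T'].

Hypothesis G_bop : forall S T, G S T -> bounded_op S /\ bounded_op T.

Lemma palg_bop S T : palg S T -> bounded_op S /\ bounded_op T.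
Proof.
elim=> [{}S {}T /G_bop//| |a {}S S' {}T T' _ [h1 h2] _ [h3 h4]|
        {}S S' {}T T' _ [h1 h2] _ [h3 h4]].
- by split; apply: bop0.
- by split; apply: bop_lin.
- by split; apply: bop_comp.
Qed.

Lemma palgB S S' T T' : palg S S' -> palg T T' -> palg (S - T) (S' - T').
Proof.
move=> h h'; rewrite addrC -[- T]scaleN1r [S' - T']addrC -[- T']scaleN1r; exact: palg_lin.
Qed.

Lemma palg_pcl S T : palg S T -> pcl S T.
Proof.
move=> h; have [bS bT] := palg_bop h; split=> // e e0; exists S, T; split=> //.
  by rewrite subrr; apply: bnd_le (ltW e0) (@bnd0 _ _ _).
by rewrite subrr; apply: bnd_le (ltW e0) (@bnd0 _ _ _).
Qed.

Lemma pcl_lin a S S' T T' : pcl S S' -> pcl T T' -> pcl (a *: S + T) (a *: S' + T').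
Proof.
move=> [bS bS' hS] [bT bT' hT]; split; try exact: bop_lin.
move=> e e0; have a0 : 0 < cmod a + 1 by rewrite ltr_wpDl ?cmod_ge0.
have e1 : 0 < e / (cmod a + 1) by rewrite divr_gt0.
have [U [U' [pU hU hU']]] := hS _ e1; have [W [W' [pW hW hW']]] := hT _ e1.
exists (a *: U + W), (a *: U' + W'); split; first exact: palg_lin.
  have -> : a *: S + T - (a *: U + W) = a *: (S - U) + (T - W).
    by rewrite scalerBr opprD addrACA.
  apply: bnd_le (bnd_lin a hU hW); rewrite -[X in _ + X]mul1r -mulrDl mulrC divfK //.
  by rewrite gt_eqF.
have -> : a *: S' + T' - (a *: U' + W') = a *: (S' - U') + (T' - W').
  by rewrite scalerBr opprD addrACA.
apply: bnd_le (bnd_lin a hU' hW'); rewrite -[X in _ + X]mul1r -mulrDl mulrC divfK //.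
by rewrite gt_eqF.
Qed.

Lemma pclB S S' T T' : pcl S S' -> pcl T T' -> pcl (S - T) (S' - T').
Proof.
move=> h h'; rewrite addrC -[- T]scaleN1r [S' - T']addrC -[- T']scaleN1r; exact: pcl_lin.
Qed.

Lemma comp_approx (L : hilbert R) (S U T W : L -> L) (c d e : R) : bounded_op S -> 0 <= c -> 0 <= d ->
  0 <= e -> e <= 1 -> bnd S c -> bnd T d -> bnd (S - U) e -> bnd (T - W) e ->
  bnd ((S \o T) - (U \o W)) ((c + d + 1) * e).
Proof.
move=> bS c0 d0 e0 e1 hS hT hSU hTW x.
have -> : ((S \o T) - (U \o W)) x = S ((T - W) x) + (S - U) (W x).
  rewrite -[LHS]/(S (T x) - U (W x)) -[(T - W) x]/(T x - W x).
  by rewrite (linearB_of (bop_linear bS)) -[(S - U) (W x)]/(S (W x) - U (W x)) addrA subrK.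
have hW : hn (W x) <= (d + e) * hn x by apply: (bndK (bndBC hTW) hT).
rewrite (le_trans (hnD _ _)) //.
have x0 := hn_ge0 x.
have h1 : hn (S ((T - W) x)) <= c * (e * hn x).
  by rewrite (le_trans (hS _)) // ler_wpM2l.
have h2 : hn ((S - U) (W x)) <= e * ((d + e) * hn x).
  by rewrite (le_trans (hSU _)) // ler_wpM2l.
have h3 : e * (e * hn x) <= 1 * (e * hn x) by rewrite ler_wpM2r // mulr_ge0.
by lra.
Qed.

Lemma pcl_comp S S' T T' : pcl S S' -> pcl T T' -> pcl (S \o T) (S' \o T').
Proof.
move=> [bS bS' hS] [bT bT' hT]; split; try exact: bop_comp.
move=> e e0; have [c c0 hc] := bop_bnd bS; have [c' c0' hc'] := bop_bnd bS'.
have [d d0 hd] := bop_bnd bT; have [d' d0' hd'] := bop_bnd bT'.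
pose k := c + d + (c' + d') + 1; have k0 : 0 < k by rewrite /k; lra.
pose e1 := Num.min 1 (e / k).
have e10 : 0 < e1 by rewrite lt_min ltr01 divr_gt0.
have e11 : e1 <= 1 by rewrite ge_min lexx.
have e12 : k * e1 <= e by rewrite mulrC -ler_pdivlMr // ge_min lexx orbT.
have [U [U' [pU hU hU']]] := hS _ e10; have [W [W' [pW hW hW']]] := hT _ e10.
exists (U \o W), (U' \o W'); split; first exact: palg_comp.
  apply: bnd_le (comp_approx bS c0 d0 (ltW e10) e11 hc hd hU hW).
  rewrite (le_trans _ e12) // ler_pM2r // /k; lra.
apply: bnd_le (comp_approx bS' c0' d0' (ltW e10) e11 hc' hd' hU' hW').
rewrite (le_trans _ e12) // ler_pM2r // /k; lra.
Qed.

Lemma pcl_mem (B : set (K -> K)) T T' : operator_algebra B ->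
  (forall S S', G S S' -> B S') -> pcl T T' -> B T'.
Proof.
move=> aB gB [_ bT' h]; apply: (op_closedP (oa_closed aB) bT') => e /h[S [S' [pS _ hS']]].
exists S' => //; elim: pS => {S S' hS'} [S S' /gB//| |a S S' U U' _ h1 _ h2|
    S S' U U' _ h1 _ h2]; [exact: oa0|exact: oa_lin|exact: oa_comp].
Qed.

Section Dominated.
Hypothesis dom : forall S S' (c : R), palg S S' -> 0 <= c -> bnd S c -> bnd S' c.

Lemma pcl_bnd T T' (c : R) : pcl T T' -> 0 <= c -> bnd T c -> bnd T' c.
Proof.
move=> [bT bT' h] c0 hT; apply: bnd_inf => d d0.
have d20 : 0 < d / 2 by lra.
have [S [S' [pS hS hS']]] := h _ d20.
have h1 : bnd S (c + d / 2) by apply: bndK hT; apply: bndBC.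
have cd : 0 <= c + d / 2 by lra.
have := bndK hS' (dom pS cd h1); rewrite -addrA -splitr.
by [].
Qed.

(** The difference of the two values is paired with [0], and domination makes it vanish: the closed
    graph is still a graph. *)
Lemma pcl_unique T T1 T2 : pcl T T1 -> pcl T T2 -> T1 = T2.
Proof.
move=> h1 h2; have := pclB h1 h2; rewrite subrr => /pcl_bnd/(_ (lexx 0) (@bnd0 _ _ _)).
move=> h; apply: (@op_eq _ _ _ _ _ 0) => e _; by rewrite mulr0.
Qed.

Lemma pcl_complete T : bounded_op T ->
  (forall e : R, 0 < e -> exists S S', palg S S' /\ bnd (T - S) e) ->
  exists T', pcl T T'.
Proof.
move=> bT hT.
have /choice[f hf] : forall n : nat, exists SS : (H -> H) * (K -> K),
    palg SS.1 SS.2 /\ bnd (T - SS.1) (n.+1%:R^-1 : R).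
  move=> n; have [|S [S' h]] := hT (n.+1%:R^-1); first by rewrite invr_gt0.
  by exists (S, S').
have [T' bT' hT'] : exists2 T', bounded_op T' & forall e : R, 0 < e ->
    exists N, forall n, (N <= n)%N -> bnd ((f n).2 - T') e.
  apply: op_complete => [n|e e0]; first by have [/palg_bop[]] := hf n.
  have e20 : 0 < e / 2 by lra.
  have [N hN] := invS_le e20; exists N => m n /hN hm /hN hn'.
  have [pm bm] := hf m; have [pn bn] := hf n.
  apply: (dom (palgB pm pn)); first exact: ltW.
  apply: bnd_le (bnd_trans (bndBC bm) bn).
  by rewrite (splitr e) lerD.
exists T'; split=> // e e0.
have [N hN] := hT' e e0; have [M hM] := invS_le e0.
pose n := maxn N M; have [pn bn] := hf n; exists (f n).1, (f n).2; split=> //.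
  by apply: bnd_le bn; apply: hM; apply: leq_maxr.
by apply: bndBC; apply: hN; apply: leq_maxl.
Qed.

Lemma pairdom_closed T : bounded_op T ->
  (forall e : R, 0 < e -> exists2 S, pairdom S & bnd (T - S) e) -> pairdom T.
Proof.
move=> bT hT; apply: pcl_complete => // e e0.
have e20 : 0 < e / 2 by lra.
have [S [S' [_ _ hS]] hTS] := hT _ e20.
have [U [U' [pU hSU _]]] := hS _ e20; exists U, U'; split=> //.
by rewrite (splitr e); apply: bnd_trans hTS hSU.
Qed.

Lemma pairdom_alg : operator_algebra pairdom.
Proof.
split.
- by move=> T [T' []].
- by exists 0; apply/palg_pcl/palg0.
- by move=> a S T [S' hS] [T' hT]; exists (a *: S' + T'); apply: pcl_lin.
- by move=> S T [S' hS] [T' hT]; exists (S' \o T'); apply: pcl_comp.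
move=> T bT hT; apply: pairdom_closed => // e /hT[S pS hS]; exists S => // x.
by rewrite -lecR rmorphM /= -!hnE; apply: hS.
Qed.

Lemma pairdom_generated : pairdom = algebra_generated [set S | exists T, G S T].
Proof.
apply/seteqP; split=> [T [T' [bT bT' h]] A [aA gA]|T]; last first.
  by apply; split; [exact: pairdom_alg|move=> S [S' /palg_gen/palg_pcl]; exists S'].
apply: (op_closedP (oa_closed aA) bT) => e /h[S [S' [pS hS _]]].
exists S => //; elim: pS => {S S' hS} [S S' gS| |a S S' U U' _ h1 _ h2|
    S S' U U' _ h1 _ h2].
- by apply: gA; exists S'.
- exact: oa0.
- exact: oa_lin.
- exact: oa_comp.
Qed.

Lemma pfuncP T : pairdom T -> pcl T (pfunc T).
Proof. by move=> [T' h]; rewrite /pfunc; case: xgetP => // /(_ T'). Qed.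

Lemma pfuncE T T' : pcl T T' -> pfunc T = T'.
Proof. by move=> h; apply: (@pcl_unique T) => //; apply: pfuncP; exists T'. Qed.

Lemma pfunc_hom (B : set (K -> K)) : operator_algebra B ->
  (forall S S', G S S' -> B S') -> alg_hom pairdom B pfunc.
Proof.
move=> aB gB; split.
- by move=> T /pfuncP; apply: pcl_mem.
- by move=> a S T /pfuncP hS /pfuncP hT; apply/pfuncE/pcl_lin.
- by move=> S T /pfuncP hS /pfuncP hT; apply/pfuncE/pcl_comp.
Qed.

Section Star.
Hypothesis G_adj : forall S T, G S T -> G (adj S) (adj T).

Lemma palg_adj S T : palg S T -> palg (adj S) (adj T).
Proof.
elim=> [{}S {}T /G_adj/palg_gen//| |a {}S S' {}T T' h1 ih1 h2 ih2|
        {}S S' {}T T' h1 ih1 h2 ih2].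
- by rewrite !adj0; apply: palg0.
- have [b1 b1'] := palg_bop h1; have [b2 b2'] := palg_bop h2.
  by rewrite (adj_lin _ b1 b2) (adj_lin _ b1' b2'); apply: palg_lin.
- have [b1 b1'] := palg_bop h1; have [b2 b2'] := palg_bop h2.
  by rewrite (adj_comp b1 b2) (adj_comp b1' b2'); apply: palg_comp.
Qed.

Lemma bnd_adjB (L : hilbert R) (S T : L -> L) (e : R) : bounded_op S -> bounded_op T ->
  bnd (S - T) e -> bnd (adj S - adj T) e.
Proof.
move=> bS bT h; have -> : adj S - adj T = adj (S - T).
  rewrite [RHS](_ : _ = adj ((-1) *: T + S)); last by rewrite scaleN1r addrC.
  by rewrite adj_lin // rmorphN1 scaleN1r addrC.
by apply: bnd_adj => //; apply: bopB.
Qed.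

Lemma pcl_adj S T : pcl S T -> pcl (adj S) (adj T).
Proof.
move=> [bS bT h]; split; try exact: bop_adj.
move=> e /h[U [U' [pU h1 h2]]]; have [bU bU'] := palg_bop pU.
exists (adj U), (adj U'); split; [exact: palg_adj| |]; exact: bnd_adjB.
Qed.

Lemma pairdom_cstar : cstar_algebra pairdom.
Proof.
split; first exact: pairdom_alg.
by move=> T [T' h]; exists (adj T'); apply: pcl_adj.
Qed.

Lemma pairdom_cstar_generated : pairdom = cstar_generated [set S | exists T, G S T].
Proof.
apply/seteqP; split=> [T|T]; last first.
  by apply; split; [exact: pairdom_cstar|move=> S [S' /palg_gen/palg_pcl]; exists S'].
by rewrite pairdom_generated => hT A [[aA _] gA]; apply: hT.
Qed.

Lemma pfunc_star_hom (B : set (K -> K)) : cstar_algebra B ->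
  (forall S S', G S S' -> B S') -> star_hom pairdom B pfunc.
Proof.
move=> [aB _] gB; split; first exact: pfunc_hom.
by move=> T /pfuncP/pcl_adj/pfuncE.
Qed.

End Star.
End Dominated.

Lemma pcl_mxbnd n (M : 'M[H -> H]_n) (M' : 'M[K -> K]_n) (c : R) :
  (forall (N : 'M[H -> H]_n) (N' : 'M[K -> K]_n) (d : R),
     (forall i j, palg (N i j) (N' i j)) -> 0 <= d -> mxbnd N d -> mxbnd N' d) ->
  0 <= c -> (forall i j, pcl (M i j) (M' i j)) -> mxbnd M c -> mxbnd M' c.
Proof.
move=> dom c0 hM /(mxbndP _ c0) bM; apply/(mxbndP _ c0); apply: bnd_inf => d d0.
have n0 : 0 <= n%:R * n%:R :> R by rewrite mulr_ge0.
pose e := d / 2 / (n%:R * n%:R + 1); have e0 : 0 < e by rewrite !divr_gt0 // ltr_wpDl.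
have en : n%:R * n%:R * e <= d / 2.
  rewrite /e mulrA ler_pdivrMr ?ltr_wpDl // mulrC.
  by rewrite ler_wpM2l ?lerDl // ltW // divr_gt0.
have /choice[f hf] : forall ij : 'I_n * 'I_n, exists SS : (H -> H) * (K -> K),
    [/\ palg SS.1 SS.2, bnd (M ij.1 ij.2 - SS.1) e & bnd (M' ij.1 ij.2 - SS.2) e].
  by move=> [i j]; have [_ _ /(_ e e0)[S [S' h]]] := hM i j; exists (S, S').
pose N := \matrix_(i, j) (f (i, j)).1; pose N' := \matrix_(i, j) (f (i, j)).2.
have mxB (L : hilbert R) (P Q : 'M[L -> L]_n) : (forall i j, bnd (P i j - Q i j) e) ->
    bnd (mx2op P - mx2op Q) (d / 2).
  move=> h; have -> : mx2op P - mx2op Q = mx2op (\matrix_(i, j) (P i j - Q i j)).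
    apply/funext => x; apply: l2_eq => i; rewrite -[(mx2op P - _) x]/(mx2op P x - mx2op Q x).
    by rewrite l2vB !mx2opE -sumrB; apply: eq_bigr => j _; rewrite mxE.
  apply: bnd_le en _; apply: mx2op_bnd; first exact: ltW.
  by move=> i j; rewrite mxE.
have h1 : bnd (mx2op M - mx2op N) (d / 2).
  by apply: mxB => i j; rewrite mxE; have [] := hf (i, j).
have h2 : bnd (mx2op M' - mx2op N') (d / 2).
  by apply: mxB => i j; rewrite mxE; have [] := hf (i, j).
have cd : 0 <= c + d / 2 by rewrite addr_ge0 // ltW // divr_gt0.
have : bnd (mx2op N') (c + d / 2).
  apply/(mxbndP _ cd); apply: (dom N) => //; last first.
    by apply/(mxbndP _ cd); apply: bndK bM; apply: bndBC.
  by move=> i j; rewrite !mxE; have [] := hf (i, j).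
by move=> /(bndK h2); rewrite -addrA -splitr.
Qed.

End PairAlgebra.

(** With the roles of the two sides exchanged, the reverse norm inequality is again a domination,
    and the results on [pcl] apply to it. *)
Lemma palg_flip (R : realType) (H K : hilbert R) (G : (H -> H) -> (K -> K) -> Prop) S T :
  palg G S T -> palg (fun T S => G S T) T S.
Proof.
by elim=> [? ? ?| |*|*]; [apply: palg_gen|apply: palg0|apply: palg_lin|apply: palg_comp].
Qed.

Lemma pcl_flip (R : realType) (H K : hilbert R) (G : (H -> H) -> (K -> K) -> Prop) S T :
  pcl G S T -> pcl (fun T S => G S T) T S.
Proof.
move=> [bS bT h]; split=> // e /h[U [U' [pU h1 h2]]]; exists U', U; split=> //.
exact: palg_flip.
Qed.

(* These names are shadowed by those of [action]. *)
Local Notation act1 := Defs.act1.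
Local Notation act := Defs.act.

(** * A combinatorial unitary and Cuntz-Krieger representation *)

Section SelfSimilarBasics.
Variables (P : nmodType) (E : graph) (Y : self_similar P E).

Lemma act0D p q v : act0 Y (p + q) v = act0 Y p (act0 Y q v).
Proof. by have := act_comp Y p q (inl v) => -[]. Qed.

Lemma act1D p q e : act1 Y (p + q) e = act1 Y p (act1 Y q e).
Proof. by have := act_comp Y p q (inr e) => -[]. Qed.

Lemma act00 v : act0 Y 0 v = v.
Proof. by have := act_id Y (inl v) => -[]. Qed.

Lemma act10 e : act1 Y 0 e = e.
Proof. by have := act_id Y (inr e) => -[]. Qed.

Lemma res1D p q e : res Y (p + q) (inr e) = res Y p (inr (act1 Y q e)) + res Y q (inr e).
Proof. by rewrite res_add. Qed.

End SelfSimilarBasics.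

Section SelfSimilarInt.
Variables (E : graph) (Y : self_similar int E).

Lemma act0K g v : act0 Y (- g) (act0 Y g v) = v.
Proof. by rewrite -act0D addNr act00. Qed.

Lemma act0KV g v : act0 Y g (act0 Y (- g) v) = v.
Proof. by rewrite -act0D subrr act00. Qed.

Lemma act1K g e : act1 Y (- g) (act1 Y g e) = e.
Proof. by rewrite -act1D addNr act10. Qed.

Lemma act1KV g e : act1 Y g (act1 Y (- g) e) = e.
Proof. by rewrite -act1D subrr act10. Qed.

Lemma resN g e : res Y (- g) (inr (act1 Y g e)) = - res Y g (inr e).
Proof. by apply/eqP; rewrite -addr_eq0 -res1D addNr res_edge0. Qed.

End SelfSimilarInt.

(* A CK E-family on l2 of a set I together with a Z-action: every index i is
   uniquely of the form (edge) . (tail), and the Z-action is free on the orbits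
   of the base points. The levels and tags count prepended edges. *)
Record csys (E : graph) (Y : self_similar int E) := CSys {
  ci : choiceType;
  crng : ci -> vertex E;
  chd : ci -> edge E;
  ctl : ci -> ci;
  ccons : edge E -> ci -> ci;
  cact : int -> ci -> ci;
  clev : ci -> int;
  ctag : ci -> int;
  cbase : vertex E -> int -> ci;
  crng_hd : forall i, crng i = rng (chd i);
  csrc_hd : forall i, src (chd i) = crng (ctl i);
  cconsK : forall i, ccons (chd i) (ctl i) = i;
  chd_cons : forall e i, src e = crng i -> chd (ccons e i) = e;
  ctl_cons : forall e i, src e = crng i -> ctl (ccons e i) = i;
  cact0 : forall i, cact 0 i = i;
  cactD : forall g h i, cact (g + h) i = cact g (cact h i);
  crng_act : forall g i, crng (cact g i) = act0 Y g (crng i);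
  chd_act : forall g i, chd (cact g i) = act1 Y g (chd i);
  ctl_act : forall g i, ctl (cact g i) = cact (res Y g (inr (chd i))) (ctl i);
  clev_tl : forall i, clev (ctl i) = clev i - 1;
  ctag_tl : forall i, ctag (ctl i) = ctag i - 1;
  clev_act : forall g i, clev (cact g i) = clev i;
  ctag_act : forall g i, ctag (cact g i) = ctag i;
  crng_base : forall w N, crng (cbase w N) = w;
  clev_base : forall w N, clev (cbase w N) = 0;
  ctag_base : forall w N, ctag (cbase w N) = N;
  cbase_inj : forall g g' w w' N N',
    cact g (cbase w N) = cact g' (cbase w' N') -> g = g' /\ w = w' }.

Section CsysRep.
Variables (R : realType) (E : graph) (Y : self_similar int E) (C : csys Y).
Variable H : hilbert R.
Local Notation G := (l2 (ci C) H).
Implicit Types F : G.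

Definition cv_pinj (v : vertex E) : pinj (ci C) :=
  @Pinj (ci C) (fun i => crng i == v) id (fun i => crng i == v) id
    (fun i h => conj h erefl) (fun i h => conj h erefl).

Lemma ce_pfunK e (i : ci C) : chd i == e -> crng (ctl i) == src e /\ ccons e (ctl i) = i.
Proof. by move=> /eqP <-; rewrite -csrc_hd cconsK. Qed.

Lemma ce_pbwdK e (i : ci C) : crng i == src e -> chd (ccons e i) == e /\ ctl (ccons e i) = i.
Proof. by move=> /eqP h; rewrite chd_cons ?ctl_cons. Qed.

Definition ce_pinj e := @Pinj (ci C) (fun i => chd i == e) (@ctl _ _ C)
  (fun i => crng i == src e) (ccons e) (@ce_pfunK e) (@ce_pbwdK e).

Lemma cactK g : cancel (@cact _ _ C g) (cact (- g)).
Proof. by move=> i; rewrite -cactD addNr cact0. Qed.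

Lemma cactKV g : cancel (@cact _ _ C (- g)) (cact g).
Proof. by move=> i; rewrite -cactD subrr cact0. Qed.

Definition cg_pinj g := @Pinj (ci C) (fun=> true) (cact (- g)) (fun=> true) (cact g)
  (fun i _ => conj isT (cactKV g i)) (fun i _ => conj isT (cactK g i)).

Definition cS (m : cell E) : G -> G :=
  match m with inl v => pio (cv_pinj v) | inr e => pio (ce_pinj e) end.

Definition cU (g : int) : G -> G := pio (cg_pinj g).

Lemma cSvE v F i : l2v (cS (inl v) F) i = if crng i == v then l2v F i else 0.
Proof. by []. Qed.

Lemma cSeE e F i : l2v (cS (inr e) F) i = if chd i == e then l2v F (ctl i) else 0.
Proof. by []. Qed.

Lemma cUE g F i : l2v (cU g F) i = l2v F (cact (- g) i).
Proof. by []. Qed.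

Lemma cSv_adj v : adj (cS (inl v)) = cS (inl v).
Proof. by rewrite /= pio_adj; apply/funext => F; apply: l2_eq => i; rewrite !pioE. Qed.

Lemma cSe_adjE e F i :
  l2v (adj (cS (inr e)) F) i = if crng i == src e then l2v F (ccons e i) else 0.
Proof. by rewrite /= pio_adj. Qed.

Lemma cU_adj g : adj (cU g) = cU (- g).
Proof.
rewrite /cU pio_adj; apply/funext => F; apply: l2_eq => i.
by rewrite !pioE /= opprK.
Qed.

Lemma cS_src e : adj (cS (inr e)) \o cS (inr e) = cS (inl (src e)).
Proof.
apply/funext => F; apply: l2_eq => i; rewrite /= cSe_adjE cSvE.
by case: eqP => // h; rewrite cSeE chd_cons // eqxx ctl_cons.
Qed.

Lemma cS_range v : range_sum cS v = cS (inl v).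
Proof.
apply/funext => F; apply: l2_eq => i.
rewrite /range_sum fct_sum l2v_sum cSvE crng_hd.
have cE e : l2v ((cS (inr e) \o adj (cS (inr e))) F) i = if chd i == e then l2v F i else 0.
  rewrite -[(_ \o _) F]/(cS (inr e) (adj (cS (inr e)) F)) cSeE.
  by case: eqP => // <-; rewrite cSe_adjE -csrc_hd eqxx cconsK.
under eq_bigr do rewrite cE.
case: ifP => hv; last first.
  by rewrite big1 // => e he; case: eqP => // h; rewrite h he in hv.
rewrite (bigD1 (chd i)) //= eqxx big1 ?addr0 // => e /andP[_ /negbTE h].
by rewrite eq_sym h.
Qed.

Lemma cS_ck : ck_family cS.
Proof.
split; last exact: cS_range.
split.
- by case=> ?; apply: pio_bop.
- move=> v; split; last exact: cSv_adj.
  by apply/funext => F; apply: l2_eq => i /=; rewrite !cSvE; case: eqP.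
- move=> v w vw; apply/funext => F; apply: l2_eq => i /=; rewrite !cSvE.
  by case: eqP => // ->; rewrite (negbTE vw).
- exact: cS_src.
- by move=> v x; rewrite cS_range.
apply/funext => F; apply: l2_eq => i; rewrite fct_sum l2v_sum.
under eq_bigr do rewrite cSvE.
rewrite (bigD1 (crng i)) //= eqxx big1 ?addr0 // => v /negbTE h.
by rewrite eq_sym h.
Qed.

Lemma c_unitary_ck_rep : unitary_ck_rep Y cU cS.
Proof.
split.
- by move=> g; apply: pio_bop.
- move=> g; rewrite /unitary_op cU_adj; split; apply/funext => F; apply: l2_eq => i /=.
    by rewrite !cUE opprK cactK.
  by rewrite !cUE opprK cactKV.
- by apply/funext => F; apply: l2_eq => i; rewrite cUE oppr0 cact0.
- move=> g h; apply/funext => F; apply: l2_eq => i; rewrite /= !cUE.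
  by rewrite -cactD -opprD addrC.
- exact: cS_ck.
move=> g [v|e]; apply/funext => F; apply: l2_eq => i.
  rewrite /= res_vertex cUE !cSvE cUE crng_act.
  have -> : (act0 Y (- g) (crng i) == v) = (crng i == act0 Y g v).
    by apply/eqP/eqP => [<-|->]; rewrite ?act0KV ?act0K.
  by [].
rewrite /= cUE !cSeE cUE chd_act.
have -> : (act1 Y (- g) (chd i) == e) = (chd i == act1 Y g e).
  by apply/eqP/eqP => [<-|->]; rewrite ?act1KV ?act1K.
by case: eqP => // h; rewrite ctl_act h resN.
Qed.

Lemma cS_del_v v i x : cS (inl v) (l2_del i x) = if crng i == v then l2_del i x else 0.
Proof.
apply: l2_eq => j; rewrite cSvE l2_delE; have [->|ji] := eqVneq j i.
  by case: ifP => _; rewrite // l2_delE eqxx.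
by rewrite if_same; case: ifP => _; rewrite // l2_delE (negbTE ji).
Qed.

Lemma cU_del g i x : cU g (l2_del i x) = l2_del (cact g i) x.
Proof.
apply: l2_eq => j; rewrite cUE !l2_delE; congr (if _ then _ else _).
by apply/eqP/eqP => [<-|->]; rewrite ?cactKV ?cactK.
Qed.

End CsysRep.

(** * A phase that makes prepending edges compatible with translation *)

Section SlopePotential.
Variables (E : graph) (X : self_similar nat E).
Hypothesis hX : forall e : edge E, exists m : nat, res X m (inr e) <> 0%N.

Let n := #[act1 X 1%N]%g.
Let n_gt0 : (0 < n)%N := order_gt0 _.
Let r (i : nat) e : nat := res X i (inr e).
Let one := act1 X 1%N.

Let rD i j e : r (i + j)%N e = (r i (act1 X j e) + r j e)%N.
Proof. exact: res1D. Qed.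

Let aD i j e : act1 X (i + j)%N e = act1 X i (act1 X j e).
Proof. exact: (act1D X i j e). Qed.

Let actnE i e : act1 X i e = (one ^+ i)%g e.
Proof.
elim: i => [|i IH]; first by rewrite expg0 perm1 -[RHS](act10 X).
by rewrite -add1n aD IH expgSr permM.
Qed.

Let actn e : act1 X n e = e.
Proof. by rewrite actnE expg_order perm1. Qed.

Let actkn k e : act1 X (k * n)%N e = e.
Proof. by rewrite actnE mulnC expgM expg_order expg1n perm1. Qed.

Let r_one e : r n (one e) = r n e.
Proof.
have := rD n 1 e; rewrite addnC rD actn addnC => /esym /eqP.
by rewrite eqn_add2r => /eqP.
Qed.

(** [m|_e] is a summand of [(m n)|_e], which is [m] times [n|_e] because [n] fixes every edge. So
    [n|_e = 0] would force [m|_e = 0] for every [m]. *)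
Let r_gt0 e : (0 < r n e)%N.
Proof.
rewrite lt0n; apply/negP => /eqP h; have [m hm] := hX e; apply: hm.
have hk k : r (k * n)%N e = 0%N.
  elim: k => [|k IH]; first exact: (res_edge0 X).
  by rewrite mulSn rD actkn h IH.
have := hk m; rewrite -[(m * n)%N](@subnK m) ?leq_pmulr // rD => /eqP.
by rewrite addn_eq0 => /andP[_ /eqP].
Qed.

Let rho e : rat := (r n e)%:R / n%:R.
Let co i e : rat := (r i e)%:R - rho e * i%:R.
Let beta e : rat := - (\sum_(i < n) co i e) / n%:R.

Let rho_gt0 e : 0 < rho e.
Proof. by rewrite divr_gt0 ?ltr0n. Qed.

Let nQ : (n%:R : rat) != 0.
Proof. by rewrite pnatr_eq0 -lt0n. Qed.

(** [co i e] is the deviation of [i|_e] from linear growth and vanishes for [i = 0] and [i = n].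
    Hence [c1], summed over a period, telescopes to [n] times [co 1 e], which is the coboundary
    equation for [beta]. *)
Let beta_one e : (r 1 e)%:R = rho e + beta (one e) - beta e.
Proof.
have rho1 : rho (one e) = rho e by rewrite /rho r_one.
have c1 i : co i e - co i (one e) = co 1 e - (co i.+1 e - co i e).
  by rewrite /co rho1 -(addn1 i) (rD i 1) natrD -/one natrD; ring.
have : beta (one e) - beta e = (\sum_(i < n) (co i e - co i (one e))) / n%:R.
  by rewrite /beta [in RHS]sumrB; move: (\sum_(i < n) co i e) (\sum_(i < n) co i (one e)) => x y; ring.
under eq_bigr do rewrite c1.
rewrite sumrB sumr_const card_ord -(big_mkord xpredT (fun i => co i.+1 e - co i e)).
rewrite telescope_sumr // {1}/co.
have -> : co n e = 0.
  by rewrite /co /rho divfK // subrr.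
have -> : co 0 e = 0 by rewrite /co /r (res_edge0 X) mulr0 subr0.
rewrite !subr0 -[_ *+ n]mulr_natr mulfK // => h.
by rewrite -addrA h; ring.
Qed.

(* tau e is affine of slope 1 / rho e, where rho e = n|_e / n is nonzero by hX
   and n is the order of the permutation 1 of the edges; the constant beta
   solves the resulting cocycle equation by averaging over the orbits. *)
Lemma slope_potential : exists tau tauI : edge E -> rat -> rat,
  [/\ forall e, cancel (tau e) (tauI e), forall e, cancel (tauI e) (tau e) &
  forall (g : int) e a, tau (act1 (extend X) g e) (a + (res (extend X) g (inr e))%:~R) =
    tau e a + g%:~R].
Proof.
exists (fun e a => (a - beta e) / rho e), (fun e a => a * rho e + beta e).
have rho0 e : rho e != 0 by rewrite gt_eqF.
split=> [e a|e a|].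
- by rewrite divfK // subrK.
- by rewrite addrK mulfK.
(* The relation is stable under sums and negatives of [g], so the case [g = 1], which is [beta_one],
   suffices. *)
pose rel (g : int) := forall e a,
  (a + (res (extend X) g (inr e))%:~R - beta (act1 (extend X) g e)) /
    rho (act1 (extend X) g e) = (a - beta e) / rho e + g%:~R.
have relD g h : rel g -> rel h -> rel (g + h).
  move=> hg hh e a; rewrite act1D res1D.
  rewrite (_ : a + (_ + _)%:~R = a + (res (extend X) h (inr e))%:~R +
    (res (extend X) g (inr (act1 (extend X) h e)))%:~R); last first.
    by rewrite intrD addrCA addrC.
  by rewrite hg hh intrD -addrA; congr (_ + _); apply: addrC.
have relN g : rel g -> rel (- g).
  move=> hg e a; set e' := act1 _ _ e.
  have r0 : (res (extend X) (- g) (inr e))%:~R + (res (extend X) g (inr e'))%:~R = 0 :> rat.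
    by rewrite -intrD addrC /e' -res1D subrr (res_edge0 (extend X)).
  have ge : act1 (extend X) g e' = e by apply: act1KV.
  have := hg e' (a + (res (extend X) (- g) (inr e))%:~R).
  by rewrite ge -[a + _ + _]addrA r0 addr0 => ->; rewrite rmorphN /= addrK.
have rel1 : rel 1.
  move=> e a; rewrite -[res _ _ _]/((r 1 e)%:Z) -[act1 _ _ _]/(one e).
  have -> : ((r 1 e)%:Z)%:~R = (r 1 e)%:R :> rat by [].
  rewrite beta_one; have -> : rho (one e) = rho e by rewrite /rho r_one.
  have := rho0 e; move: (rho e) (beta e) (beta (one e)) => x y z x0.
  by field.
have rel0 : rel 0.
  by move=> e a; rewrite act10 (res_edge0 (extend X)) !addr0.
have reln (k : nat) : rel k.
  elim: k => // k IH; rewrite -addn1 PoszD; exact: relD.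
by case=> k; [apply: reln|rewrite NegzE; apply/relN/reln].
Qed.

End SlopePotential.

(** * The action of Z on infinite paths *)

Section InfinitePaths.
Variables (E : graph) (hE : source_free E) (Y : self_similar int E).

Definition ipath := {x : nat -> edge E | `[< forall n, src (x n) = rng (x n.+1) >]}.
Implicit Types x : ipath.

Lemma ipathP x n : src (val x n) = rng (val x n.+1).
Proof. exact: (asboolW (valP x)). Qed.

Definition mkpath (x : nat -> edge E) (h : forall n, src (x n) = rng (x n.+1)) : ipath :=
  exist _ x (introT (asboolP _) h).

Lemma ipath_eq x x' : (forall n, val x n = val x' n) -> x = x'.
Proof. by move=> h; apply/val_inj/funext. Qed.

(** The restriction of [g] along the first [n] edges of [x]: the integer that acts on the edge of
    index [n]. *)
Fixpoint pst (g : int) (x : nat -> edge E) n : int :=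
  if n is m.+1 then res Y (pst g x m) (inr (x m)) else g.

Lemma pact_subproof g x n :
  src (act1 Y (pst g (val x) n) (val x n)) =
  rng (act1 Y (pst g (val x) n.+1) (val x n.+1)).
Proof. by rewrite act_src act_rng -ipathP /= res_act. Qed.

Definition pact g x : ipath := mkpath (pact_subproof g x).

Lemma pactE g x n : val (pact g x) n = act1 Y (pst g (val x) n) (val x n).
Proof. by []. Qed.

Lemma ptl_subproof x n : src (val x n.+1) = rng (val x n.+2).
Proof. exact: ipathP. Qed.

Definition ptl x : ipath := mkpath (ptl_subproof x).

Definition pcons_fun e (x : nat -> edge E) n := if n is m.+1 then x m else e.

(** An edge that cannot be prepended leaves [x] as a junk value; [csys] only constrains composable
    pairs. *)
Definition pcons e x : ipath :=
  match pselect (src e = rng (val x 0%N)) with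
  | left h => @mkpath (pcons_fun e (val x))
      (fun n => match n with 0%N => h | m.+1 => ipathP x m end)
  | right _ => x
  end.

Lemma pconsE e x n : src e = rng (val x 0%N) -> val (pcons e x) n = pcons_fun e (val x) n.
Proof. by rewrite /pcons; case: pselect. Qed.

Lemma pst0 (y : nat -> edge E) n : pst 0 y n = 0.
Proof. by elim: n => //= n ->; rewrite (res_edge0 Y). Qed.

Lemma pact0 x : pact 0 x = x.
Proof. by apply: ipath_eq => n; rewrite pactE pst0 act10. Qed.

Lemma pstD g h x n : pst (g + h) (val x) n = pst g (val (pact h x)) n + pst h (val x) n.
Proof. by elim: n => //= n ->; rewrite res1D. Qed.

Lemma pactD g h x : pact (g + h) x = pact g (pact h x).
Proof. by apply: ipath_eq => n; rewrite !pactE pstD act1D. Qed.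

Lemma ptl_act g x : ptl (pact g x) = pact (res Y g (inr (val x 0%N))) (ptl x).
Proof.
apply: ipath_eq => n; rewrite -[LHS]/(val (pact g x) n.+1) !pactE; congr (act1 Y _ _).
by elim: n => //= n ->.
Qed.

Lemma exists_path w : exists x : ipath, rng (val x 0%N) = w.
Proof.
have /choice[f hf] := hE.
pose y := fix y n := if n is m.+1 then f (src (y m)) else f w.
have hy n : src (y n) = rng (y n.+1) by rewrite /= hf.
by exists (mkpath hy) => /=.
Qed.

End InfinitePaths.

(* An index is an infinite path with a rational phase and the two counters.
   The generator of Z translates the phase, which makes the action free, and
   prepending e transforms it by tau e. *)
Lemma csys_exists (E : graph) (hE : source_free E) (X : self_similar nat E)
    (hX : forall e : edge E, exists m : nat, res X m (inr e) <> 0%N) :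
  csys (extend X).
Proof.
pose Y := extend X.
have /cid[tau /cid[tauI [tauK tauIK htau]]] := slope_potential hX.
have [base hbase] := choice (fun w => @exists_path E hE w).
pose T : Type := (ipath E * rat * int * int)%type.
pose hd (i : T) := val i.1.1.1 0%N.
apply: (@CSys E Y (T : choiceType) (fun i => rng (hd i)) hd
  (fun i => (ptl i.1.1.1, tauI (hd i) i.1.1.2, i.1.2 - 1, i.2 - 1))
  (fun e i => (pcons e i.1.1.1, tau e i.1.1.2, i.1.2 + 1, i.2 + 1))
  (fun g i => (pact Y g i.1.1.1, i.1.1.2 + g%:~R, i.1.2, i.2))
  (fun i => i.1.2) (fun i => i.2)
  (fun w N => (base w, 0, 0, N))).
- by [].
- by move=> i; apply: ipathP.
- move=> [[[x a] l] N] /=; rewrite tauIK !subrK; congr (_, _, _, _).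
  apply: ipath_eq => n; rewrite pconsE; last exact: ipathP.
  by case: n.
- by move=> e [[[x a] l] N] h; rewrite /hd /= pconsE.
- move=> e [[[x a] l] N] h; rewrite /hd /= pconsE //= tauK !addrK; congr (_, _, _, _).
  by apply: ipath_eq => n; rewrite /= pconsE.
- by move=> [[[x a] l] N] /=; rewrite pact0 addr0.
- by move=> g h [[[x a] l] N] /=; rewrite pactD intrD addrA [_ + _ + h%:~R]addrAC.
- by move=> g i; apply: (act_rng Y g (hd i)).
- by move=> g [[[x a] l] N].
- move=> g [[[x a] l] N]; rewrite /hd /= ptl_act; congr (_, _, _, _).
  (* Under [tau] the two phases of the tail agree by [htau]: translation by [g] before removing the
     edge is translation by [g|_e] after it. *)
  set e := sval x 0%N; apply: (can_inj (tauK (act1 Y g e))).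
  by rewrite -[ext_act1 X g e]/(act1 Y g e) -[ext_res X g _]/(res Y g (inr e)) htau !tauIK.
- by [].
- by [].
- by [].
- by [].
- by move=> w N; apply: hbase.
- by [].
- by [].
(* The phase of a base point is 0, so it alone recovers [g]; cancelling [g] leaves equal base paths,
   whose range is [w]. *)
move=> g g' w w' N N' [h1 h2 h3]; have gg : g = g'.
  by move: h2; rewrite !add0r => /intr_inj.
split=> //; move: h1; rewrite gg => h1.
have hp : pact Y g' (base w) = pact Y g' (base w') by apply: val_inj; apply: h1.
have := congr1 (pact Y (- g')) hp; rewrite -!pactD addNr !pact0 => h.
by rewrite -(hbase w) h hbase.
Qed.

(** * Asymptotic dilation of Toeplitz representations *)

Section TCKFacts.
Variables (R : realType) (E : graph) (H : hilbert R) (S : cell E -> H -> H).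
Hypothesis tS : tck_family S.
Implicit Types (x y : H) (v w : vertex E) (e f : edge E).

Let bS m : bounded_op (S m). Proof. exact: tck_bounded. Qed.

Lemma tckv_idem v x : S (inl v) (S (inl v) x) = S (inl v) x.
Proof. by have [h _] := tck_proj tS v; rewrite -[in RHS]h. Qed.

Lemma tckv_adj v : adj (S (inl v)) = S (inl v).
Proof. by have [] := tck_proj tS v. Qed.

Lemma tckv_orth v w x : v != w -> S (inl v) (S (inl w) x) = 0.
Proof. by move=> /(tck_orth tS)/(congr1 (fun T => T x)). Qed.

Lemma tck_sum x : \sum_v S (inl v) x = x.
Proof. by have := congr1 (fun T => T x) (tck_nondegenerate tS); rewrite fct_sum. Qed.

Lemma tck_adjK e x : adj (S (inr e)) (S (inr e) x) = S (inl (src e)) x.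
Proof. exact: (congr1 (fun T => T x) (tck_src tS e)). Qed.

Lemma tckv_hn v x : hn (S (inl v) x) ^+ 2 = rip (S (inl v) x) x.
Proof. by rewrite -ripxx (rip_adj (bS _)) tckv_adj tckv_idem ripC. Qed.

Lemma tcke_hn e x : hn (S (inr e) x) = hn (S (inl (src e)) x).
Proof.
apply/eqP; rewrite -(eqrXn2 (ltn0Sn 1)) ?hn_ge0 // (hn_comp_adj _ (bS _)).
by rewrite tck_adjK tckv_hn ripC.
Qed.

Lemma tck_pyth x : \sum_v hn (S (inl v) x) ^+ 2 = hn x ^+ 2.
Proof.
have <- : rip x (\sum_v S (inl v) x) = hn x ^+ 2 by rewrite tck_sum ripxx.
rewrite rip_sumr.
by apply: eq_bigr => v _; rewrite tckv_hn ripC.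
Qed.

Lemma tckv_bnd v : bnd (S (inl v)) 1.
Proof.
move=> x; rewrite mul1r; apply: le_of_sqr; first exact: hn_ge0.
rewrite -[leRHS]tck_pyth (bigD1 v) //= lerDl sumr_ge0 // => w _; exact: sqr_ge0.
Qed.

Lemma tcke_bnd e : bnd (S (inr e)) 1.
Proof. by move=> x; rewrite tcke_hn; apply: tckv_bnd. Qed.

Lemma tcke_src e x : S (inr e) (S (inl (src e)) x) = S (inr e) x.
Proof.
apply/eqP; rewrite -subr_eq0 -(linearB_of (bop_linear (bS _))); apply/eqP/hn_eq0.
by rewrite tcke_hn (linearB_of (bop_linear (bS _))) tckv_idem subrr hn0.
Qed.

Lemma tck_le_rip v x :
  \sum_(e | rng e == v) hn (adj (S (inr e)) x) ^+ 2 <= hn (S (inl v) x) ^+ 2.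
Proof.
have := tck_le tS v x; rewrite tckv_hn lecE => /andP[_].
rewrite -!/(rip _ _) /range_sum fct_sum rip_suml; congr (_ <= _).
apply: eq_bigr => e _; rewrite -ripxx (rip_adjr (bS _)) //= ripC //.
Qed.

Lemma tck_adj_bessel x : \sum_e hn (adj (S (inr e)) x) ^+ 2 <= hn x ^+ 2.
Proof.
rewrite -[leRHS]tck_pyth (partition_big (@rng E) xpredT) //=; apply: ler_sum => v _.
exact: tck_le_rip.
Qed.

Lemma tcke_adj_bnd e : bnd (adj (S (inr e))) 1.
Proof. by apply: bnd_adj => //; apply: tcke_bnd. Qed.

(** At [S e x] the summand of [e] already exhausts Bessel's inequality. *)
Lemma tck_adj_orth e f x : e != f -> adj (S (inr f)) (S (inr e) x) = 0.
Proof.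
move=> ef; apply: hn_eq0; apply/eqP; rewrite -sqrf_eq0 eq_le sqr_ge0 andbT.
have := tck_adj_bessel (S (inr e) x); rewrite (bigD1 e) //= tck_adjK -tcke_hn gerDl.
apply: le_trans; rewrite (bigD1 f) /=; last by rewrite eq_sym.
by rewrite lerDl sumr_ge0 // => g _; apply: sqr_ge0.
Qed.

Lemma tck_src_adj e x : S (inl (src e)) (adj (S (inr e)) x) = adj (S (inr e)) x.
Proof.
apply: hdotI => y; rewrite -[S (inl _)]tckv_adj -(adjP (bS _)) -!(adjP (bS (inr e))).
by rewrite tcke_src.
Qed.

Lemma tck_adj_rng e v x :
  adj (S (inr e)) (S (inl v) x) = if rng e == v then adj (S (inr e)) x else 0.
Proof.
have h0 w y : rng e != w -> adj (S (inr e)) (S (inl w) y) = 0.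
  move=> ew; apply: hn_eq0; apply/eqP; rewrite -sqrf_eq0 eq_le sqr_ge0 andbT.
  have := tck_le_rip (rng e) (S (inl w) y); rewrite tckv_orth // hn0 expr0n.
  apply: le_trans; rewrite (bigD1 e) //= lerDl sumr_ge0 // => g _; exact: sqr_ge0.
case: (eqVneq (rng e) v) => [<-|/h0//].
have lA := linear_adj (bS (inr e)).
rewrite -[in RHS](tck_sum x) (linear_sum_of lA) (bigD1 (rng e)) //= big1 ?addr0 // => w hw.
by rewrite h0 // eq_sym.
Qed.

Lemma tck_rng e v x :
  S (inl v) (S (inr e) x) = if rng e == v then S (inr e) x else 0.
Proof.
apply: hdotI => y; rewrite -[S (inl v)]tckv_adj -(adjP (bS _)).
rewrite -[in LHS](adjK (bS (inr e))) -(adjP (bop_adj (bS _))) tck_adj_rng.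
by case: ifP => _; [rewrite (adjP (bop_adj (bS _))) adjK|rewrite hdot0l hdot0r].
Qed.

(** The projection onto the complement of the ranges of all [S e]: the defect of the Cuntz-Krieger
    relations. *)
Definition tckQ x := x - \sum_e S (inr e) (adj (S (inr e)) x).

Lemma tckQ_lin : linear tckQ.
Proof.
move=> a x y; rewrite /tckQ.
under eq_bigr => e _ do rewrite (linear_adj (bS _)) (bop_linear (bS _)).
by rewrite big_split /= -scaler_sumr opprD addrACA scalerBr.
Qed.

Lemma tckQ_hn x : hn (tckQ x) ^+ 2 + \sum_e hn (adj (S (inr e)) x) ^+ 2 = hn x ^+ 2.
Proof.
rewrite /tckQ hn_sqrB; set T := \sum_e S _ _; set B := \sum_e hn _ ^+ 2.
have h1 : rip x T = B.
  rewrite /T rip_sumr; apply: eq_bigr => e _.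
  by rewrite -(rip_adjr (bS _)) ripxx.
have h2 : hn T ^+ 2 = B.
  rewrite -ripxx {1}/T rip_suml; apply: eq_bigr => e _.
  rewrite (rip_adj (bS _)) /T (linear_sum_of (linear_adj (bS _))) (bigD1 e) //=.
  rewrite tck_adjK tck_src_adj big1 ?addr0 ?ripxx // => f fe.
  by rewrite tck_adj_orth.
by rewrite h1 h2; ring.
Qed.

Lemma tckQ_bnd : bnd tckQ 1.
Proof.
move=> x; rewrite mul1r; apply: le_of_sqr; first exact: hn_ge0.
by rewrite -(tckQ_hn x) lerDl sumr_ge0 // => e _; apply: sqr_ge0.
Qed.

Lemma tckQ_e e x : tckQ (S (inr e) x) = 0.
Proof.
rewrite /tckQ (bigD1 e) //= tck_adjK tcke_src big1 ?addr0 ?subrr // => f fe.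
by rewrite tck_adj_orth 1?eq_sym // (linear0_of (bop_linear (bS _))).
Qed.

Lemma tckQ_v v x : tckQ (S (inl v) x) = S (inl v) (tckQ x).
Proof.
rewrite /tckQ (linearB_of (bop_linear (bS _))) (linear_sum_of (bop_linear (bS _))).
congr (_ - _); apply: eq_bigr => e _; rewrite tck_adj_rng tck_rng.
by case: ifP => // _; rewrite (linear0_of (bop_linear (bS _))).
Qed.

End TCKFacts.

Lemma isometry_hn (R : realType) (H : hilbert R) (T : H -> H) x :
  bounded_op T -> isometry_op T -> hn (T x) = hn x.
Proof.
move=> bT iT; apply/eqP; rewrite -(eqrXn2 (ltn0Sn 1)) ?hn_ge0 // (hn_comp_adj _ bT).
by rewrite -[adj T (T x)]/((adj T \o T) x) iT ripxx.
Qed.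

Section ToeplitzFacts.
Variables (R : realType) (E : graph) (X : self_similar nat E) (H : hilbert R).
Variables (V : nat -> H -> H) (S : cell E -> H -> H).
Hypothesis hVS : toeplitz_rep X V S.
Implicit Types (x : H).

Let tS := toeplitz_tck hVS.
Let bV p : bounded_op (V p). Proof. exact: (toeplitz_bounded hVS). Qed.
Let bS m : bounded_op (S m). Proof. exact: (tck_bounded tS). Qed.

Lemma toeplitz_hn p x : hn (V p x) = hn x.
Proof. by apply: isometry_hn => //; apply: (toeplitz_isometry hVS). Qed.

Lemma toeplitz_bnd p : bnd (V p) 1.
Proof. by move=> x; rewrite toeplitz_hn mul1r. Qed.

Lemma toeplitz_addE p q x : V (p + q)%N x = V p (V q x).
Proof. by rewrite (toeplitz_add hVS). Qed.

Lemma toeplitz0E x : V 0%N x = x.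
Proof. by rewrite (toeplitz_id hVS). Qed.

Lemma toeplitz_ve p e x : V p (S (inr e) x) = S (inr (act1 X p e)) (V (res X p (inr e)) x).
Proof. exact: (congr1 (fun T => T x) (toeplitz_comm hVS p (inr e))). Qed.

Lemma toeplitz_vv p v x : V p (S (inl v) x) = S (inl (act0 X p v)) (V p x).
Proof.
by have := congr1 (fun T => T x) (toeplitz_comm hVS p (inl v)); rewrite /= res_vertex.
Qed.

(** The second Toeplitz relation, read through adjoints. *)
Lemma toeplitz_adj_ve p e x :
  adj (S (inr (act1 X p e))) (V p x) = V (res X p (inr e)) (adj (S (inr e)) x).
Proof.
apply: hdotI => y; rewrite -!(adjP (bS _)) -(adjK (bV p)) -(adjP (bop_adj (bV p))).
rewrite -[V (res _ _ _)](adjK (bV _)) -(adjP (bop_adj (bV _))) -(adjP (bS _)).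
congr (hdot H _ _).
exact: (congr1 (fun T => T y) (toeplitz_adj hVS p (inr e))).
Qed.

(** [S_{p.e} S_{p.e}^* V_p = V_p S_e S_e^*], and [e -> p.e] permutes the edges. This is what lets
    the Wold decomposition by levels be compatible with [V]. *)
Lemma toeplitz_Q p x : tckQ S (V p x) = V p (tckQ S x).
Proof.
rewrite /tckQ (linearB_of (bop_linear (bV _))) (linear_sum_of (bop_linear (bV _))).
congr (_ - _); rewrite (reindex_inj (@perm_inj _ (act1 X p))) /=.
by apply: eq_bigr => e _; rewrite toeplitz_adj_ve toeplitz_ve.
Qed.

End ToeplitzFacts.

Section UckFacts.
Variables (R : realType) (E : graph) (Y : self_similar int E) (K : hilbert R).
Variables (u : int -> K -> K) (s : cell E -> K -> K).
Hypothesis hus : unitary_ck_rep Y u s.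

Lemma uck_tck : tck_family s. Proof. by have [] := uck_ck hus. Qed.

Lemma uck_hn g x : hn (u g x) = hn x.
Proof.
apply: isometry_hn; first exact: (uck_bounded hus).
by have [] := uck_unitary hus g.
Qed.

Lemma uck_addE g h x : u (g + h) x = u g (u h x).
Proof. by rewrite (uck_add hus). Qed.

Lemma uck0E x : u 0 x = x.
Proof. by rewrite (uck_id hus). Qed.

Lemma uckKV g x : u g (u (- g) x) = x.
Proof. by rewrite -uck_addE subrr uck0E. Qed.

Lemma uck_adj g : adj (u g) = u (- g).
Proof.
have [h _] := uck_unitary hus g; apply/funext => x.
by rewrite -{1}(uckKV g x) -[LHS]/((adj (u g) \o u g) (u (- g) x)) h.
Qed.

Lemma uck_ve g e x : u g (s (inr e) x) = s (inr (act1 Y g e)) (u (res Y g (inr e)) x).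
Proof. exact: (congr1 (fun T => T x) (uck_comm hus g (inr e))). Qed.

End UckFacts.

(** The second Toeplitz relation is the commutation relation for [-p] at [p.m], because
    [(-p)|_{p.m} = -(p|_m)]. *)
Lemma uck_toeplitz (R : realType) (E : graph) (X : self_similar nat E) (K : hilbert R)
    (u : int -> K -> K) (s : cell E -> K -> K) :
  unitary_ck_rep (extend X) u s -> toeplitz_rep X (fun p : nat => u p) s.
Proof.
move=> hus; have bu := uck_bounded hus; have ts := uck_tck hus.
split=> //.
- by move=> p; have [] := uck_unitary hus p.
- exact: (uck_id hus).
- by move=> p q; rewrite PoszD; apply: (uck_add hus).
- by move=> p [v|e]; [have := uck_comm hus p (inl v)|have := uck_comm hus p (inr e)].
move=> p m; rewrite !(uck_adj hus); apply/funext => x /=.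
have hm : res (extend X) (- p%:Z) (act X p m) = - (res X p m)%:Z.
  have h := res_add (extend X) (- p%:Z) p%:Z m.
  apply/eqP; rewrite -addr_eq0; apply/eqP.
  have -> : act X p m = act (extend X) p m by [].
  have -> : (res X p m)%:Z = res (extend X) p m by [].
  rewrite -h addNr; case: (m) => [v|e]; [exact: res_vertex|exact: res_edge0].
have h : u (- p%:Z) (s (act X p m) x) = s (act (extend X) (- p%:Z) (act X p m))
    (u (res (extend X) (- p%:Z) (act X p m)) x).
  exact: (congr1 (fun T => T x) (uck_comm hus (- p%:Z) (act X p m))).
rewrite h hm; congr (s _ _); have -> : act X p m = act (extend X) p m by [].
by rewrite -act_comp addNr act_id.
Qed.

Arguments cS : simpl never.
Arguments cU : simpl never.

Section Approximation.
Variables (R : realType) (E : graph) (X : self_similar nat E) (H : hilbert R).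
Variables (V : nat -> H -> H) (S : cell E -> H -> H).
Hypothesis hVS : toeplitz_rep X V S.
Variable C : csys (extend X).
Local Notation G := (l2 (ci C) H).
Local Notation cS := (cS (C := C) (H := H)).
Local Notation cU := (cU (C := C) (H := H)).
Implicit Types (x : H) (F : G).

Let tS := toeplitz_tck hVS.
Let bV p : bounded_op (V p). Proof. exact: (toeplitz_bounded hVS). Qed.
Let bS m : bounded_op (S m). Proof. exact: (tck_bounded tS). Qed.
Let hC : unitary_ck_rep (extend X) cU cS := c_unitary_ck_rep C H.
Let tC : tck_family cS := uck_tck hC.
Let lC m : linear (cS m). Proof. by apply/bop_linear/(tck_bounded tC). Qed.
Let lU g : linear (cU g). Proof. by apply/bop_linear/(uck_bounded hC). Qed.

Lemma l2_hn_dels (J : finType) (i : J -> ci C) (x : J -> H) : injective i ->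
  hn (\sum_j l2_del (i j) (x j) : G) ^+ 2 = \sum_j hn (x j) ^+ 2.
Proof.
move=> inj; rewrite -ripxx rip_suml; apply: eq_bigr => j _.
rewrite /rip l2_hdot_del l2v_sum (bigD1 j) //= l2_delE eqxx big1 ?addr0; last first.
  by move=> k kj; rewrite l2_delE (inj_eq inj) eq_sym (negbTE kj).
by rewrite -/(rip _ _) ripxx.
Qed.

(** [V m x] is split along the vertex projections and placed at base points translated by [-k]. The
    parameters [k] and [m] are kept apart because [cU] moves only [k]. *)
Definition Zterm (N : int) (k m : nat) x : G :=
  \sum_w l2_del (cact (- k%:Z) (cbase C w N)) (S (inl w) (V m x)).

(* The D ^ 2 terms are orthogonal and V_1 shifts them by one, up to the two
   boundary terms. *)
Definition Zmap (D : nat) (N : int) x : G :=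
  (D%:R^-1 : R)%:C *: \sum_(m < D ^ 2) Zterm N m m x.

Lemma Zterm_lin N k m : linear (Zterm N k m).
Proof.
move=> a x y; rewrite /Zterm scaler_sumr -big_split /=; apply: eq_bigr => w _.
by rewrite (bop_linear (bV _)) (bop_linear (bS _)) l2_del_lin.
Qed.

Lemma Zmap_lin D N : linear (Zmap D N).
Proof.
move=> a x y; rewrite /Zmap; under eq_bigr do rewrite Zterm_lin.
by rewrite big_split /= -scaler_sumr scalerDr !scalerA mulrC.
Qed.

Lemma Zterm_hn N k m x : hn (Zterm N k m x) = hn x.
Proof.
apply/eqP; rewrite -(eqrXn2 (ltn0Sn 1)) ?hn_ge0 // l2_hn_dels.
  by rewrite (tck_pyth tS) (toeplitz_hn hVS).
by move=> w w' /cbase_inj[].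
Qed.

Lemma Zmap_hn D N x : (0 < D)%N -> hn (Zmap D N x) = hn x.
Proof.
move=> D0; rewrite /Zmap hnZr ger0_norm ?invr_ge0 ?ler0n //.
have D0' : (D%:R : R) != 0 by rewrite pnatr_eq0 -lt0n.
suff -> : hn (\sum_(m < D ^ 2) Zterm N m m x) = D%:R * hn x by rewrite mulKf.
apply/eqP; rewrite -(eqrXn2 (ltn0Sn 1)) ?mulr_ge0 ?hn_ge0 //.
rewrite /Zterm pair_big /= (l2_hn_dels (J := ('I_(D ^ 2) * vertex E)%type)
  (i := fun p => cact (- (p.1 : nat)%:Z) (cbase C p.2 N))
  (fun p => S (inl p.2) (V p.1 x))); last first.
  move=> [m w] [m' w'] /= /cbase_inj[/oppr_inj mm ww].
  by congr (_, _) => //; apply: val_inj; case: mm.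
rewrite -(pair_big xpredT xpredT (fun (m : 'I_(D ^ 2)) w => hn (S (inl w) (V m x)) ^+ 2)) /=.
under eq_bigr do rewrite (tck_pyth tS) (toeplitz_hn hVS).
by rewrite sumr_const card_ord exprMn -natrX mulr_natl.
Qed.

Lemma cU_Zterm N k m p x :
  cU p%:Z (Zterm N (k + p) m x) = Zterm N k m x.
Proof.
rewrite /Zterm (linear_sum_of (lU _)); apply: eq_bigr => w _; rewrite cU_del -cactD.
by congr (l2_del (cact _ _) _); rewrite PoszD opprD addrC subrK.
Qed.

Lemma cU1_Zmap D N x : hn (cU 1 (Zmap D N x) - Zmap D N (V 1%N x)) <= 2 / D%:R * hn x.
Proof.
have -> : cU 1 (Zmap D N x) - Zmap D N (V 1%N x) =
    (D%:R^-1 : R)%:C *: (cU 1 (Zterm N 0 0 x) - cU 1 (Zterm N (D ^ 2) (D ^ 2) x)).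
  rewrite /Zmap (linearZ_of (lU _)) -scalerBr (linear_sum_of (lU _)); congr (_ *: _).
  have h m : Zterm N m m (V 1%N x) = cU 1 (Zterm N m.+1 m.+1 x).
    rewrite -[X in Zterm _ X m.+1]addn1 (cU_Zterm _ _ _ 1).
    rewrite /Zterm; apply: eq_bigr => w _; congr (l2_del _ (S _ _)).
    by rewrite -(toeplitz_addE hVS) addn1.
  under [X in _ - X]eq_bigr do rewrite h.
  rewrite -sumrB -opprB -(telescope_sumr (fun m => cU 1 (Zterm N m m x))) //.
  by rewrite big_mkord -sumrN; apply: eq_bigr => m _; rewrite opprB.
rewrite hnZr ger0_norm ?invr_ge0 ?ler0n // mulrAC mulrC ler_wpM2r ?invr_ge0 ?ler0n //.
rewrite (le_trans (hnB _ _)) // !(uck_hn hC) !Zterm_hn; lra.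
Qed.

Lemma cU_Zmap D N p x :
  hn (cU p%:Z (Zmap D N x) - Zmap D N (V p x)) <= (2 * p)%:R / D%:R * hn x.
Proof.
elim: p x => [|p IH] x.
  by rewrite (uck0E hC) (toeplitz0E hVS) subrr hn0 muln0 !mul0r.
rewrite -addn1 PoszD (uck_addE hC) (toeplitz_addE hVS).
rewrite (le_trans (hnBD (cU p%:Z (Zmap D N (V 1%N x))) _ _)) //.
rewrite -(linearB_of (lU _)) (uck_hn hC) mulnDr muln1 natrD mulrDl mulrDl [leRHS]addrC.
by apply: lerD; [exact: cU1_Zmap|rewrite -[hn x](toeplitz_hn hVS 1%N); apply: IH].
Qed.

(** No error arises here: the base point of [w] translated by [-m] has range [(-m).w], and
    [S_w V_m S_v = S_w S_{m.v} V_m] survives for [w = m.v] only. *)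
Lemma cSv_Zmap D N v x : cS (inl v) (Zmap D N x) = Zmap D N (S (inl v) x).
Proof.
rewrite /Zmap (linearZ_of (lC _)) (linear_sum_of (lC _)); congr (_ *: _).
apply: eq_bigr => m _; rewrite /Zterm (linear_sum_of (lC _)).
rewrite (toeplitz_vv hVS); apply: eq_bigr => w _.
rewrite cS_del_v crng_act crng_base.
have -> : (act0 (extend X) (- (m : nat)%:Z) w == v) = (w == act0 X m v).
  have e0 : act0 X m v = act0 (extend X) (m : nat)%:Z v by [].
  by rewrite e0; apply/eqP/eqP => [<-|->]; rewrite ?act0KV ?act0K.
case: eqP => [->|/eqP wv]; first by rewrite (tckv_idem tS).
by rewrite (tckv_orth tS _ wv) (linear0_of (l2_del_lin _)).
Qed.

Lemma Zmap_supp D N x i : clev i != 0 \/ ctag i != N -> l2v (Zmap D N x) i = 0.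
Proof.
move=> h; rewrite /Zmap l2vZ l2v_sum big1 ?scaler0 // => m _.
rewrite /Zterm l2v_sum big1 // => w _; rewrite l2_delE; case: eqP => // e.
by case: h; rewrite e ?clev_act ?clev_base ?ctag_act ?ctag_base eqxx.
Qed.

Variable D : nat.
Hypothesis D_gt0 : (0 < D)%N.

(* A Wold decomposition of length N: the part of x orthogonal to the ranges of
   the S_e starts at a base point, the part in the range of S_e is moved up one
   level by the CK edge operator. The tag N makes the ranges of the Ymap N
   mutually orthogonal. *)
Fixpoint Ymap (N : nat) : H -> G :=
  if N is M.+1 then fun x =>
    Zmap D M.+1 (tckQ S x) + \sum_e cS (inr e) (Ymap M (adj (S (inr e)) x))
  else Zmap D 0.

Lemma Ymap_lin N : linear (Ymap N).
Proof.
elim: N => [|N IH] a x y; first exact: Zmap_lin.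
rewrite /= (tckQ_lin tS) Zmap_lin.
under eq_bigr do rewrite (linear_adj (bS _)) IH lC.
by rewrite big_split /= -scaler_sumr addrACA scalerDr.
Qed.

Lemma Ymap_supp N x i : clev i < 0 \/ ctag i != N%:Z -> l2v (Ymap N x) i = 0.
Proof.
elim: N x i => [|N IH] x i h.
  by apply: Zmap_supp; case: h => h; [left; rewrite lt_eqF|right].
rewrite /= l2vD Zmap_supp ?add0r; last by case: h => h; [left; rewrite lt_eqF|right].
rewrite l2v_sum big1 // => e _; rewrite cSeE; case: eqP => // _; apply: IH.
case: h => h; [left|right].
  by rewrite clev_tl (lt_trans _ h) // ltrBlDr ltrDl.
by rewrite ctag_tl subr_eq addrC -intS.
Qed.

Lemma cSv_Ymap N v x : cS (inl v) (Ymap N x) = Ymap N (S (inl v) x).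
Proof.
elim: N x => [|N IH] x; first exact: cSv_Zmap.
rewrite /= (linearD_of (lC _)) cSv_Zmap (tckQ_v tS) (linear_sum_of (lC _)).
congr (_ + _); apply: eq_bigr => e _.
rewrite (tck_rng tC) (tck_adj_rng tS); case: ifP => // _.
by rewrite (linear0_of (Ymap_lin _)) (linear0_of (lC _)).
Qed.

(** [S e x] has no component in the defect space and none under the other edges, so raising the
    level by one absorbs [S e] exactly. The error in [Yavg_e] then comes only from the two ends of
    the average. *)
Lemma Ymap_S N e x : Ymap N.+1 (S (inr e) x) = cS (inr e) (Ymap N x).
Proof.
rewrite /= (tckQ_e tS) (linear0_of (Zmap_lin _ _)) add0r (bigD1 e) //=.
rewrite (tck_adjK tS) -cSv_Ymap (tcke_src tC) big1 ?addr0 // => f fe.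
by rewrite (tck_adj_orth tS) 1?eq_sym // (linear0_of (Ymap_lin _)) (linear0_of (lC _)).
Qed.

Lemma cSe_orth_sum (F : edge E -> G) :
  (forall e, cS (inl (src e)) (F e) = F e) ->
  hn (\sum_e cS (inr e) (F e)) ^+ 2 = \sum_e hn (F e) ^+ 2.
Proof.
move=> hF; rewrite -ripxx rip_suml; apply: eq_bigr => e _.
rewrite (rip_adj (tck_bounded tC _)) (linear_sum_of (linear_adj (tck_bounded tC _))).
rewrite (bigD1 e) //= (tck_adjK tC) hF big1 ?addr0 ?ripxx // => f fe.
by rewrite (tck_adj_orth tC).
Qed.

Lemma Ymap_hn N x : hn (Ymap N x) = hn x.
Proof.
elim: N x => [|N IH] x; first exact: Zmap_hn.
apply/eqP; rewrite -(eqrXn2 (ltn0Sn 1)) ?hn_ge0 //= hn_sqrD Zmap_hn //.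
rewrite cSe_orth_sum => [|e]; last by rewrite cSv_Ymap (tck_src_adj tS).
have -> : \sum_e hn (Ymap N (adj (S (inr e)) x)) ^+ 2 = \sum_e hn (adj (S (inr e)) x) ^+ 2.
  by apply: eq_bigr => e _; rewrite IH.
rewrite -[X in _ == X](tckQ_hn tS).
suff -> : rip (Zmap D N.+1 (tckQ S x)) (\sum_e cS (inr e) (Ymap N (adj (S (inr e)) x))) = 0.
  by rewrite mulr0 addr0.
rewrite /rip l2_hdot_disj // => i.
(* The [Zmap] part lives on level 0, the rest on positive levels. *)
case: (eqVneq (clev i) 0) => hi; last by left; apply: Zmap_supp; left.
right; rewrite l2v_sum big1 // => e _; rewrite cSeE; case: eqP => // _.
by apply: Ymap_supp; left; rewrite clev_tl hi.
Qed.

(** The sum of [2 * p|_mu] over all words [mu] of at most [N] edges. It depends neither on [D] nor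
    on [x], so [D] can be chosen large compared with it. *)
Fixpoint Yconst (N p : nat) : nat :=
  if N is M.+1 then (2 * p + \sum_(e : edge E) Yconst M (res X p (inr e)))%N
  else (2 * p)%N.

Lemma cU_Ymap N p x :
  hn (cU p%:Z (Ymap N x) - Ymap N (V p x)) <= (Yconst N p)%:R / D%:R * hn x.
Proof.
elim: N p x => [|N IH] p x; first exact: cU_Zmap.
rewrite /= (linearD_of (lU _)) (toeplitz_Q hVS) opprD addrACA.
have D0 : 0 <= D%:R^-1 :> R by rewrite invr_ge0.
rewrite (le_trans (hnD _ _)) // natrD !mulrDl lerD //.
  rewrite (le_trans (cU_Zmap _ _ _ _)) // ler_wpM2l ?mulr_ge0 //.
  by have := tckQ_bnd tS x; rewrite mul1r.
rewrite (linear_sum_of (lU _)) [X in _ - X](reindex_inj (@perm_inj _ (act1 X p))) /=.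
rewrite -sumrB (le_trans (hn_sum _ _ _)) // natr_sum !mulr_suml; apply: ler_sum => e _.
rewrite (toeplitz_adj_ve hVS) (uck_ve hC) -[act1 (extend X) _ _]/(act1 X p e).
rewrite -(linearB_of (lC _)) (le_trans (tcke_bnd tC _ _)) // mul1r.
rewrite (le_trans (IH _ _)) // ler_wpM2l ?mulr_ge0 //.
by have := tcke_adj_bnd tS e x; rewrite mul1r.
Qed.

(** The [k^2] summands are mutually orthogonal, whence the factor [1 / k]. *)
Definition Yavg (k : nat) x : G := (k%:R^-1 : R)%:C *: \sum_(N < k ^ 2) Ymap N x.

Lemma Yavg_lin k : linear (Yavg k).
Proof.
move=> a x y; rewrite /Yavg; under eq_bigr do rewrite Ymap_lin.
by rewrite big_split /= -scaler_sumr scalerDr !scalerA mulrC.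
Qed.

Lemma Yavg_hn k x : (0 < k)%N -> hn (Yavg k x) = hn x.
Proof.
move=> k0; rewrite /Yavg hnZr ger0_norm ?invr_ge0 ?ler0n //.
have k0' : (k%:R : R) != 0 by rewrite pnatr_eq0 -lt0n.
suff -> : hn (\sum_(N < k ^ 2) Ymap N x) = k%:R * hn x by rewrite mulKf.
apply/eqP; rewrite -(eqrXn2 (ltn0Sn 1)) ?mulr_ge0 ?hn_ge0 //.
rewrite -ripxx rip_suml.
under eq_bigr => N _.
  rewrite rip_sumr (bigD1 N) //= ripxx Ymap_hn big1 ?addr0; last first.
    move=> M MN; rewrite /rip l2_hdot_disj // => i.
    case: (eqVneq (ctag i) (N : nat)%:Z) => hi; last by left; apply: Ymap_supp; right.
    right; apply: Ymap_supp; right; rewrite hi; apply: contra MN => /eqP[/esym h].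
    by apply/eqP/val_inj.
  over.
by rewrite sumr_const card_ord exprMn -natrX mulr_natl.
Qed.

Lemma Yavg_v k v x : cS (inl v) (Yavg k x) = Yavg k (S (inl v) x).
Proof.
rewrite /Yavg (linearZ_of (lC _)) (linear_sum_of (lC _)); congr (_ *: _).
by apply: eq_bigr => N _; apply: cSv_Ymap.
Qed.

Lemma Yavg_e k e x : hn (cS (inr e) (Yavg k x) - Yavg k (S (inr e) x)) <= 2 / k%:R * hn x.
Proof.
have -> : cS (inr e) (Yavg k x) - Yavg k (S (inr e) x) =
    (k%:R^-1 : R)%:C *: (Ymap (k ^ 2) (S (inr e) x) - Ymap 0 (S (inr e) x)).
  rewrite /Yavg (linearZ_of (lC _)) -scalerBr (linear_sum_of (lC _)); congr (_ *: _).
  rewrite -sumrB -(telescope_sumr (fun N => Ymap N (S (inr e) x))) // big_mkord.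
  by apply: eq_bigr => N _; rewrite Ymap_S.
rewrite hnZr ger0_norm ?invr_ge0 ?ler0n // mulrAC mulrC ler_wpM2r ?invr_ge0 ?ler0n //.
rewrite (le_trans (hnB _ _)) // !Ymap_hn.
by have := tcke_bnd tS e x; lra.
Qed.

Lemma Yavg_U k p x : hn (cU p%:Z (Yavg k x) - Yavg k (V p x)) <=
  (\sum_(N < k ^ 2) Yconst N p)%:R / D%:R / k%:R * hn x.
Proof.
rewrite /Yavg (linearZ_of (lU _)) -scalerBr (linear_sum_of (lU _)) -sumrB hnZr.
rewrite ger0_norm ?invr_ge0 ?ler0n // mulrAC [leRHS]mulrC ler_wpM2l ?invr_ge0 ?ler0n //.
rewrite (le_trans (hn_sum _ _ _)) // natr_sum !mulr_suml; apply: ler_sum => N _.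
exact: cU_Ymap.
Qed.

End Approximation.

Definition asymp_intertwine (R : realType) (H G : hilbert R) (Y_ : nat -> H -> G)
    (a : H -> H) (b : G -> G) :=
  forall e : R, 0 < e -> exists k0, forall k, (k0 <= k)%N ->
    bnd ((b \o Y_ k) - (Y_ k \o a)) e.

Lemma approx_dilation (R : realType) (E : graph) (X : self_similar nat E) (H : hilbert R)
    (V : nat -> H -> H) (S : cell E -> H -> H) (C : csys (extend X)) :
  toeplitz_rep X V S ->
  exists Y_ : nat -> H -> l2 (ci C) H,
    [/\ forall k, linear (Y_ k), forall k x, hn (Y_ k x) = hn x,
        forall p, asymp_intertwine Y_ (V p) (cU (C := C) (H := H) p%:Z) &
        forall m, asymp_intertwine Y_ (S m) (cS (C := C) (H := H) m)].
Proof.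
move=> hVS.
(* For [p <= k] and [k > 0], [D k] exceeds the total defect over [k^2] levels, so [Yavg_U] yields at
   most [1 / k]; the successor keeps [D] positive. *)
pose D (k : nat) := (k * \sum_(p < k.+1) \sum_(N < k ^ 2) Yconst X N p).+1.
pose Y_ k := Yavg V S C (D k.+1) k.+1.
have small (e : R) (c : nat) : 0 < e -> exists k0, forall k, (k0 <= k)%N -> c%:R / k.+1%:R <= e.
  move=> e0; have c0 : 0 < c%:R + 1 :> R by rewrite ltr_wpDl.
  have [k0 hk] := invS_le (divr_gt0 e0 c0); exists k0 => k /hk.
  rewrite ler_pdivlMr // mulrC mulrDl mul1r; apply: le_trans.
  by rewrite lerDl invr_ge0.
exists Y_; split.
- by move=> k; apply: Yavg_lin.
- by move=> k x; apply: Yavg_hn.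
- move=> p e e0; have [k0 hk] := small e 1%N e0; exists (maxn k0 p) => k.
  rewrite geq_max => /andP[/hk h1 pk] x.
  rewrite (le_trans (Yavg_U hVS C _ _ _ _)) // ler_wpM2r ?hn_ge0 // (le_trans _ h1) //.
  rewrite ler_wpM2r ?invr_ge0 ?ler0n // ler_pdivrMr ?ltr0n // mul1r ler_nat.
  have pk' : (p < k.+2)%N by rewrite ltnS leqW.
  rewrite /D (bigD1 (Ordinal pk')) //= mulnDr -addSn.
  by rewrite (leq_trans _ (leq_addr _ _)) // leqW // leq_pmull.
case=> [v|e] d d0.
  exists 0%N => k _ x; rewrite -[X in hn X]/(cS (inl v) (Y_ k x) - Y_ k (S (inl v) x)).
  by rewrite (Yavg_v hVS) subrr hn0 mulr_ge0 ?hn_ge0 // ltW.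
have [k0 hk] := small d 2%N d0; exists k0 => k /hk h x.
by rewrite (le_trans (Yavg_e hVS C _ _ _ _)) // ler_wpM2r ?hn_ge0.
Qed.

Section Generated.
Variables (R : realType) (H : hilbert R).
Implicit Types (G : set (H -> H)).

Lemma bop_cstar : cstar_algebra (@bounded_op R H).
Proof.
split; last by move=> T; apply: bop_adj.
split; [by []|exact: bop0|by move=> *; apply: bop_lin|by move=> *; apply: bop_comp|].
by move=> T bT _.
Qed.

Lemma cstar_generated_cstar G : G `<=` @bounded_op R H -> cstar_algebra (cstar_generated G).
Proof.
move=> bG; split; first split.
- by move=> T /(_ _ (conj bop_cstar bG)).
- by move=> B [[aB _] _]; apply: oa0.
- by move=> a S T hS hT B hB; apply: (oa_lin hB.1.1); [apply: hS|apply: hT].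
- by move=> S T hS hT B hB; apply: (oa_comp hB.1.1); [apply: hS|apply: hT].
- move=> T bT hT B hB; apply: (oa_closed hB.1.1) => // e /hT[S hS dS].
  by exists S => //; apply: hS.
by move=> T hT B hB; apply: hB.1.2; apply: hT.
Qed.

Lemma algebra_generated_algebra G : G `<=` @bounded_op R H ->
  operator_algebra (algebra_generated G).
Proof.
move=> bG; split.
- by move=> T /(_ _ (conj bop_cstar.1 bG)).
- by move=> B [aB _]; apply: oa0.
- by move=> a S T hS hT B hB; apply: (oa_lin hB.1); [apply: hS|apply: hT].
- by move=> S T hS hT B hB; apply: (oa_comp hB.1); [apply: hS|apply: hT].
- move=> T bT hT B hB; apply: (oa_closed hB.1) => // e /hT[S hS dS].
  by exists S => //; apply: hS.
Qed.

Lemma cstar_generated_min G (B : set (H -> H)) : cstar_algebra B -> G `<=` B ->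
  cstar_generated G `<=` B.
Proof. by move=> cB GB T; apply. Qed.

Lemma cstar_generated_sub G : G `<=` cstar_generated G.
Proof. by move=> T GT B [_]; apply. Qed.

Lemma algebra_generated_min G (B : set (H -> H)) : operator_algebra B -> G `<=` B ->
  algebra_generated G `<=` B.
Proof. by move=> cB GB T; apply. Qed.

Lemma algebra_generated_sub G : G `<=` algebra_generated G.
Proof. by move=> T GT B [_]; apply. Qed.

End Generated.

(** * Norm bounds from asymptotic intertwining *)

Section Asymptotic.
Variables (R : realType) (H G : hilbert R) (Y_ : nat -> H -> G).
Hypothesis Y_lin : forall k, linear (Y_ k).
Hypothesis Y_hn : forall k x, hn (Y_ k x) = hn x.
Implicit Types (S T : H -> H).

Lemma asymp0 : asymp_intertwine Y_ 0 0.
Proof.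
move=> e e0; exists 0%N => k _ x; rewrite -[X in hn X]/(0 - Y_ k 0).
by rewrite (linear0_of (Y_lin k)) subrr hn0 mulr_ge0 ?hn_ge0 ?(ltW e0).
Qed.

Lemma asymp_lin (a : R[i]) S (S' : G -> G) T (T' : G -> G) : asymp_intertwine Y_ S S' ->
  asymp_intertwine Y_ T T' -> asymp_intertwine Y_ (a *: S + T) (a *: S' + T').
Proof.
move=> hS hT e e0; have c0 : 0 < cmod a + 1 by have := cmod_ge0 a; lra.
have d0 : 0 < e / (cmod a + 1) by rewrite divr_gt0.
have [k1 h1] := hS _ d0; have [k2 h2] := hT _ d0.
exists (maxn k1 k2) => k; rewrite geq_max => /andP[/h1 b1 /h2 b2].
have -> : (a *: S' + T') \o Y_ k - (Y_ k \o (a *: S + T)) =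
    a *: ((S' \o Y_ k) - (Y_ k \o S)) + ((T' \o Y_ k) - (Y_ k \o T)).
  apply/funext => x; rewrite -[LHS]/(a *: S' (Y_ k x) + T' (Y_ k x) - Y_ k (a *: S x + T x)).
  by rewrite Y_lin opprD addrACA -scalerBr.
by apply: bnd_le (bnd_lin a b1 b2); rewrite -[X in _ + X]mul1r -mulrDl mulrC divfK ?gt_eqF.
Qed.

Lemma asymp_comp S (S' : G -> G) T (T' : G -> G) : bounded_op S' -> bounded_op T -> asymp_intertwine Y_ S S' ->
  asymp_intertwine Y_ T T' -> asymp_intertwine Y_ (S \o T) (S' \o T').
Proof.
move=> bS' bT hS hT e e0; have [c c0 hc] := bop_bnd bS'; have [d d0 hd] := bop_bnd bT.
have cd0 : 0 < c + d + 1 by lra.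
have e1 : 0 < e / (c + d + 1) by rewrite divr_gt0.
have [k1 h1] := hS _ e1; have [k2 h2] := hT _ e1.
exists (maxn k1 k2) => k; rewrite geq_max => /andP[/h1 b1 /h2 b2].
have -> : ((S' \o T') \o Y_ k) - (Y_ k \o (S \o T)) =
    (S' \o ((T' \o Y_ k) - (Y_ k \o T))) + (((S' \o Y_ k) - (Y_ k \o S)) \o T).
  apply/funext => x; rewrite -[LHS]/(S' (T' (Y_ k x)) - Y_ k (S (T x))).
  rewrite -[RHS]/(S' (T' (Y_ k x) - Y_ k (T x)) + (S' (Y_ k (T x)) - Y_ k (S (T x)))).
  by rewrite (linearB_of (bop_linear bS')) addrA subrK.
apply: bnd_le (bndD (bnd_comp c0 hc b2) (bnd_comp (ltW e1) b1 hd)).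
rewrite [X in X + _]mulrC -mulrDr mulrAC ler_pdivrMr // ler_wpM2l ?(ltW e0) //; lra.
Qed.

(** Applied in each coordinate, [Y_ m] is isometric and almost carries [M] to [M'], so a bound for
    [M'] passes to [M] up to an error absorbed by [e]. *)
Lemma asymp_mxbnd n (M : 'M[H -> H]_n) (M' : 'M[G -> G]_n) (c : R) : 0 <= c ->
  (forall i j, asymp_intertwine Y_ (M i j) (M' i j)) -> mxbnd M' c -> mxbnd M c.
Proof.
move=> c0 hM /(mxbndP _ c0) hM'; apply/(mxbndP _ c0) => x; apply/ler_addgt0Pr => e e0.
pose k := n%:R * n%:R * hn x + 1; have k_gt0 : 0 < k by rewrite ltr_wpDl ?mulr_ge0 ?hn_ge0.
have d0 : 0 < e / k by rewrite divr_gt0.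
have /choice[k0 hk0] : forall ij : 'I_n * 'I_n, exists k0, forall l, (k0 <= l)%N ->
    bnd ((M' ij.1 ij.2 \o Y_ l) - (Y_ l \o M ij.1 ij.2)) (e / k).
  by move=> [i j]; apply: hM.
pose m := (\max_ij k0 ij)%N.
pose Yx y : l2 'I_n G := vec (fun i => Y_ m (l2v (y : l2 'I_n H) i)).
have hYx y : hn (Yx y) = hn y.
  by apply/eqP; rewrite -(eqrXn2 (ltn0Sn 1)) ?hn_ge0 // !l2_hn_fin; under eq_bigr do rewrite Y_hn.
rewrite -(hYx (mx2op M x)) -(subrK (mx2op M' (Yx x)) (Yx (mx2op M x))).
rewrite (le_trans (hnD _ _)) // addrC lerD //; first by rewrite -(hYx x); apply: hM'.
rewrite (vec_decomp (_ - _)) (le_trans (hn_sum _ _ _)) //.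
apply: (@le_trans _ _ (\sum_(i < n) \sum_(j < n) e / k * hn x)); last first.
  rewrite !sumr_const card_ord -mulrnA -[leLHS]mulr_natl natrM mulrCA -mulrA mulrCA.
  by rewrite mulrCA ger_pMr // mulrC ler_pdivrMr // mul1r /k lerDl.
apply: ler_sum => i _; rewrite hn_l2_del l2vB.
rewrite -[l2v (Yx (mx2op M x)) i]/(Y_ m (l2v (mx2op M x) i)) !mx2opE hnBC (linear_sum_of (Y_lin m)).
rewrite -sumrB (le_trans (hn_sum _ _ _)) //; apply: ler_sum => j _.
have := hk0 (i, j) m (leq_bigmax (i, j)) (l2v x j) => /le_trans; apply.
by rewrite ler_wpM2l ?(ltW d0) // hn_l2v.
Qed.

End Asymptotic.

Section GeneratorPairs.
Variables (R : realType) (E : graph) (H K : hilbert R).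
Variables (V : nat -> H -> H) (S : cell E -> H -> H).
Variables (V' : nat -> K -> K) (S' : cell E -> K -> K).

Inductive genpair : (H -> H) -> (K -> K) -> Prop :=
| genpair_V p : genpair (V p) (V' p)
| genpair_S m : genpair (S m) (S' m).

Lemma genpair_bop (X : self_similar nat E) : toeplitz_rep X V S -> toeplitz_rep X V' S' ->
  forall T T', genpair T T' -> bounded_op T /\ bounded_op T'.
Proof.
move=> h h' _ _ [p|m]; first by split; [apply: (toeplitz_bounded h)|apply: (toeplitz_bounded h')].
by split; [apply: (tck_bounded (toeplitz_tck h))|apply: (tck_bounded (toeplitz_tck h'))].
Qed.

End GeneratorPairs.

Section Domination.
Variables (R : realType) (E : graph) (X : self_similar nat E).
Hypothesis hE : source_free E.
Hypothesis hX : forall e : edge E, exists m : nat, res X m (inr e) <> 0%N.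
Variables (H K : hilbert R) (V : nat -> H -> H) (S : cell E -> H -> H).
Variables (u : int -> K -> K) (s : cell E -> K -> K).
Hypothesis hVS : toeplitz_rep X V S.
Hypothesis hus : universal_unitary_ck_rep (extend X) u s.

(** Universality maps [(u, s)] to the combinatorial representation by a *-homomorphism [phi], which
    is completely contractive; asymptotic intertwining pulls the bound back to [(V, S)]. *)
Lemma toeplitz_le_unitary_ck n (M : 'M[H -> H]_n) (M' : 'M[K -> K]_n) (c : R) :
  0 <= c -> (forall i j, palg (genpair V S (fun p => u p%:Z) s) (M i j) (M' i j)) ->
  mxbnd M' c -> mxbnd M c.
Proof.
move=> c0 hM hM'; pose C := csys_exists hE hX.
have hC := c_unitary_ck_rep C H.
have [phi [hphi phiE]] := hus.2 _ (rep_family (cU (C := C) (H := H)) (cS (C := C) (H := H))) hC.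
have [Y_ [Y_lin Y_hn YV YS]] := approx_dilation C hVS.
pose A := family_cstar u s.
have bG T T' : genpair V S (fun p => u p%:Z) s T T' -> bounded_op T /\ bounded_op T'.
  exact: genpair_bop hVS (uck_toeplitz hus.1) T T'.
have gA i : A (rep_family u s i) by move=> B [_]; apply; exists i.
have csA : cstar_algebra A by apply: cstar_generated_cstar => _ [[g|m] _ <-]; 
  [apply: (uck_bounded hus.1)|apply: (tck_bounded (uck_tck hus.1))].
have hA T T' : palg (genpair V S (fun p => u p%:Z) s) T T' ->
    A T' /\ asymp_intertwine Y_ T (phi T').
  elim=> {T T'} [_ _ [p|m]| |a T T' W W' _ [AT iT] _ [AW iW]|T T' W W' pT [AT iT] pW [AW iW]].
  - by split; [apply: (gA (inl _))|rewrite (phiE (inl p%:Z))].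
  - by split; [apply: (gA (inr _))|rewrite (phiE (inr m))].
  - by split; [apply: (oa0 csA.1)|rewrite (hom0 csA.1 hphi.1); apply: asymp0].
  - by split; [exact: (oa_lin csA.1)|rewrite (hom_lin hphi.1 a AT AW); exact: asymp_lin].
  split; first exact: (oa_comp csA.1).
  rewrite (hom_comp hphi.1 AT AW).
  exact: (asymp_comp (hom_in hphi.1 AT) (palg_bop bG pW).1 iT iW).
apply: (asymp_mxbnd Y_lin Y_hn c0 (M' := map_mx phi M')).
  by move=> i j; rewrite mxE; have [] := hA _ _ (hM i j).
by apply: (star_hom_mxbnd csA _ hphi c0) => // i j; have [] := hA _ _ (hM i j).
Qed.

End Domination.

(** * Separable reducing subspaces *)

Section SeparableReducing.
Variables (R : realType) (K : hilbert R) (I J : countType).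
Variables (x : I -> K) (T : J -> K -> K).
Hypothesis bT : forall j, bounded_op (T j).

(* A countable set of operators whose closed invariant subsets that are stable
   under addition are the closed invariant subspaces. *)
Let op (o : J + (rat + unit)) : K -> K :=
  match o with
  | inl j => T j
  | inr (inl q) => fun y => (ratr q : R)%:C *: y
  | inr (inr _) => fun y => ('i : R[i]) *: y
  end.

Let op_lin o : linear (op o).
Proof.
case: o => [j|[q|_]] a y z /=; first exact: (bop_linear (bT j)).
- by rewrite scalerDr !scalerA mulrC.
- by rewrite scalerDr !scalerA mulrC.
Qed.

Let op_bnd o : exists2 c : R, 0 <= c & bnd (op o) c.
Proof.
rewrite /op; move: o => [j|[q|u]]; first exact: (bop_bnd (bT j)).
- by exists (cmod (ratr q : R)%:C) => [|y]; rewrite ?cmod_ge0 ?hnZ.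
- by exists (cmod ('i : R[i])) => [|y]; rewrite ?cmod_ge0 ?hnZ.
Qed.

(** Terms over the generators [x i], with the maps of [op] as unary symbols and the sum as binary
    symbol. Trees over a countable type are countable, which makes the closure [sr_car] separable;
    other trees and invalid codes evaluate to the default 0. *)
Fixpoint sr_eval (t : GenTree.tree I) : K :=
  match t with
  | GenTree.Leaf i => x i
  | GenTree.Node k [:: t1] =>
      if unpickle k is Some o then op o (sr_eval t1) else 0
  | GenTree.Node _ [:: t1; t2] => sr_eval t1 + sr_eval t2
  | _ => 0
  end.

Definition sr_car : set K := [set y | forall e : R, 0 < e -> exists t, hn (y - sr_eval t) <= e].

Lemma sr_eval_car t : sr_car (sr_eval t).
Proof. by move=> e e0; exists t; rewrite subrr hn0 ltW. Qed.

Lemma sr_closed y : (forall e : R, 0 < e -> exists2 z, sr_car z & hn (y - z) <= e) -> sr_car y.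
Proof.
move=> h e e0; have e2 : 0 < e / 2 by rewrite divr_gt0.
have [z hz yz] := h _ e2; have [t ht] := hz _ e2; exists t.
by rewrite (le_trans (hnBD z _ _)) // (splitr e) lerD.
Qed.

Lemma sr_add y z : sr_car y -> sr_car z -> sr_car (y + z).
Proof.
move=> hy hz e e0; have e2 : 0 < e / 2 by rewrite divr_gt0.
have [t ht] := hy _ e2; have [t' ht'] := hz _ e2.
exists (GenTree.Node 0 [:: t; t']).
by rewrite /= opprD addrACA (le_trans (hnD _ _)) // (splitr e) lerD.
Qed.

Let sr_op o y : sr_car y -> sr_car (op o y).
Proof.
move=> hy e e0; have [c c0 hc] := op_bnd o.
have c1 : 0 < c + 1 by lra.
have [t ht] := hy _ (divr_gt0 e0 c1); exists (GenTree.Node (pickle o) [:: t]).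
rewrite /= pickleK -(linearB_of (op_lin o)) (le_trans (hc _)) //.
apply: (le_trans (ler_wpM2l c0 ht)); rewrite mulrCA ger_pMr // ler_pdivrMr // mul1r; lra.
Qed.

Lemma sr_T j y : sr_car y -> sr_car (T j y).
Proof. exact: (sr_op (inl j)). Qed.

Let sr_real (r : R) y : sr_car y -> sr_car (r%:C *: y).
Proof.
move=> hy; apply: sr_closed => e e0.
have y1 : 0 < hn y + 1 by rewrite ltr_wpDl ?hn_ge0.
have [q /itvP hq] : exists q, ratr q \in `]r, r + e / (hn y + 1)[.
  by apply: rat_in_itvoo; rewrite ltrDl divr_gt0.
exists (op (inr (inl q)) y); first exact: sr_op.
rewrite /= -scalerBl -rmorphB hnZ cmod_real distrC ger0_norm ?subr_ge0 ?hq //.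
have h : ratr q - r <= e / (hn y + 1) by rewrite lerBlDl hq.
rewrite (le_trans (ler_wpM2r (hn_ge0 y) h)) // -mulrA ger_pMr // mulrC ler_pdivrMr // mul1r; lra.
Qed.

Lemma sr_lin (a : R[i]) y z : sr_car y -> sr_car z -> sr_car (a *: y + z).
Proof.
move=> hy hz; apply: sr_add => //; rewrite [a]complexE scalerDl -scalerA.
apply: sr_add; first exact: sr_real.
by rewrite complexiE; apply/(sr_op (inr (inr tt)))/sr_real.
Qed.

Lemma sr_car0 : sr_car 0.
Proof. exact: (sr_eval_car (GenTree.Node 0 [::])). Qed.

Let sr_dot_lin (a : R[i]) y z w : sr_car y -> sr_car z -> sr_car w ->
  hdot K (a *: y + z) w = a * hdot K y w + hdot K z w.
Proof. by move=> _ _ _; rewrite hdotDl hdotZl. Qed.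

Let sr_dotC y z : sr_car y -> sr_car z -> hdot K y z = ((hdot K z y)^*)%R.
Proof. by move=> _ _; rewrite [LHS]hdotC. Qed.

Let sr_dot_gt0 y : sr_car y -> y != 0 -> 0 < hdot K y y.
Proof.
move=> _ y0; rewrite hdotxx ltcR exprn_gt0 // lt_def hn_ge0 andbT.
by apply: contra y0 => /eqP/hn_eq0 ->.
Qed.

Let sr_complete (x_ : nat -> K) : (forall n, sr_car (x_ n)) ->
  (forall e : R, 0 < e -> exists N, forall m n, (N <= m)%N -> (N <= n)%N ->
     complex.Re (hdot K (x_ m - x_ n) (x_ m - x_ n)) <= e ^+ 2) ->
  exists2 z, sr_car z & forall e : R, 0 < e -> exists N, forall n, (N <= n)%N ->
     complex.Re (hdot K (x_ n - z) (x_ n - z)) <= e ^+ 2.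
Proof.
move=> hx cx; have [|z hz] := @hcomplete _ K x_.
  move=> e e0; have [N hN] := cx e e0; exists N => m n Nm Nn.
  by have := hN m n Nm Nn; rewrite -/(rip _ _) ripxx ler_sqr ?nnegrE ?hn_ge0 ?(ltW e0).
exists z.
  apply: sr_closed => e /hz[N hN]; exists (x_ N) => //.
  by rewrite hnBC; apply: hN.
move=> e e0; have [N hN] := hz e e0; exists N => n /hN h.
by rewrite -/(rip _ _) ripxx ler_sqr ?nnegrE ?hn_ge0 ?(ltW e0).
Qed.

Definition sr_ip : ipsub K :=
  IpSub sr_car0 sr_lin sr_dot_lin sr_dotC sr_dot_gt0 sr_complete.

Definition sr_space : hilbert R := ip_hilbert sr_ip.

Lemma sr_separable : separable_space sr_space.
Proof.
pose f t : sr_space := ipmk (sr_eval_car t : ip_car sr_ip _).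
exists (f @` setT); first exact: sub_countable (card_image_le _ _) (countableP _).
move=> O [z Oz] oO; have /nbhs_ballP[e e0 he] : nbhs z O by apply: open_nbhs_nbhs.
have eE : e = (complex.Re e)%:C by rewrite RRe_real // gtr0_real.
have e20 : 0 < complex.Re e / 2 by rewrite divr_gt0 // -ltcR -eE.
have [t ht] : exists t, hn (ival z - sr_eval t) <= complex.Re e / 2 by apply: (ival_car z).
exists (f t); split; last by exists t.
apply: he; rewrite -ball_normE; suff : `|(z - f t : sr_space)| < e by [].
rewrite hnE eE ltcR.
suff h : hn (z - f t) = hn (ival z - sr_eval t) by rewrite h; lra.
by apply/eqP; rewrite -(eqrXn2 (ltn0Sn 1)) ?hn_ge0 // ip_hn_sqr -ripxx.
Qed.

Lemma separable_reducing : exists (L : hilbert R) (U : L -> K),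
  [/\ separable_space L, linear_isometry U, forall i, exists y, U y = x i
    & forall j y, exists z, U z = T j (U y)].
Proof.
exists sr_space, (@ival _ _ sr_ip); split.
- exact: sr_separable.
- by split.
- move=> i; have h : ip_car sr_ip (x i) by exact: (sr_eval_car (GenTree.Leaf i)).
  by exists (ipmk h).
move=> j y; have h : ip_car sr_ip (T j (ival y)) by apply/sr_T/(ival_car y).
by exists (ipmk h).
Qed.

End SeparableReducing.

Section Restriction.
Variables (R : realType) (L K : hilbert R) (U : L -> K).
Hypothesis hU : linear_isometry U.

Lemma isom_hn y : hn (U y) = hn y.
Proof. by apply/eqP; rewrite -(eqrXn2 (ltn0Sn 1)) ?hn_ge0 // -!ripxx /rip hU.2. Qed.

Lemma isom_inj : injective U.
Proof.
move=> y z e; apply/eqP; rewrite -subr_eq0; apply/eqP/hn_eq0.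
by rewrite -isom_hn (linearB_of hU.1) e subrr hn0.
Qed.

Definition leaves_range (T : K -> K) := forall y, exists z, U z = T (U y).

Definition restr (T : K -> K) : L -> L := fun y => xget 0 [set z | U z = T (U y)].

Lemma restrE T y : leaves_range T -> U (restr T y) = T (U y).
Proof.
move=> /(_ y) h; rewrite /restr; case: xgetP => [z _ //|h'].
by case: h => w /h'.
Qed.

Lemma restr_bop T : bounded_op T -> leaves_range T -> bounded_op (restr T).
Proof.
move=> bT rT; have [c c0 hc] := bop_bnd bT; apply: (@bop_of _ _ _ c) => [a y z|y].
  by apply: isom_inj; rewrite hU.1 !restrE // hU.1 (bop_linear bT).
by rewrite -isom_hn restrE // -(isom_hn y).
Qed.

Lemma restr_adj T : bounded_op T -> leaves_range T -> leaves_range (adj T) ->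
  adj (restr T) = restr (adj T).
Proof.
move=> bT rT rT'; apply: adj_unique => y z.
by rewrite -!hU.2 !restrE // adjP.
Qed.

(** Invariance under the adjoints as well makes [adj] commute with restriction, so each relation can
    be checked after applying the injective map [U]. *)
Lemma restr_toeplitz (E : graph) (X : self_similar nat E) (V : nat -> K -> K)
    (S : cell E -> K -> K) : toeplitz_rep X V S ->
  (forall p, leaves_range (V p) /\ leaves_range (adj (V p))) ->
  (forall m, leaves_range (S m) /\ leaves_range (adj (S m))) ->
  toeplitz_rep X (fun p => restr (V p)) (fun m => restr (S m)).
Proof.
move=> h rV rS; have t := toeplitz_tck h.
have bV := toeplitz_bounded h; have bS := tck_bounded t.
have eV p := restrE _ (rV p).1; have eV' p := restrE _ (rV p).2.
have eS m := restrE _ (rS m).1; have eS' m := restrE _ (rS m).2.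
have aV p := restr_adj (bV p) (rV p).1 (rV p).2.
have aS m := restr_adj (bS m) (rS m).1 (rS m).2.
split.
- by move=> p; apply: restr_bop (bV p) (rV p).1.
- move=> p; apply/funext => y; apply: isom_inj; rewrite aV /= eV' eV.
  by have := congr1 (@^~ (U y)) (toeplitz_isometry h p).
- by apply/funext => y; apply: isom_inj; rewrite eV (toeplitz_id h).
- by move=> p q; apply/funext => y; apply: isom_inj; rewrite /= !eV (toeplitz_add h).
- split.
  + by move=> m; apply: restr_bop (bS m) (rS m).1.
  + move=> v; have [idv adv] := tck_proj t v; split.
      apply/funext => y; apply: isom_inj; rewrite /= !eS.
      by have := congr1 (@^~ (U y)) idv.
    by rewrite aS adv.
  + move=> v w vw; apply/funext => y; apply: isom_inj; rewrite /= !eS.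
    rewrite -[LHS]/(S (inl v) (S (inl w) (U y))) -[RHS]/(U 0) (linear0_of hU.1).
    by have := congr1 (@^~ (U y)) (tck_orth t vw).
  + move=> e; apply/funext => y; apply: isom_inj; rewrite aS /= eS' !eS.
    by have := congr1 (@^~ (U y)) (tck_src t e).
  + move=> v y; rewrite -!hU.2 eS.
    have -> : U (range_sum (fun m => restr (S m)) v y) = range_sum S v (U y).
      rewrite /range_sum !fct_sum (linear_sum_of hU.1); apply: eq_bigr => e _.
      by rewrite /= eS aS eS'.
    exact: (tck_le t).
  + apply/funext => y; apply: isom_inj; rewrite fct_sum (linear_sum_of hU.1).
    under eq_bigr do rewrite eS.
    by have := congr1 (@^~ (U y)) (tck_nondegenerate t); rewrite fct_sum.
- move=> p m; apply/funext => y; apply: isom_inj; rewrite /= eV !eS eV.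
  by have := congr1 (@^~ (U y)) (toeplitz_comm h p m).
- move=> p m; apply/funext => y; apply: isom_inj; rewrite !aV /= eV' !eS eV'.
  by have := congr1 (@^~ (U y)) (toeplitz_adj h p m).
Qed.

End Restriction.

Section UniversalDomination.
Variables (R : realType) (E : graph) (X : self_similar nat E).
Variables (H K : hilbert R) (V : nat -> H -> H) (S : cell E -> H -> H).
Variables (V' : nat -> K -> K) (S' : cell E -> K -> K).
Hypothesis hVS : universal_toeplitz_rep X V S.
Hypothesis hVS' : toeplitz_rep X V' S'.

(** A matrix bound is tested on one finite tuple [x]. A separable reducing subspace [L] through [x]
    carries a Toeplitz representation that reappears as a summand of the universal one, so
    [U : L -> K] and [Z : L -> H] transport the same vectors to both sides. *)
Lemma toeplitz_le_universal n (M : 'M[H -> H]_n) (M' : 'M[K -> K]_n) (c : R) :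
  (forall i j, palg (genpair V S V' S') (M i j) (M' i j)) ->
  mxbnd M c -> mxbnd M' c.
Proof.
move=> hM hc x.
have bV := toeplitz_bounded hVS'; have bS := tck_bounded (toeplitz_tck hVS').
pose T (j : (nat + nat) + (cell E + cell E)) : K -> K := match j with
  | inl (inl p) => V' p | inl (inr p) => adj (V' p)
  | inr (inl m) => S' m | inr (inr m) => adj (S' m) end.
have bT j : bounded_op (T j) by case: j => -[]k /=; rewrite ?bV ?bS //; apply: bop_adj.
have [L [U [sL hU Ux UT]]] := separable_reducing x bT.
have hL : toeplitz_rep X (fun p => restr U (V' p)) (fun m => restr U (S' m)).
  apply: restr_toeplitz => // k; split.
  - exact: (UT (inl (inl k))).
  - exact: (UT (inl (inr k))).
  - exact: (UT (inr (inl k))).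
  - exact: (UT (inr (inr k))).
have [_ [I [Ki [Vi [Si [iota [_ hsep hiota _ _]]]]]]] := hVS.
have [i [W [hW _ [WV WS]]]] := hsep _ _ _ sL hL.
have [hi [iV iS]] := hiota i.
pose Z := iota i \o W.
have hZ : linear_isometry Z.
  split=> [a y z|y z]; rewrite /Z /=; first by rewrite hW.1 hi.1.
  by rewrite hi.2 hW.2.
have key a b : palg (genpair V S V' S') a b ->
    forall y, exists z, U z = b (U y) /\ Z z = a (Z y).
  elim=> {a b} [_ _ [p|m]| |t a b a' b' _ h1 _ h2|a b a' b' _ h1 _ h2] y.
  - exists (restr U (V' p) y); split; first by rewrite restrE //; apply: (UT (inl (inl p))).
    have := congr1 (@^~ y) (WV p); rewrite /Z /= => ->.
    by have := congr1 (@^~ (W y)) (iV p).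
  - exists (restr U (S' m) y); split; first by rewrite restrE //; apply: (UT (inr (inl m))).
    have := congr1 (@^~ y) (WS m); rewrite /Z /= => ->.
    by have := congr1 (@^~ (W y)) (iS m).
  - by exists 0; rewrite (linear0_of hU.1) (linear0_of hZ.1).
  - have [z1 [u1 w1]] := h1 y; have [z2 [u2 w2]] := h2 y.
    by exists (t *: z1 + z2); rewrite hU.1 hZ.1 u1 u2 w1 w2.
  - have [z [u w]] := h2 y; have [z' [u' w']] := h1 z.
    by exists z'; rewrite u' w' u w.
have /choice[y hy] := Ux.
have /choice[z hz] : forall ij : 'I_n * 'I_n, exists z,
    U z = M' ij.1 ij.2 (x ij.2) /\ Z z = M ij.1 ij.2 (Z (y ij.2)).
  by move=> [i' j] /=; rewrite -hy; apply: key.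
have e1 k : hn (\sum_j M' k j (x j)) = hn (\sum_j M k j (Z (y j))).
  have -> : \sum_j M' k j (x j) = U (\sum_j z (k, j)).
    by rewrite (linear_sum_of hU.1); apply: eq_bigr => j _; have [->] := hz (k, j).
  have -> : \sum_j M k j (Z (y j)) = Z (\sum_j z (k, j)).
    by rewrite (linear_sum_of hZ.1); apply: eq_bigr => j _; have [_ ->] := hz (k, j).
  by rewrite (isom_hn hU) (isom_hn hZ).
under eq_bigr do rewrite e1.
have -> : \sum_j hn (x j) ^+ 2 = \sum_j hn (Z (y j)) ^+ 2.
  by apply: eq_bigr => j _; rewrite -hy (isom_hn hU) (isom_hn hZ).
exact: hc.
Qed.

End UniversalDomination.

(** * Approximation of completely positive maps *)

Section RealAdjoint.
Variables (R : realType) (H : hilbert R).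
Implicit Types (x y : H).

Lemma adj_of_rip (T T' : H -> H) : linear T' ->
  (forall x y, rip (T x) y = rip x (T' y)) -> adj T = T'.
Proof.
move=> lT' h; apply: adj_unique => x y.
by rewrite !hdotE !h (linearZ_of lT').
Qed.

Lemma rip_min0 x y : (forall t : R, hn x <= hn (x + t%:C *: y)) -> rip x y = 0.
Proof.
move=> h; set q := hn y ^+ 2; have q0 : 0 <= q := sqr_ge0 _.
have {}h t : 0 <= 2 * t * rip x y + t ^+ 2 * q.
  have := h t; rewrite -(ler_pXn2r (ltn0Sn 1)) ?nnegrE ?hn_ge0 // hn_sqrD ripZr hnZr.
  by rewrite exprMn -normrX (ger0_norm (sqr_ge0 _)) -/q; lra.
have q1 : 0 < q + 1 by lra.
apply/eqP; rewrite -sqrf_eq0 eq_le sqr_ge0 andbT.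
have := h (- rip x y / (q + 1)); set r := rip x y => hr.
have : 0 <= (2 * (- r / (q + 1)) * r + (- r / (q + 1)) ^+ 2 * q) * (q + 1) ^+ 2.
  by rewrite mulr_ge0 ?sqr_ge0.
have -> : (2 * (- r / (q + 1)) * r + (- r / (q + 1)) ^+ 2 * q) * (q + 1) ^+ 2 =
    - (r ^+ 2 * (q + 2)) by field; lra.
by rewrite oppr_ge0 pmulr_lle0 //; lra.
Qed.

(** Moving from [P x] along the kernel cannot shorten it, since [P] maps the moved vector back to
    [P x] without increasing norms. Hence range and kernel are orthogonal. *)
Lemma idempotent_contraction_adj (P : H -> H) :
  linear P -> P \o P = P -> bnd P 1 -> adj P = P.
Proof.
move=> lP PP Pb; have PE x : P (P x) = P x by have := congr1 (@^~ x) PP.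
have orth x y : rip (P x) (y - P y) = 0.
  apply: rip_min0 => t; have := Pb (P x + t%:C *: (y - P y)).
  rewrite mul1r (linearD_of lP) (linearZ_of lP) (linearB_of lP) !PE subrr.
  by rewrite scaler0 addr0.
apply: adj_of_rip => // x y.
have -> : rip (P x) y = rip (P x) (P y) by rewrite -[in LHS](subrK (P y) y) ripDr orth add0r.
by rewrite -[in RHS](subrK (P x) x) ripDl [rip (x - _) _]ripC orth add0r.
Qed.

End RealAdjoint.

Section Diagonal.
Variables (R : realType) (I : finType) (H : hilbert R).
Implicit Types (T S : H -> H) (F G : l2 I H).

Definition amp T F : l2 I H := vec (fun i => T (l2v F i)).

Lemma ampE T F i : l2v (amp T F) i = T (l2v F i). Proof. by []. Qed.

Lemma amp_bnd T (c : R) : 0 <= c -> bnd T c -> bnd (amp T) c.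
Proof.
move=> c0 h F; apply: le_of_sqr; first by rewrite mulr_ge0 ?hn_ge0.
rewrite exprMn !l2_hn_fin mulr_sumr; apply: ler_sum => i _.
by rewrite -exprMn ler_sqr ?nnegrE ?mulr_ge0 ?hn_ge0 //; apply: h.
Qed.

Lemma amp_linear T : linear T -> linear (amp T).
Proof. by move=> lT a F G; apply: l2_eq => i; rewrite l2vD l2vZ !ampE l2vD l2vZ lT. Qed.

Lemma amp_bop T : bounded_op T -> bounded_op (amp T).
Proof.
move=> bT; have [c c0 hc] := bop_bnd bT.
exact: bop_of (amp_linear (bop_linear bT)) (amp_bnd c0 hc).
Qed.

Lemma amp_adj T : bounded_op T -> adj (amp T) = amp (adj T).
Proof.
move=> bT; apply: adj_unique => F G; rewrite !l2_hdot_fin; apply: eq_bigr => i _.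
by rewrite !ampE adjP.
Qed.

Lemma rip_fin F G : rip F G = \sum_i rip (l2v F i) (l2v G i).
Proof. by rewrite /rip l2_hdot_fin cRe_sum. Qed.

End Diagonal.

Section CompletePositivity.
Variables (R : realType) (H L K : hilbert R) (A : set (H -> H)).
Variables (j : (H -> H) -> L -> L) (phi : (H -> H) -> K -> K).
Hypotheses (algA : operator_algebra A) (A1 : A idfun).
Hypotheses (hj : alg_hom A (@bounded_op R L) j) (hphi : alg_hom A (@bounded_op R K) phi).
Hypothesis phi1 : phi idfun = idfun.
Hypothesis j1_bnd : bnd (j idfun) 1.
Hypothesis dom : forall n (M : 'M[H -> H]_n) (c : R), (forall k l, A (M k l)) ->
  0 <= c -> mxbnd (map_mx j M) c -> mxbnd (map_mx phi M) c.

Local Notation P := (j idfun).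

Lemma cp_bop_j a : A a -> bounded_op (j a). Proof. exact: (hom_in hj). Qed.
Lemma cp_PP : P \o P = P. Proof. by rewrite -(hom_comp hj A1 A1). Qed.

(** [j] is not assumed unital: [P] is a contractive idempotent, hence a projection, and [j] lives on
    its range. *)
Lemma cp_P_adj : adj P = P.
Proof. exact: idempotent_contraction_adj (bop_linear (cp_bop_j A1)) cp_PP j1_bnd. Qed.

Lemma cp_jP a x : A a -> j a (P x) = j a x.
Proof. by move=> Aa; have := congr1 (@^~ x) (hom_comp hj Aa A1). Qed.

Lemma cp_Pj a x : A a -> P (j a x) = j a x.
Proof. by move=> Aa; have := congr1 (@^~ x) (hom_comp hj A1 Aa). Qed.

(* The bound on [j M] is equivalent, to first order in [t], to a norm bound on
   [1 + t M], which [phi] preserves. *)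
Lemma cp_transfer n (M : 'M[H -> H]_n) (eta : R) : (forall k l, A (M k l)) -> 0 <= eta ->
  (forall xi : l2 'I_n L, rip (mx2op (map_mx j M) xi) xi <= eta * hn xi ^+ 2) ->
  forall y : l2 'I_n K, rip (mx2op (map_mx phi M) y) y <= eta * hn y ^+ 2.
Proof.
move=> AM eta0 hM y.
pose Mj := mx2op (map_mx j M); pose Mf := mx2op (map_mx phi M).
have bMj : bounded_op Mj by apply: mx2op_bop => k l; rewrite mxE; apply: cp_bop_j.
have [c c0 hc] := bop_bnd bMj.
pose N (t : R) : 'M[H -> H]_n := \matrix_(k, l) (t%:C *: M k l + (if k == l then idfun else 0)).
have Ade (k l : 'I_n) : A (if k == l then idfun else 0) by case: eqP => // _; apply: oa0.
have AN t k l : A (N t k l) by rewrite mxE; apply: oa_lin.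
have Nj t xi : mx2op (map_mx j (N t)) xi = amp P xi + t%:C *: Mj (amp P xi).
  apply: l2_eq => k; rewrite l2vD l2vZ !mx2opE ampE scaler_sumr.
  rewrite [X in X + _](_ : _ = \sum_l (if k == l then P (l2v xi l) else 0)); last first.
    by rewrite -big_mkcond (big_pred1 k) // => l; rewrite eq_sym.
  rewrite -big_split; apply: eq_bigr => l _ /=; rewrite !mxE (hom_lin hj) //.
  rewrite ampE cp_jP // addrC; case: eqP => [->//|_]; rewrite (hom0 algA hj).
  by rewrite !addr0.
have Nf t : mx2op (map_mx phi (N t)) y = y + t%:C *: Mf y.
  apply: l2_eq => k; rewrite l2vD l2vZ !mx2opE scaler_sumr.
  rewrite [X in X + _](_ : _ = \sum_l (if k == l then l2v y l else 0)); last first.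
    by rewrite -big_mkcond (big_pred1 k) // => l; rewrite eq_sym.
  rewrite -big_split; apply: eq_bigr => l _ /=; rewrite !mxE (hom_lin hphi) //.
  by rewrite addrC; case: eqP => [->|_]; rewrite ?phi1 // (hom0 algA hphi) !addr0.
have key (t : R) : 0 < t -> rip (Mf y) y <= eta * hn y ^+ 2 + t * (c ^+ 2 * hn y ^+ 2).
  (* The square of [d] bounds that of the norm of [P + t j(M)] on the range of [P]. Its excess over
     [1] is [2 t eta] up to a term in [t^2], which vanishes in the limit after division by [t]. *)
  move=> t0; pose d := Num.sqrt (1 + 2 * t * eta + t ^+ 2 * c ^+ 2).
  have q0 : 0 <= 1 + 2 * t * eta + t ^+ 2 * c ^+ 2.
    have h1 : 0 <= t * eta by rewrite mulr_ge0 ?(ltW t0).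
    have h2 : 0 <= t ^+ 2 * c ^+ 2 by rewrite mulr_ge0 ?sqr_ge0.
    by lra.
  have d0 : 0 <= d := sqrtr_ge0 _.
  have /(mxbndP _ d0)/(_ y) : mxbnd (map_mx phi (N t)) d.
    apply: dom => //; apply/(mxbndP _ d0) => xi; apply: le_of_sqr; first by rewrite mulr_ge0 ?hn_ge0.
    rewrite exprMn (sqr_sqrtr q0) Nj hn_sqrD ripZr hnZr exprMn -normrX (ger0_norm (sqr_ge0 t)).
    set z := amp P xi; have hz : hn z ^+ 2 <= hn xi ^+ 2.
      by rewrite ler_sqr ?nnegrE ?hn_ge0 //; have := amp_bnd ler01 j1_bnd xi; rewrite mul1r.
    have h1 : t * rip z (Mj z) <= t * (eta * hn z ^+ 2).
      by rewrite ler_wpM2l ?(ltW t0) // ripC; apply: hM.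
    have h2 : t ^+ 2 * hn (Mj z) ^+ 2 <= t ^+ 2 * (c ^+ 2 * hn z ^+ 2).
      rewrite ler_wpM2l ?sqr_ge0 // -exprMn ler_sqr ?nnegrE ?mulr_ge0 ?hn_ge0 //; exact: hc.
    have := ler_wpM2l q0 hz; lra.
  rewrite -(ler_pXn2r (ltn0Sn 1)) ?nnegrE ?mulr_ge0 ?hn_ge0 // exprMn (sqr_sqrtr q0) Nf.
  rewrite hn_sqrD ripZr [rip y _]ripC hnZr exprMn -normrX (ger0_norm (sqr_ge0 t)) => h.
  have h2 : 0 <= t ^+ 2 * hn (Mf y) ^+ 2 by rewrite mulr_ge0 ?sqr_ge0.
  have h3 : 0 <= t * (t * (c ^+ 2 * hn y ^+ 2)).
    by apply: mulr_ge0 (ltW t0) (mulr_ge0 (ltW t0) (mulr_ge0 (sqr_ge0 _) (sqr_ge0 _))).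
  by rewrite -(ler_pM2l t0); lra.
apply/ler_addgt0Pr => e e0; pose k := c ^+ 2 * hn y ^+ 2.
have k0 : 0 <= k by rewrite mulr_ge0 ?sqr_ge0.
have k1 : 0 < k + 1 by lra.
apply: le_trans (key _ (divr_gt0 e0 k1)) _; rewrite lerD2l -/k mulrAC ler_pdivrMr //.
by rewrite ler_pM2l //; lra.
Qed.

End CompletePositivity.

(** * Quantitative separation from a finite-dimensional cone *)

Section ConeApproximation.
Variables (R : realType) (T : finType) (Z : Type).
Variables (f : Z -> T -> R) (sc : R -> Z -> Z) (w : Z -> R) (F : T -> R) (C B : R).
Hypothesis f_sc : forall t z k, f (sc t z) k = t ^+ 2 * f z k.
Hypothesis C_ge0 : 0 <= C.
Hypothesis w_ge0 : forall z, 0 <= w z.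
Hypothesis f_bnd : forall z, \sum_k f z k ^+ 2 <= (C * w z) ^+ 2.
Hypothesis F_pos : forall (r : T -> R) (eta : R), 0 <= eta ->
  (forall z, \sum_k r k * f z k <= eta * w z) -> \sum_k r k * F k <= eta * B.

Let gap (Th : seq Z) : R := \sum_k (F k - \sum_(z <- Th) f z k) ^+ 2.

Let sqD (a b : T -> R) (t : R) : \sum_k (a k + t * b k) ^+ 2 =
  \sum_k a k ^+ 2 + 2 * t * (\sum_k a k * b k) + t ^+ 2 * \sum_k b k ^+ 2.
Proof.
by rewrite !mulr_sumr -!big_split /=; apply: eq_bigr => k _; ring.
Qed.

(* A near-minimiser Th of the distance of F to the cone spanned by the f z gives
   the almost separating functional r = F - \sum f. *)
Let near_minimiser (e s : R) : 0 < s -> s <= 1 -> (forall Th, e <= gap Th) ->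
  e <= s * (C * B + (3 + 4 * \sum_k F k ^+ 2) / 2).
Proof.
move=> s0 s1 he; set q := \sum_k F k ^+ 2.
pose D := [set d | exists Th, d = gap Th].
have hD : has_inf D.
  by split; [exists (gap [::]), [::]|exists e => _ [Th ->]].
have s20 : 0 < s ^+ 2 by rewrite exprn_gt0.
have [_ [Th ->] hTh] := inf_adherent s20 hD.
have low Th' : gap Th <= gap Th' + s ^+ 2.
  have : inf D <= gap Th' by apply: ge_inf; [case: hD|exists Th'].
  lra.
pose S k := \sum_(z <- Th) f z k; pose r k := F k - S k.
have gTh : gap Th = \sum_k r k ^+ 2 by [].
set nr := \sum_k r k ^+ 2 in gTh.
have gap0 : gap [::] = q by apply: eq_bigr => k _; rewrite big_nil subr0.
have nr_le : nr <= q + 1.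
  have := low [::]; rewrite gap0 gTh.
  have : s ^+ 2 <= 1 by rewrite exprn_ile1 // ltW.
  lra.
have dir z m : 0 < m -> \sum_k f z k ^+ 2 <= m ^+ 2 -> \sum_k r k * f z k <= s * m.
  move=> m0 hm; have sm0 : 0 <= s / m by rewrite divr_ge0 // ltW.
  (* [f] is quadratic in [z], so adding [s / m] times [f z] means scaling [z] by the square root. *)
  have := low (sc (Num.sqrt (s / m)) z :: Th).
  have -> : gap (sc (Num.sqrt (s / m)) z :: Th) = \sum_k (r k + - (s / m) * f z k) ^+ 2.
    apply: eq_bigr => k _; rewrite big_cons f_sc (sqr_sqrtr sm0) /r /S.
    by congr (_ ^+ 2); ring.
  rewrite sqD -/nr gTh; set d := \sum_k r k * f z k => h.
  have h2 : (- (s / m)) ^+ 2 * \sum_k f z k ^+ 2 <= s ^+ 2.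
    rewrite sqrrN (le_trans (ler_wpM2l (sqr_ge0 _) hm)) // -exprMn divfK //; lra.
  have h3 : (s / m) * d <= s ^+ 2 by lra.
  have := ler_wpM2r (ltW m0) h3.
  have -> : s / m * d * m = s * d by field; rewrite gt_eqF.
  by rewrite expr2 -mulrA ler_pM2l.
(* The slack [t / s] keeps [m] positive when [C * w z = 0]. *)
have hdir z : \sum_k r k * f z k <= s * C * w z.
  apply/ler_addgt0Pr => t t0; have ts0 : 0 < t / s by rewrite divr_gt0.
  have Cw0 : 0 <= C * w z by rewrite mulr_ge0.
  have := dir z (C * w z + t / s); rewrite mulrDr mulrA [s * (t / s)]mulrC divfK; last lra.
  apply; first lra.
  apply: le_trans (f_bnd z) _; rewrite ler_sqr ?nnegrE; lra.
have nS : \sum_k S k ^+ 2 <= 4 * q + 2.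
  have : \sum_k S k ^+ 2 <= \sum_k (2 * F k ^+ 2 + 2 * r k ^+ 2).
    apply: ler_sum => k _; rewrite -subr_ge0.
    have -> : 2 * F k ^+ 2 + 2 * r k ^+ 2 - S k ^+ 2 = (F k + r k) ^+ 2 by rewrite /r; ring.
    exact: sqr_ge0.
  rewrite big_split /= -!mulr_sumr -/q -/nr => /le_trans; apply; lra.
(* Shrinking [Th] by the factor [1 - s] cannot bring it much closer to [F]; this bounds the pairing
   of [r] with [S] from below. *)
have rS : - (2 * \sum_k r k * S k) <= s * (4 * q + 3).
  have s10 : 0 <= 1 - s by lra.
  have := low (map (sc (Num.sqrt (1 - s))) Th).
  have -> : gap (map (sc (Num.sqrt (1 - s))) Th) = \sum_k (r k + s * S k) ^+ 2.
    apply: eq_bigr => k _; rewrite big_map; under eq_bigr do rewrite f_sc (sqr_sqrtr s10).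
    by rewrite -mulr_sumr -/(S k) /r; congr (_ ^+ 2); ring.
  rewrite sqD -/nr gTh; set d := \sum_k r k * S k => h.
  have h2 : s ^+ 2 * (\sum_k S k ^+ 2) <= s ^+ 2 * (4 * q + 2) by rewrite ler_wpM2l ?sqr_ge0.
  by rewrite -(ler_pM2l s0); lra.
have rF : \sum_k r k * F k = nr + \sum_k r k * S k.
  by rewrite -big_split; apply: eq_bigr => k _; rewrite /r /=; ring.
have sC0 : 0 <= s * C by rewrite mulr_ge0 // ltW.
have := F_pos sC0 hdir; rewrite rF; have := he Th; rewrite gTh; lra.
Qed.

(** [F_pos] says that [F] obeys, quantitatively, the linear inequalities satisfied by the cone, so a
    positive distance contradicts [near_minimiser] once [s] is small. The cone need not be
    closed. *)
Lemma cone_approx (e : R) : 0 < e -> exists Th : seq Z,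
  \sum_k (F k - \sum_(z <- Th) f z k) ^+ 2 <= e.
Proof.
move=> e0; apply: contrapT => no.
have he Th : e <= gap Th by rewrite leNgt; apply/negP => /ltW h; apply: no; exists Th.
set c := C * B + (3 + 4 * \sum_k F k ^+ 2) / 2.
have c1 : 0 < `|c| + 1 by have := normr_ge0 c; lra.
pose s := Num.min 1 (e / 2 / (`|c| + 1)).
have s0 : 0 < s by rewrite lt_min ltr01 !divr_gt0.
have s1 : s <= 1 by rewrite ge_min lexx.
have := near_minimiser s0 s1 he; rewrite -/c.
have : s * (`|c| + 1) <= e / 2 by rewrite -ler_pdivlMr // ge_min lexx orbT.
have : s * c <= s * `|c| by rewrite ler_wpM2l ?(ltW s0) // ler_norm.
lra.
Qed.

End ConeApproximation.

(** A real combination of matrix coefficients is packed into the quadratic form of a single matrix,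
    so that a functional on coefficients becomes a test for [cp_transfer]. *)
Lemma rip_mx_test (R : realType) (H G : hilbert R) (A : set (H -> H))
    (psi : (H -> H) -> G -> G) (T : finType) (n : nat) (a : T -> H -> H) (r : T -> R)
    (ly lz : T -> 'I_n) (xi : l2 'I_n G) :
  operator_algebra A -> alg_hom A (@bounded_op R G) psi -> (forall t, A (a t)) ->
  let M := \matrix_(k, l) \sum_(t | (lz t == k) && (ly t == l)) (r t)%:C *: a t in
  rip (mx2op (map_mx psi M) xi) xi =
    \sum_t r t * rip (psi (a t) (l2v xi (ly t))) (l2v xi (lz t)).
Proof.
move=> algA hpsi Aa /=; rewrite rip_fin [RHS](partition_big lz xpredT) //=.
apply: eq_bigr => k _; rewrite mx2opE rip_suml (partition_big ly xpredT) //=.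
apply: eq_bigr => l _; rewrite !mxE (hom_sum algA hpsi) => [|t _]; last exact: oaZ.
rewrite fct_sum rip_suml; apply: eq_bigr => t /andP[/eqP-> /eqP->].
by rewrite (homZ algA hpsi) // -ripZl.
Qed.

Section Approximants.
Variables (R : realType) (H L K : hilbert R) (A : set (H -> H)).
Variables (j : (H -> H) -> L -> L) (phi : (H -> H) -> K -> K).
Hypotheses (algA : operator_algebra A) (A1 : A idfun).
Hypotheses (hj : alg_hom A (@bounded_op R L) j) (hphi : alg_hom A (@bounded_op R K) phi).
Hypothesis phi1 : phi idfun = idfun.
Hypothesis j1_bnd : bnd (j idfun) 1.
Hypothesis dom : forall n (M : 'M[H -> H]_n) (c : R), (forall k l, A (M k l)) ->
  0 <= c -> mxbnd (map_mx j M) c -> mxbnd (map_mx phi M) c.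

Local Notation P := (j idfun).
Let bj a : A a -> bounded_op (j a). Proof. exact: (hom_in hj). Qed.
Let bphi a : A a -> bounded_op (phi a). Proof. exact: (hom_in hphi). Qed.

(* A vector [Psi y] of [L^m] mimics [y]: the matrix coefficients of the
   amplification of [j] at the vectors [Psi y] approximate those of [phi]. *)
Definition approximant m (Psi : K -> l2 'I_m L) (T : finType)
    (F : T -> (H -> H) * (K * K)) (e : R) :=
  (forall y, amp P (Psi y) = Psi y) /\
  forall t, `|rip (amp (j (F t).1) (Psi (F t).2.1)) (Psi (F t).2.2) -
              rip (phi (F t).1 (F t).2.1) (F t).2.2| <= e.

(** The coefficient vectors of [j] at all [th : K -> L] generate a cone. By [cp_transfer] the
    coefficients of [phi] satisfy the inequalities valid on it, and [cone_approx] places them near a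
    finite sum, whose summands become the coordinates of [Psi]. *)
Lemma approximant_exists (T : finType) (F : T -> (H -> H) * (K * K)) (e : R) :
  (forall t, A (F t).1) -> 0 < e ->
  exists m (Psi : K -> l2 'I_m L), approximant Psi F e.
Proof.
move=> AF e0; pose a t := (F t).1; pose y t := (F t).2.1; pose z t := (F t).2.2.
(* Duplicates are removed so that the listed vectors are distinct: every tuple in [L^n] is then the
   restriction of a function on [K]. *)
pose Ys := undup ([seq y t | t <- enum T] ++ [seq z t | t <- enum T]).
pose n := size Ys; pose Y (l : 'I_n) := nth 0 Ys l.
have Y_inj : injective Y.
  move=> l l' /eqP; rewrite /Y nth_uniq ?undup_uniq // => /eqP h; exact: val_inj.
have yY t : y t \in Ys by rewrite mem_undup mem_cat map_f ?mem_enum.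
have zY t : z t \in Ys by rewrite mem_undup mem_cat orbC map_f ?mem_enum.
pose ly t : 'I_n := Ordinal (etrans (index_mem (y t) Ys) (yY t)).
pose lz t : 'I_n := Ordinal (etrans (index_mem (z t) Ys) (zY t)).
have Yly t : Y (ly t) = y t by rewrite /Y /= nth_index.
have Ylz t : Y (lz t) = z t by rewrite /Y /= nth_index.
pose f (th : K -> L) t := rip (j (a t) (th (y t))) (th (z t)).
pose sc (s : R) (th : K -> L) v := s%:C *: th v.
pose w (th : K -> L) := \sum_l hn (th (Y l)) ^+ 2.
have w0 th : 0 <= w th by apply: sumr_ge0 => l _; apply: sqr_ge0.
have /choice[k hk] : forall t, exists k : R, 0 <= k /\ bnd (j (a t)) k.
  by move=> t; have [k] := bop_bnd (bj (AF t)); exists k.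
(* The added [1] ensures that the sum of the [k t ^+ 2] is at most [C ^+ 2]. *)
pose C := 1 + \sum_t k t ^+ 2.
have k20 : 0 <= \sum_t k t ^+ 2 by apply: sumr_ge0 => t _; apply: sqr_ge0.
have f_sc s th t : f (sc s th) t = s ^+ 2 * f th t.
  by rewrite /f /sc (linearZ_of (bop_linear (bj (AF t)))) ripZl ripZr mulrA.
have th_w th l : hn (th (Y l)) ^+ 2 <= w th.
  by rewrite /w (bigD1 l) //= lerDl sumr_ge0 // => i _; apply: sqr_ge0.
have f_bnd th : \sum_t f th t ^+ 2 <= (C * w th) ^+ 2.
  apply: (@le_trans _ _ ((\sum_t k t ^+ 2) * w th ^+ 2)); last first.
    rewrite exprMn ler_wpM2r ?sqr_ge0 // /C; nra.
  rewrite mulr_suml; apply: ler_sum => t _; rewrite -exprMn -real_normK ?num_real //.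
  have [kt0 hkt] := hk t; rewrite ler_sqr ?nnegrE ?mulr_ge0 //.
  rewrite (le_trans (rip_abs _ _)) //.
  apply: le_trans (ler_wpM2r (hn_ge0 _) (hkt _)) _; rewrite -mulrA ler_wpM2l //.
  have := th_w th (ly t); have := th_w th (lz t); rewrite Yly Ylz.
  have := sqr_ge0 (hn (th (y t)) - hn (th (z t))); lra.
have F_pos (r : T -> R) (eta : R) : 0 <= eta ->
    (forall th, \sum_t r t * f th t <= eta * w th) ->
    \sum_t r t * rip (phi (a t) (y t)) (z t) <= eta * \sum_l hn (Y l) ^+ 2.
  move=> eta0 hr; pose M : 'M[H -> H]_n :=
    \matrix_(k, l) \sum_(t | (lz t == k) && (ly t == l)) (r t)%:C *: a t.
  have AM k' l' : A (M k' l').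
    by rewrite mxE; apply: oa_sum => // t _; apply: oaZ => //; apply: AF.
  have := cp_transfer algA A1 hj hphi phi1 j1_bnd dom AM eta0 _ (vec Y).
  rewrite (rip_mx_test _ _ _ _ algA hphi AF) l2_hn_fin /=.
  under eq_bigr do rewrite !vecE Yly Ylz; apply => xi.
  rewrite (rip_mx_test _ _ _ _ algA hj AF) l2_hn_fin.
  pose th v := if [pick l | Y l == v] is Some l then l2v xi l else 0.
  have thY l : th (Y l) = l2v xi l.
    rewrite /th; case: pickP => [l' /eqP/Y_inj -> //|/(_ l)].
    by rewrite eqxx.
  have := hr th; rewrite /f /w.
  under eq_bigr do rewrite -Yly -Ylz !thY.
  by under [X in _ <= _ * X -> _]eq_bigr do rewrite thY.
have e20 : 0 < e ^+ 2 by rewrite exprn_gt0.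
have C0 : 0 <= C by rewrite addr_ge0.
have [Th hTh] := cone_approx f_sc C0 w0 f_bnd F_pos e20.
(* As [P j(a) P = j(a)], inserting [P] leaves the coefficients unchanged and makes the vectors
   [Psi v] fixed by [amp P]. *)
exists (size Th), (fun v => vec (fun i => P (tnth (in_tuple Th) i v))); split.
  move=> v; apply: l2_eq => i; rewrite ampE !vecE.
  by have := congr1 (@^~ (tnth (in_tuple Th) i v)) (cp_PP A1 hj).
move=> t; rewrite -/(a t) -/(y t) -/(z t) rip_fin distrC.
have -> : \sum_i rip (l2v (amp (j (a t)) (vec (fun i0 => P (tnth (in_tuple Th) i0 (y t))))) i)
    (l2v (vec (fun i0 => P (tnth (in_tuple Th) i0 (z t)))) i) = \sum_(th <- Th) f th t.
  rewrite [RHS]big_tnth; apply: eq_bigr => i _; rewrite ampE !vecE.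
  rewrite (cp_jP A1 hj) //; last exact: AF.
  rewrite -[X in rip _ (X _)](cp_P_adj A1 hj j1_bnd) -(rip_adj (bj A1)).
  by rewrite (cp_Pj A1 hj) //; apply: AF.
rewrite -(ler_pXn2r (ltn0Sn 1)) ?nnegrE ?(ltW e0) // real_normK ?num_real //.
apply: le_trans hTh; rewrite (bigD1 t) //= lerDl sumr_ge0 // => t' _; exact: sqr_ge0.
Qed.

(** Membership in the filter of properties of sufficiently fine approximants, over all [m] at once.
    It is proper by [ev_ex]. *)
Definition ev (Q : forall m, (K -> l2 'I_m L) -> Prop) :=
  exists (T : finType) (F : T -> (H -> H) * (K * K)) (e : R),
    [/\ forall t, A (F t).1, 0 < e
      & forall m (Psi : K -> l2 'I_m L), approximant Psi F e -> Q m Psi].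

Lemma ev_ex Q : ev Q -> exists m Psi, Q m Psi.
Proof.
move=> [T [F [e [AF e0 h]]]]; have [m [Psi hPsi]] := approximant_exists AF e0.
by exists m, Psi; apply: h.
Qed.

Lemma evS Q Q' : (forall m (Psi : K -> l2 'I_m L), Q m Psi -> Q' m Psi) -> ev Q -> ev Q'.
Proof.
move=> QQ' [T [F [e [AF e0 h]]]]; exists T, F, e; split=> // m Psi /h; exact: QQ'.
Qed.

Lemma evI Q Q' : ev Q -> ev Q' -> ev (fun m Psi => Q m Psi /\ Q' m Psi).
Proof.
move=> [T [F [e [AF e0 h]]]] [T' [F' [e' [AF' e0' h']]]].
exists (T + T')%type, (fun t => match t with inl t => F t | inr t => F' t end), (Num.min e e').
split=> [[t|t]||m Psi [PPsi hPsi]]; [exact: AF|exact: AF'|by rewrite lt_min e0|].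
split; [apply: h|apply: h']; split=> // t.
  by have := hPsi (inl t); rewrite le_min => /andP[].
by have := hPsi (inr t); rewrite le_min => /andP[].
Qed.

Lemma ev_P : ev (fun m Psi => forall y, amp P (Psi y) = Psi y).
Proof.
by exists void, (fun t : void => match t with end), 1; split=> [[]||m Psi []].
Qed.

Lemma ev_all (I : finType) (Q : I -> forall m, (K -> l2 'I_m L) -> Prop) :
  (forall i, ev (Q i)) -> ev (fun m Psi => forall i, Q i m Psi).
Proof.
move=> h; suff : ev (fun m Psi => forall i, i \in enum I -> Q i m Psi).
  by apply: evS => m Psi hQ i; apply: hQ; rewrite mem_enum.
elim: (enum I) => [|i s IH]; first by apply: evS ev_P.
apply: evS (evI (h i) IH) => m Psi [hi hs] k; rewrite inE => /orP[/eqP->//|]; exact: hs.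
Qed.

Lemma ev_rip a y z (e : R) : A a -> 0 < e -> ev (fun m Psi =>
  `|rip (amp (j a) (Psi y)) (Psi z) - rip (phi a y) z| <= e).
Proof.
move=> Aa e0; exists unit, (fun=> (a, (y, z))), e; split=> // m Psi [_ /(_ tt)]; exact.
Qed.

Lemma ev_gram y z (e : R) : 0 < e -> ev (fun m Psi => `|rip (Psi y) (Psi z) - rip y z| <= e).
Proof.
move=> e0; apply: evS (evI ev_P (ev_rip y z A1 e0)) => m Psi [hP].
by rewrite hP phi1.
Qed.

Lemma ev_hn y (e : R) : 0 < e -> ev (fun m Psi => `|hn (Psi y) - hn y| <= e).
Proof.
move=> e0; have e20 : 0 < e ^+ 2 by rewrite exprn_gt0.
apply: evS (ev_gram y y e20) => m Psi; rewrite !ripxx => h.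
rewrite -(ler_pXn2r (ltn0Sn 1)) ?nnegrE ?(ltW e0) //; apply: le_trans h.
rewrite subr_sqr normrM expr2 ler_wpM2l // ger0_norm ?addr_ge0 ?hn_ge0 //.
rewrite ler_norml; have := hn_ge0 y; have := hn_ge0 (Psi y); lra.
Qed.

(** [Psi] is not linear. The squared defect expands into coefficients under control, the mixed ones
    through [t *: idfun] in [A], and for the exact vectors the same expansion is 0. The errors add
    up to [cmod t ^+ 2 + 8] times the tolerance. *)
Lemma ev_lin (t : R[i]) y z (e : R) : 0 < e -> ev (fun m Psi =>
  hn (t *: Psi y + Psi z - Psi (t *: y + z)) <= e).
Proof.
move=> e0; pose c := cmod t ^+ 2 + 8; have c0 : 0 < c by have := sqr_ge0 (cmod t); rewrite /c; lra.
have d0 : 0 < e ^+ 2 / c by rewrite divr_gt0 ?exprn_gt0.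
pose a : H -> H := t *: idfun; have Aa : A a by apply: oaZ.
pose q := t *: y + z.
apply: evS (evI ev_P (evI (evI (ev_gram y y d0) (evI (ev_gram z z d0) (ev_gram q q d0)))
  (evI (ev_gram z q d0) (evI (ev_rip y z Aa d0) (ev_rip y q Aa d0))))) => m Psi [hP].
have ja v : amp (j a) (Psi v) = t *: Psi v.
  by apply: l2_eq => i; rewrite ampE /a (homZ algA hj) // l2vZ -[in RHS]hP ampE.
have fa v : phi a v = t *: v by rewrite /a (homZ algA hphi) // phi1.
rewrite !ja !fa; move: d0; set d := e ^+ 2 / c => d0.
rewrite !ripxx => -[[h1 [h2 h3]] [h4 [h5 h6]]].
apply: le_of_sqr; first exact: ltW.
have ed : e ^+ 2 = c * d by rewrite /d mulrC divfK // gt_eqF.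
have E (G : hilbert R) (u v x : G) : hn (t *: u + v - x) ^+ 2 = cmod t ^+ 2 * hn u ^+ 2 +
    hn v ^+ 2 + hn x ^+ 2 + 2 * rip (t *: u) v - 2 * rip (t *: u) x - 2 * rip v x.
  by rewrite hn_sqrB hn_sqrD ripDl hnZ exprMn; ring.
have := E K y z q; rewrite subrr hn0 expr0n /= => e1.
rewrite E ed /c.
have h1' : cmod t ^+ 2 * (hn (Psi y) ^+ 2 - hn y ^+ 2) <= cmod t ^+ 2 * d.
  by rewrite ler_wpM2l ?sqr_ge0 // (le_trans (ler_norm _)).
move: h2 h3 h4 h5 h6; rewrite !ler_norml => /andP[_ h2] /andP[_ h3] /andP[h4 _] /andP[_ h5] /andP[h6 _].
lra.
Qed.

Definition ev_intertwine (c : L -> L) (b : K -> K) := forall x (e : R), 0 < e ->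
  ev (fun m Psi => hn (amp c (Psi x) - Psi (b x)) <= e).

Lemma ev_intertwine0 : ev_intertwine 0 0.
Proof.
move=> x e e0; apply: evS (ev_hn 0 e0) => m Psi; rewrite hn0 subr0 => h.
have -> : amp 0 (Psi x) = 0 by apply: l2_eq => i; rewrite ampE l2v0.
by rewrite sub0r hnN (le_trans (ler_norm _)).
Qed.

Lemma ev_intertwine_lin (t : R[i]) c b c' b' : ev_intertwine c b -> ev_intertwine c' b' ->
  ev_intertwine (t *: c + c') (t *: b + b').
Proof.
move=> h h' x e e0; have k0 : 0 < cmod t + 2 by have := cmod_ge0 t; lra.
have d0 : 0 < e / (cmod t + 2) by rewrite divr_gt0.
apply: evS (evI (ev_lin t (b x) (b' x) d0) (evI (h x _ d0) (h' x _ d0))) => m Psi [h1 [h2 h3]].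
have -> : amp (t *: c + c') (Psi x) - Psi ((t *: b + b') x) =
    t *: (amp c (Psi x) - Psi (b x)) + (amp c' (Psi x) - Psi (b' x)) +
    (t *: Psi (b x) + Psi (b' x) - Psi (t *: b x + b' x)).
  have -> : amp (t *: c + c') (Psi x) = t *: amp c (Psi x) + amp c' (Psi x).
    by apply: l2_eq => i; rewrite l2vD l2vZ.
  rewrite scalerBr -[in RHS](addrACA _ (amp c' _)) -opprD addrA.
  by rewrite -[X in _ = X - _]addrA [- _ + _]addrC subrr addr0.
move: h1 h2 h3; set d := e / _ => h1 h2 h3.
have -> : e = cmod t * d + d + d by rewrite /d; field; rewrite gt_eqF.
apply: le_trans (hnD _ _) _; apply: lerD _ h1.
apply: le_trans (hnD _ _) _; rewrite hnZ; apply: lerD _ h3.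
by rewrite ler_wpM2l ?cmod_ge0.
Qed.

Lemma ev_intertwine_comp c b c' b' : bounded_op c -> ev_intertwine c b -> ev_intertwine c' b' ->
  ev_intertwine (c \o c') (b \o b').
Proof.
move=> bc h h' x e e0; have [k k0 hk] := bop_bnd bc.
have k1 : 0 < k + 1 by lra.
have d0 : 0 < e / (k + 1) by rewrite divr_gt0.
apply: evS (evI (h (b' x) _ d0) (h' x _ d0)) => m Psi [h1 h2].
rewrite (le_trans (hnBD (amp c (Psi (b' x))) _ _)) //.
have -> : amp (c \o c') (Psi x) = amp c (amp c' (Psi x)) by apply: l2_eq.
rewrite -(linearB_of (amp_linear (bop_linear bc))).
move: h1 h2; set d := e / _ => h1 h2.
have -> : e = k * d + d by rewrite /d; field; rewrite gt_eqF.
apply: lerD _ h1; apply: le_trans (amp_bnd k0 hk _) _; exact: ler_wpM2l.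
Qed.

(** One approximant accurate at [x] and at [b x] suffices: there [Psi (b x)] is close to
    [amp c (Psi x)], and [Psi] almost preserves both norms. *)
Lemma ev_intertwine_bnd c b (k : R) : ev_intertwine c b -> 0 <= k -> bnd c k -> bnd b k.
Proof.
move=> h k0 hk x; apply/ler_addgt0Pr => e e0.
have k1 : 0 < k + 2 by lra.
have d0 : 0 < e / (k + 2) by rewrite divr_gt0.
have [m [Psi [h1 [h2 h3]]]] := ev_ex (evI (h x _ d0) (evI (ev_hn x d0) (ev_hn (b x) d0))).
have := hnBD (amp c (Psi x)) (Psi (b x)) 0; rewrite !subr0 [hn (Psi _ - _)]hnBC.
have := amp_bnd k0 hk (Psi x).
move: h1 h2 h3; rewrite !ler_norml => h1 /andP[_ h2] /andP[h3 _].
have := ler_wpM2l k0 h2; move: h1 h3; set d := e / _ => h1 h3.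
have -> : e = (k + 2) * d by rewrite /d mulrC divfK // gt_eqF.
lra.
Qed.

(* Equality in the Cauchy-Schwarz inequality: [phi a] attains the bound that
   [j a] satisfies. *)
Lemma ev_intertwine_col a p : A a -> A p ->
  (forall x, hn (phi a x) ^+ 2 = rip (phi p x) x) ->
  (forall xi, hn (j a xi) ^+ 2 <= rip (j p xi) xi) -> ev_intertwine (j a) (phi a).
Proof.
move=> Aa Ap hf hjp x e e0; have d0 : 0 < e ^+ 2 / 4 by rewrite divr_gt0 ?exprn_gt0.
apply: evS (evI (ev_rip x x Ap d0) (evI (ev_rip x (phi a x) Aa d0) (ev_gram (phi a x) (phi a x) d0))).
move=> m Psi; rewrite ripxx !ler_norml => -[/andP[_ h1] [/andP[h2 _] /andP[_ h3]]].
rewrite !ripxx in h2 h3; apply: le_of_sqr; first exact: ltW.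
have h4 : hn (amp (j a) (Psi x)) ^+ 2 <= rip (amp (j p) (Psi x)) (Psi x).
  by rewrite l2_hn_fin rip_fin; apply: ler_sum => i _; apply: hjp.
rewrite hn_sqrB; have := hf x; move: h1 h2 h3 h4; set d := e ^+ 2 / 4 => h1 h2 h3 h4 hfx.
have -> : e ^+ 2 = 4 * d by rewrite /d mulrC divfK ?pnatr_eq0.
lra.
Qed.

(** The row of the [phi (a i)] is a coisometry, that of the [j (a i)] a contraction, so the squared
    defects summed over [i] are bounded by the errors alone. Coefficients of adjoints are read as
    coefficients of [j (a i)]. In [N], one error comes from [x], and for each [i] two from the cross
    term and one from [b i]. *)
Lemma ev_intertwine_row (I : finType) (a : I -> H -> H) : (forall i, A (a i)) ->
  (forall x, \sum_i hn (adj (phi (a i)) x) ^+ 2 = hn x ^+ 2) ->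
  (forall xi, \sum_i hn (adj (j (a i)) xi) ^+ 2 <= hn xi ^+ 2) ->
  forall i, ev_intertwine (adj (j (a i))) (adj (phi (a i))).
Proof.
move=> Aa hf hja i0 x e e0; pose N : R := #|I|%:R * 3 + 1.
have N0 : 0 < N by rewrite /N ltr_wpDl ?mulr_ge0 ?ler0n.
have d0 : 0 < e ^+ 2 / N by rewrite divr_gt0 ?exprn_gt0.
pose b i := adj (phi (a i)) x.
apply: evS (evI (ev_gram x x d0) (evI (ev_all (fun i => ev_gram (b i) (b i) d0))
  (ev_all (fun i => ev_rip (b i) x (Aa i) d0)))) => m Psi [h1 [h2 h3]].
move: h1 h2 h3; set d := e ^+ 2 / N => h1 h2 h3.
apply: le_of_sqr; first exact: ltW.
apply: (@le_trans _ _ (\sum_i hn (amp (adj (j (a i))) (Psi x) - Psi (b i)) ^+ 2)).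
  by rewrite (bigD1 i0) //= lerDl sumr_ge0 // => i _; apply: sqr_ge0.
have h4 : \sum_i hn (amp (adj (j (a i))) (Psi x)) ^+ 2 <= hn (Psi x) ^+ 2.
  under eq_bigr do rewrite l2_hn_fin.
  by rewrite exchange_big l2_hn_fin; apply: ler_sum => k _; apply: hja.
have h5 : \sum_i (- (2 * rip (amp (adj (j (a i))) (Psi x)) (Psi (b i))) + hn (Psi (b i)) ^+ 2) <=
    \sum_i (- hn (b i) ^+ 2 + 3 * d).
  apply: ler_sum => i _; have := h2 i; have := h3 i.
  rewrite -(amp_adj _ (bj (Aa i))) [rip (adj _ _) _]ripC -(rip_adj (amp_bop _ (bj (Aa i)))).
  rewrite (rip_adj (bphi (Aa i))) !ripxx !ler_norml => /andP[h6 _] /andP[_ h7]; lra.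
under eq_bigr do rewrite hn_sqrB -addrA; rewrite big_split /=.
apply: le_trans (lerD h4 h5) _; rewrite big_split /= sumrN hf sumr_const -mulr_natl.
have -> : e ^+ 2 = N * d by rewrite /d mulrC divfK // gt_eqF.
move: h1; rewrite !ripxx ler_norml => /andP[_ h1]; rewrite /N; lra.
Qed.

End Approximants.

(** * The envelope *)

Section SmallMatrices.
Variables (R : realType) (H : hilbert R).

Lemma mx_opnorm_ge0 n (M : 'M[H -> H]_n) : 0 <= mx_opnorm M.
Proof.
rewrite /mx_opnorm; set E := [set c | _].
have [->|/set0P hE] := eqVneq E set0; first by rewrite inf0.
by apply: lb_le_inf => // c [].
Qed.

Lemma mxbnd1P (T : H -> H) (c : R) : mxbnd (const_mx T : 'M_1) c <-> (forall x, hn (T x) ^+ 2 <= c ^+ 2 * hn x ^+ 2).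
Proof.
split=> h x; first by have := h (fun=> x); rewrite !big_ord1 mxE.
by rewrite !big_ord1 mxE; apply: h.
Qed.

Lemma mxbnd1 (T : H -> H) (c : R) : 0 <= c -> mxbnd (const_mx T : 'M_1) c <-> bnd T c.
Proof.
move=> c0; split=> [/mxbnd1P h x|h]; last first.
  apply/mxbnd1P => x; rewrite -exprMn ler_sqr ?nnegrE ?mulr_ge0 ?hn_ge0 //; exact: h.
by apply: le_of_sqr; rewrite ?mulr_ge0 ?hn_ge0 // exprMn.
Qed.

End SmallMatrices.

Section CompleteIsometry.
Variables (R : realType) (H L : hilbert R).
Variables (A : set (H -> H)) (j : (H -> H) -> L -> L).
Hypotheses (algA : operator_algebra A) (hj : alg_hom A (@bounded_op R L) j).

Lemma completely_isometric_of : (forall n (M : 'M[H -> H]_n) c, (forall k l, A (M k l)) ->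
  0 <= c -> mxbnd (map_mx j M) c <-> mxbnd M c) -> completely_isometric A j.
Proof.
move=> h n M AM.
have bM k l : bounded_op (M k l) by apply: oa_bop (AM k l).
have bjM k l : bounded_op (map_mx j M k l) by rewrite mxE; apply: (hom_in hj).
apply/eqP; rewrite eq_le; apply/andP; split.
- apply/(mx_opnorm_le bjM (mx_opnorm_ge0 _))/(h _ _ _ AM (mx_opnorm_ge0 _)).
  by apply/(mx_opnorm_le bM (mx_opnorm_ge0 _)).
- apply/(mx_opnorm_le bM (mx_opnorm_ge0 _))/(h _ _ _ AM (mx_opnorm_ge0 _)).
  by apply/(mx_opnorm_le bjM (mx_opnorm_ge0 _)).
Qed.

Hypothesis cij : completely_isometric A j.

Lemma ci_mxbnd n (M : 'M[H -> H]_n) c : (forall k l, A (M k l)) -> 0 <= c ->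
  mxbnd (map_mx j M) c <-> mxbnd M c.
Proof.
move=> AM c0; have bM k l : bounded_op (M k l) by apply: oa_bop (AM k l).
have bjM k l : bounded_op (map_mx j M k l) by rewrite mxE; apply: (hom_in hj).
split=> h.
  by apply/(mx_opnorm_le bM c0); rewrite -(cij AM); apply/(mx_opnorm_le bjM c0).
by apply/(mx_opnorm_le bjM c0); rewrite (cij AM); apply/(mx_opnorm_le bM c0).
Qed.

Lemma ci_bnd T c : A T -> 0 <= c -> bnd T c -> bnd (j T) c.
Proof.
move=> AT c0 hT; apply/(mxbnd1 _ c0).
have -> : const_mx (j T) = map_mx j (const_mx T) :> 'M_1 by apply/matrixP => k l; rewrite !mxE.
by apply/ci_mxbnd => //; [move=> k l; rewrite mxE|apply/mxbnd1].
Qed.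

(** The row is coded as a square matrix with the single nonzero row [i0], to which complete isometry
    applies; the Bessel inequality is dual to contractivity of the row. *)
Lemma ci_row (I : finType) (a : I -> H -> H) (i0 : I) : (forall i, A (a i)) ->
  (forall xi : I -> H, hn (\sum_i a i (xi i)) ^+ 2 <= \sum_i hn (xi i) ^+ 2) ->
  forall xi, \sum_i hn (adj (j (a i)) xi) ^+ 2 <= hn xi ^+ 2.
Proof.
move=> Aa ha xi; have bja i : bounded_op (j (a i)) := hom_in hj (Aa i).
pose M : 'M[H -> H]_#|I| := \matrix_(k, l) if k == enum_rank i0 then a (enum_val l) else 0.
have AM k l : A (M k l) by rewrite mxE; case: eqP => // _; apply: oa0.
have reI (F : 'I_#|I| -> R) : \sum_l F l = \sum_i F (enum_rank i).
  by rewrite (reindex enum_rank) //=; apply/onW_bij/enum_rank_bij.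
have reI' (G : hilbert R) (F : 'I_#|I| -> G) : \sum_l F l = \sum_i F (enum_rank i).
  by rewrite (reindex enum_rank) //=; apply/onW_bij/enum_rank_bij.
have rowE (G : hilbert R) (psi : (H -> H) -> G -> G) (x : 'I_#|I| -> G) :
    (psi 0 = 0) -> \sum_k hn (\sum_l map_mx psi M k l (x l)) ^+ 2 =
    hn (\sum_i psi (a i) (x (enum_rank i))) ^+ 2.
  move=> psi0; rewrite (bigD1 (enum_rank i0)) //= [X in _ + X]big1 ?addr0 => [|k /negbTE ki].
    by rewrite reI'; congr (hn _ ^+ 2); apply: eq_bigr => i _; rewrite !mxE eqxx enum_rankK.
  rewrite big1 => [|l _]; first by rewrite hn0 expr0n.
  by rewrite !mxE ki psi0.
have hM : mxbnd M 1.
  move=> x; rewrite expr1n mul1r [leRHS]reI.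
  have eM : M = map_mx id M by apply/matrixP => k l; rewrite [RHS]mxE.
  by rewrite [in leLHS]eM (rowE _ id) //; apply: ha.
(* On this tuple the row bound reads [|y|^2 <= t], while [t = <xi, y>] by duality; Cauchy-Schwarz
   concludes. *)
have /(_ (fun l => adj (j (a (enum_val l))) xi)) := (ci_mxbnd AM ler01).2 hM.
rewrite (rowE _ j) ?(hom0 algA hj) // expr1n mul1r [X in _ <= X]reI.
under [X in hn X]eq_bigr do rewrite enum_rankK.
under [X in _ <= X]eq_bigr do rewrite enum_rankK.
set t := \sum_i hn _ ^+ 2; set y := \sum_i j (a i) _ => hy.
have tE : t = rip xi y.
  rewrite /y rip_sumr; apply: eq_bigr => i _.
  by rewrite -ripxx (rip_adjr (bja i)).
have t0 : 0 <= t by apply: sumr_ge0 => i _; apply: sqr_ge0.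
have [->|tn0] := eqVneq t 0; first exact: sqr_ge0.
have tp : 0 < t by rewrite lt_def tn0.
rewrite -(ler_pM2l tp) -expr2 {1}tE.
have h1 := rip_le xi y; rewrite -tE in h1.
apply: (@le_trans _ _ ((hn xi * hn y) ^+ 2)).
  by rewrite -tE ler_sqr ?nnegrE ?mulr_ge0 ?hn_ge0.
by rewrite exprMn mulrC ler_wpM2r ?sqr_ge0.
Qed.

Lemma ci_adj q : A q -> q \o q = q -> bnd q 1 -> adj (j q) = j q.
Proof.
move=> Aq qq q1; apply: idempotent_contraction_adj.
- exact: (bop_linear (hom_in hj Aq)).
- by rewrite -(hom_comp hj Aq Aq) qq.
- exact: ci_bnd.
Qed.

(** [a = a q] gives [j a = j a j q], so the contraction [j a] only sees [j q xi], and [j q] is a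
    projection. This is the inequality that [ev_intertwine_col] asks of a partial isometry [a] with
    source [q]. *)
Lemma ci_source a q xi : A a -> A q -> q \o q = q -> bnd q 1 -> a \o q = a -> bnd a 1 ->
  hn (j a xi) ^+ 2 <= rip (j q xi) xi.
Proof.
move=> Aa Aq qq q1 aq a1; have bq := hom_in hj Aq.
have -> : rip (j q xi) xi = hn (j q xi) ^+ 2.
  rewrite -ripxx -[j q in RHS](ci_adj Aq qq q1) (rip_adjr bq) ripC.
  have -> : j q (adj (j q) xi) = (j q \o j q) xi by rewrite (ci_adj Aq qq q1).
  by rewrite -(hom_comp hj Aq Aq) qq.
rewrite ler_sqr ?nnegrE ?hn_ge0 // -[in leLHS]aq (hom_comp hj Aa Aq) /=.
by have := ci_bnd Aa ler01 a1 (j q xi); rewrite mul1r.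
Qed.

End CompleteIsometry.

(** * The completely isometric copy of the Toeplitz algebra *)

Section Embedding.
Variables (R : realType) (E : graph) (hE : source_free E) (X : self_similar nat E).
Hypothesis hX : forall e : edge E, exists m : nat, res X m (inr e) <> 0%N.
Variables (H : hilbert R) (V : nat -> H -> H) (S : cell E -> H -> H).
Hypothesis hVS : universal_toeplitz_rep X V S.
Variables (K : hilbert R) (u : int -> K -> K) (s : cell E -> K -> K).
Hypothesis hus : universal_unitary_ck_rep (extend X) u s.

Let tVS := hVS.1.
Let uus : unitary_ck_rep (extend X) u s := hus.1.
Let tus := uck_toeplitz uus.
Let tS := toeplitz_tck tVS.
Let ts : tck_family s := uck_tck uus.
Let G0 := genpair V S (fun p : nat => u p%:Z) s.
Let G0_bop : forall T T', G0 T T' -> bounded_op T /\ bounded_op T' := genpair_bop tVS tus.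
Let A := toeplitz_algebra V S.
Let B := family_cstar u s.

Lemma emb_up n (M : 'M[H -> H]_n) (M' : 'M[K -> K]_n) (d : R) :
  (forall i k, palg G0 (M i k) (M' i k)) -> 0 <= d -> mxbnd M d -> mxbnd M' d.
Proof. by move=> hM _; apply: (toeplitz_le_universal hVS tus hM). Qed.

Lemma emb_down n (M' : 'M[K -> K]_n) (M : 'M[H -> H]_n) (d : R) :
  (forall i k, palg (fun T' T => G0 T T') (M' i k) (M i k)) -> 0 <= d -> mxbnd M' d -> mxbnd M d.
Proof.
by move=> hM d0; apply: (toeplitz_le_unitary_ck hE hX tVS hus d0) => i k; apply: palg_flip.
Qed.

Lemma emb_dom T T' (c : R) : palg G0 T T' -> 0 <= c -> bnd T c -> bnd T' c.
Proof.
move=> pT c0 /(mxbnd1 _ c0) h; apply/(mxbnd1 _ c0); apply: emb_up c0 h => i k.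
by rewrite !mxE.
Qed.

Let gB i : B (rep_family u s i).
Proof. by apply: cstar_generated_sub; exists i. Qed.

Lemma emb_B_cstar : cstar_algebra B.
Proof.
apply: cstar_generated_cstar => _ [[g|m] _ <-]; first exact: (uck_bounded uus).
exact: (tck_bounded ts).
Qed.

(** Nondegeneracy writes [V p] as the sum of the [S_v V_p], so the products [S_mu V_p] and the
    single operators [V p], [S m] generate the same algebra. *)
Lemma emb_algebraE : A = pairdom G0.
Proof.
rewrite (pairdom_generated G0_bop emb_dom); apply/seteqP; split.
  have gA : [set T | exists T', G0 T T'] `<=` @bounded_op R H by move=> T [T' /G0_bop[]].
  have aA := algebra_generated_algebra gA.
  have AV p : algebra_generated [set T | exists T', G0 T T'] (V p).
    by apply: algebra_generated_sub; exists (u p%:Z); apply: genpair_V.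
  have AS m : algebra_generated [set T | exists T', G0 T T'] (S m).
    by apply: algebra_generated_sub; exists (s m); apply: genpair_S.
  apply: algebra_generated_min => // T [[v [p ->]]|[e [es [p [_ ->]]]]].
    exact: (oa_comp aA).
  elim: (e :: es) => //= f fs IH; exact: (oa_comp aA).
have gA : path_generators V S `<=` @bounded_op R H.
  move=> T [[v [p ->]]|[e [es [p [_ ->]]]]].
    by apply: bop_comp; [apply: (tck_bounded tS)|apply: (toeplitz_bounded tVS)].
  elim: (e :: es) => [|f fs IH] /=; first exact: (toeplitz_bounded tVS).
  by apply: bop_comp IH; apply: (tck_bounded tS).
have aA := algebra_generated_algebra gA.
apply: algebra_generated_min => // T [_ [p|[v|e]]].
- have -> : V p = \sum_v (S (inl v) \o V p).
    by apply/funext => x; rewrite fct_sum /= (tck_sum tS).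
  by apply: oa_sum => // v _; apply: algebra_generated_sub; left; exists v, p.
- apply: algebra_generated_sub; left; exists v, 0%N.
  by apply/funext => x; rewrite /= (toeplitz0E tVS).
- apply: algebra_generated_sub; right; exists e, [::], 0%N; split=> //.
  by apply/funext => x; rewrite /= (toeplitz0E tVS).
Qed.

Lemma emb_algebra : operator_algebra A.
Proof. by rewrite emb_algebraE; apply: pairdom_alg G0_bop emb_dom. Qed.

Definition emb : (H -> H) -> K -> K := pfunc G0.

Lemma emb_pcl T : A T -> pcl G0 T (emb T).
Proof. by rewrite emb_algebraE; apply: pfuncP. Qed.

Lemma emb_V p : emb (V p) = u p%:Z.
Proof. by apply: (pfuncE emb_dom); apply/(palg_pcl G0_bop)/palg_gen/genpair_V. Qed.

Lemma emb_S m : emb (S m) = s m.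
Proof. by apply: (pfuncE emb_dom); apply/(palg_pcl G0_bop)/palg_gen/genpair_S. Qed.

Lemma emb_A_V p : A (V p).
Proof.
by rewrite emb_algebraE; exists (u p%:Z); apply/(palg_pcl G0_bop)/palg_gen/genpair_V.
Qed.

Lemma emb_A_S m : A (S m).
Proof.
by rewrite emb_algebraE; exists (s m); apply/(palg_pcl G0_bop)/palg_gen/genpair_S.
Qed.

Lemma emb_hom (D : set (K -> K)) : operator_algebra D -> (forall p : nat, D (u p%:Z)) ->
  (forall m, D (s m)) -> alg_hom A D emb.
Proof.
move=> aD Du Ds; rewrite emb_algebraE; apply: (pfunc_hom emb_dom aD).
by move=> _ _ [p|m].
Qed.

Lemma emb_homB : alg_hom A B emb.
Proof. by apply: emb_hom (emb_B_cstar).1 _ _ => k; [apply: (gB (inl _))|apply: (gB (inr _))]. Qed.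

Lemma emb_hom_bop : alg_hom A (@bounded_op R K) emb.
Proof.
apply: emb_hom (bop_cstar K).1 _ _ => k; first exact: (uck_bounded uus).
exact: (tck_bounded ts).
Qed.

Lemma emb_ci : completely_isometric A emb.
Proof.
apply: (completely_isometric_of emb_algebra emb_hom_bop) => n M c AM c0.
have pM k l : pcl G0 (M k l) (map_mx emb M k l) by rewrite mxE; apply: emb_pcl.
split; last exact: (pcl_mxbnd (@emb_up n) c0 pM).
apply: (pcl_mxbnd (@emb_down n) c0) => k l; exact: pcl_flip (pM k l).
Qed.

(** At negative integers [u] is the adjoint of its value at positive ones. *)
Lemma emb_generated (D : set (K -> K)) : cstar_algebra D -> (forall p : nat, D (u p%:Z)) ->
  (forall m, D (s m)) -> B `<=` D.
Proof.
move=> cD Du Ds; apply: cstar_generated_min => // _ [[[p|p]|m] _ <-]; [exact: Du| |exact: Ds].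
rewrite -[rep_family _ _ _]/(u (Negz p)) NegzE -(uck_adj uus); apply: cD.2; exact: Du.
Qed.

Lemma emb_cover : cstar_cover A B emb.
Proof.
split; [exact: emb_B_cstar|exact: emb_homB|exact: emb_ci|].
have bE : emb @` A `<=` @bounded_op R K by move=> _ [T /(hom_in emb_hom_bop) h <-].
apply/seteqP; split.
  by apply: cstar_generated_min emb_B_cstar _ => _ [T AT <-]; apply: (hom_in emb_homB).
apply: emb_generated (cstar_generated_cstar bE) _ _ => k; apply: cstar_generated_sub.
  by exists (V k); [exact: emb_A_V|exact: emb_V].
by exists (S k); [exact: emb_A_S|exact: emb_S].
Qed.

(** * The quotient map from an arbitrary C*-cover *)

Section Cover.
Variables (L : hilbert R) (C : set (L -> L)) (j : (H -> H) -> L -> L).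
Hypothesis hC : cstar_cover A C j.

Let csC : cstar_algebra C. Proof. by case: hC. Qed.
Let hjC : alg_hom A C j. Proof. by case: hC. Qed.
Let hj : alg_hom A (@bounded_op R L) j.
Proof. by case: hjC => h1 h2 h3; split=> // T /h1 /(oa_bop csC.1). Qed.
Let cij : completely_isometric A j. Proof. by case: hC. Qed.
Let A1 : A idfun. Proof. by rewrite -(toeplitz_id tVS); apply: emb_A_V. Qed.
Let emb1 : emb idfun = idfun.
Proof. by rewrite -(toeplitz_id tVS) emb_V (uck_id uus). Qed.
Let j1_bnd : bnd (j idfun) 1.
Proof. exact: (ci_bnd emb_algebra hj cij A1 ler01 (@bnd_id _ _)). Qed.
Let dom n (M : 'M[H -> H]_n) (c : R) : (forall k l, A (M k l)) -> 0 <= c ->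
  mxbnd (map_mx j M) c -> mxbnd (map_mx emb M) c.
Proof.
move=> AM c0 /(ci_mxbnd emb_algebra hj cij AM c0) h.
exact/(ci_mxbnd emb_algebra emb_hom_bop emb_ci AM c0).
Qed.

Local Notation evi := (ev_intertwine A j emb).

Let evi_V p : evi (j (V p)) (u p%:Z).
Proof.
rewrite -emb_V; apply: (ev_intertwine_col A1 emb1 (emb_A_V p) A1) => [x|xi].
  by rewrite emb_V emb1 (uck_hn uus) ripxx.
apply: (ci_source emb_algebra hj cij xi (emb_A_V p) A1) => //; first exact: bnd_id.
exact: (toeplitz_bnd tVS).
Qed.

Let SvSv v : S (inl v) \o S (inl v) = S (inl v).
Proof. by have [] := tck_proj tS v. Qed.

Let evi_S m : evi (j (S m)) (s m).
Proof.
rewrite -(emb_S m); case: m => [v|e].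
  apply: (ev_intertwine_col A1 emb1 (emb_A_S _) (emb_A_S (inl v))) => [x|xi].
    by rewrite emb_S (tckv_hn ts).
  apply: (ci_source emb_algebra hj cij xi (emb_A_S _) (emb_A_S _) (SvSv v)) => //; exact: (tckv_bnd tS).
apply: (ev_intertwine_col A1 emb1 (emb_A_S _) (emb_A_S (inl (src e)))) => [x|xi].
  by rewrite !emb_S (tcke_hn ts) (tckv_hn ts).
apply: (ci_source emb_algebra hj cij xi (emb_A_S _) (emb_A_S _) (SvSv _)).
- exact: (tckv_bnd tS).
- by apply/funext => x; apply: (tcke_src tS).
- exact: (tcke_bnd tS).
Qed.

(** A row with one entry: unitarity of [u p] makes it a coisometry. *)
Let evi_adjV p : evi (adj (j (V p))) (adj (u p%:Z)).
Proof.
rewrite -emb_V; apply: (@ev_intertwine_row _ _ _ _ _ _ _ A1 hj emb_hom_bop emb1 unit (fun=> V p) _ _ _ tt).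
- by move=> _; apply: emb_A_V.
- by move=> x; rewrite big_const card_unit /= addr0 emb_V (uck_adj uus) (uck_hn uus).
- move=> xi; rewrite big_const card_unit /= addr0 ler_sqr ?nnegrE ?hn_ge0 //.
  have := bnd_adj (hom_in hj (emb_A_V p))
    (ci_bnd emb_algebra hj cij (emb_A_V p) ler01 (toeplitz_bnd tVS p)) xi.
  by rewrite mul1r.
Qed.

(** Here the Cuntz-Krieger equality enters: it makes the row of all [s e] a coisometry, while
    orthogonality of the ranges of the [S e] makes the row contractive in [H], hence under [j]. *)
Let evi_adjS m : evi (adj (j (S m))) (adj (s m)).
Proof.
case: m => [v|e].
  rewrite (tckv_adj ts) (ci_adj emb_algebra hj cij (emb_A_S _) (SvSv v)); first exact: evi_S.
  exact: (tckv_bnd tS).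
rewrite -emb_S; apply: (@ev_intertwine_row _ _ _ _ _ _ _ A1 hj emb_hom_bop emb1 (edge E) (fun e => S (inr e))).
- by move=> f; apply: emb_A_S.
- move=> x; under eq_bigr do rewrite emb_S.
  rewrite -(tck_pyth ts x) (partition_big (@rng E) xpredT) //=; apply: eq_bigr => v _.
  rewrite (tckv_hn ts) -((uck_ck uus).2 v) /range_sum fct_sum rip_suml.
  apply: eq_bigr => f _; rewrite -ripxx /= (rip_adj (tck_bounded ts (inr f))) //.
- apply: (ci_row emb_algebra hj cij e) => [f|xi]; first exact: emb_A_S.
  rewrite -ripxx rip_suml; apply: ler_sum => f _.
  rewrite (rip_adj (tck_bounded tS _)) (linear_sum_of (linear_adj (tck_bounded tS _))).
  rewrite (bigD1 f) //= (tck_adjK tS) big1 ?addr0 => [|g gf]; last by rewrite (tck_adj_orth tS).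
  rewrite ripC -(tckv_hn tS) ler_sqr ?nnegrE ?hn_ge0 //.
  by have := tckv_bnd tS (src f) (xi f); rewrite mul1r.
Qed.

(** [palg] knows no involution, so adjoints enter as generators of their own; [palg coverpair] then
    consists of pairs of *-polynomials. *)
Inductive coverpair : (L -> L) -> (K -> K) -> Prop :=
| coverpair_gen T T' : G0 T T' -> coverpair (j T) T'
| coverpair_adj T T' : G0 T T' -> coverpair (adj (j T)) (adj T').

Let G0_A T T' : G0 T T' -> A T.
Proof. by move=> [p|m]; [exact: emb_A_V|exact: emb_A_S]. Qed.

Lemma coverpair_bop T T' : coverpair T T' -> bounded_op T /\ bounded_op T'.
Proof.
by move=> [{}T {}T' h|{}T {}T' h]; have [_ b] := G0_bop h; have b' := hom_in hj (G0_A h);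
  split=> //; apply: bop_adj.
Qed.

Lemma coverpair_star T T' : coverpair T T' -> coverpair (adj T) (adj T').
Proof.
move=> [{}T {}T' h|{}T {}T' h]; first exact: coverpair_adj.
by rewrite (adjK (hom_in hj (G0_A h))) (adjK (G0_bop h).2); apply: coverpair_gen.
Qed.

(** Asymptotic intertwining is stable under products that involve adjoints, so it propagates from
    the generators to all *-polynomials, and [ev_intertwine_bnd] turns it into a norm bound. *)
Lemma coverpair_dom T T' (c : R) : palg coverpair T T' -> 0 <= c -> bnd T c -> bnd T' c.
Proof.
move=> pT; apply: (ev_intertwine_bnd emb_algebra A1 hj emb_hom_bop emb1 j1_bnd dom).
elim: pT => {T T'} [_ _ [_ _ [p|m]|_ _ [p|m]]| |a T T' W W' _ h1 _ h2|T T' W W' pT h1 _ h2].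
- exact: evi_V.
- exact: evi_S.
- exact: evi_adjV.
- exact: evi_adjS.
- exact: (@ev_intertwine0 _ _ _ _ A j emb A1 emb1).
- exact: (ev_intertwine_lin emb_algebra A1 hj emb_hom_bop emb1).
- exact: ev_intertwine_comp (palg_bop coverpair_bop pT).1 h1 h2.
Qed.

Lemma cover_palg T T' : palg G0 T T' -> A T /\ palg coverpair (j T) T'.
Proof.
elim=> {T T'} [T T' h| |a T T' W W' _ [AT pT] _ [AW pW]|T T' W W' _ [AT pT] _ [AW pW]].
- by split; [exact: G0_A h|exact/palg_gen/coverpair_gen].
- by split; [exact: (oa0 emb_algebra)|rewrite (hom0 emb_algebra hj); exact: palg0].
- by split; [exact: (oa_lin emb_algebra)|rewrite (hom_lin hj a AT AW); exact: palg_lin].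
- by split; [exact: (oa_comp emb_algebra)|rewrite (hom_comp hj AT AW); exact: palg_comp].
Qed.

Lemma cover_pcl T : A T -> pcl coverpair (j T) (emb T).
Proof.
move=> AT; have [bT bT' h] := emb_pcl AT; split=> //; first exact: (hom_in hj).
move=> e e0; have [W [W' [pW hW hW']]] := h e e0; have [AW pW'] := cover_palg pW.
exists (j W), W'; split=> //; rewrite -(homB emb_algebra hj AT AW).
by apply: (ci_bnd emb_algebra hj cij) => //; [exact: (oaB emb_algebra)|exact: ltW].
Qed.

Lemma cover_pdom : pairdom coverpair = C.
Proof.
have cD := pairdom_cstar coverpair_bop coverpair_dom coverpair_star.
have [_ _ _ genC] := hC; apply/seteqP; split.
  rewrite (pairdom_cstar_generated coverpair_bop coverpair_dom coverpair_star).
  apply: cstar_generated_min => // T [_ [{}T T' h|{}T T' h]].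
    by apply: (hom_in hjC); apply: G0_A h.
  by apply: csC.2; apply: (hom_in hjC); apply: G0_A h.
rewrite -genC; apply: cstar_generated_min => // _ [T AT <-].
by exists (emb T); apply: cover_pcl.
Qed.

Lemma cover_quotient : exists q : (L -> L) -> (K -> K),
  [/\ star_hom C B q, q @` C = B & forall T, A T -> q (j T) = emb T].
Proof.
pose q := pfunc coverpair; have csB := emb_B_cstar.
have hq : star_hom C B q.
  rewrite -cover_pdom.
  apply: (pfunc_star_hom coverpair_bop coverpair_dom coverpair_star csB).
  have G0B T T' : G0 T T' -> B T' by move=> [p|m]; [apply: (gB (inl _))|apply: (gB (inr _))].
  by move=> _ _ [T T' /G0B //|T T' /G0B h]; apply: csB.2.
have qj T : A T -> q (j T) = emb T.
  by move=> AT; apply: (pfuncE coverpair_dom); apply: cover_pcl.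
exists q; split=> //; have h1 := hq.1; apply/seteqP; split.
  by move=> _ [T CT <-]; apply: (hom_in h1).
have BB : B `<=` @bounded_op R K by move=> T /(oa_bop csB.1).
(* The image of [q] contains the generators, so its being a C*-algebra is what remains;
   norm-closedness comes from [star_hom_range_closed]. *)
apply: emb_generated; last 2 first.
- move=> p; exists (j (V p)); first exact: (hom_in hjC (emb_A_V p)).
  by rewrite (qj _ (emb_A_V p)) emb_V.
- move=> m; exists (j (S m)); first exact: (hom_in hjC (emb_A_S m)).
  by rewrite (qj _ (emb_A_S m)) emb_S.
split; last by move=> _ [T CT <-]; exists (adj T); [exact: csC.2|rewrite hq.2].
split.
- by move=> _ [T CT <-]; apply: BB; apply: (hom_in h1).
- by exists 0; [exact: (oa0 csC.1)|exact: (hom0 csC.1 h1)].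
- move=> a _ _ [T CT <-] [W CW <-]; exists (a *: T + W); first exact: (oa_lin csC.1).
  exact: (hom_lin h1).
- move=> _ _ [T CT <-] [W CW <-]; exists (T \o W); first exact: (oa_comp csC.1).
  exact: (hom_comp h1).
- move=> b bb hb; have [|T CT Tb] := star_hom_range_closed csC BB hq bb; last by exists T.
  move=> e /hb[_ [T CT <-] hT]; exists T => // x; have := hT x.
  by rewrite !hnE -rmorphM /= lecR -[(q T - b) x]/(q T x - b x) hnBC.
Qed.

End Cover.

Lemma emb_envelope : cstar_envelope A B emb.
Proof. by split; [exact: emb_cover|exact: cover_quotient]. Qed.

End Embedding.

(** * Unitary + CK Toeplitz representations as representations of Z *)

Section ExtendRepresentation.
Variables (R : realType) (E : graph) (X : self_similar nat E) (K : hilbert R).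
Variables (V : nat -> K -> K) (S : cell E -> K -> K).
Hypotheses (hVS : toeplitz_rep X V S) (hu : unitary_ck_type V S).

Let bV p : bounded_op (V p). Proof. exact: (toeplitz_bounded hVS). Qed.
Let VK p x : adj (V p) (V p x) = x.
Proof. by have := congr1 (@^~ x) (toeplitz_isometry hVS p). Qed.

(** Only [V 1] is assumed unitary; the other [V p] are its powers. *)
Let VKV p x : V p (adj (V p) x) = x.
Proof.
elim: p x => [|p IH] x.
  by rewrite (toeplitz0E hVS) (toeplitz_id hVS) adj_id.
rewrite -addn1 (toeplitz_add hVS) (adj_comp (bV p) (bV 1)) /=.
have -> : V 1%N (adj (V 1%N) (adj (V p) x)) = adj (V p) x.
  by have [_ h] := hu.1; have := congr1 (@^~ (adj (V p) x)) h.
exact: IH.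
Qed.

Definition ext_rep (g : int) : K -> K :=
  match g with Posz n => V n | Negz n => adj (V n.+1) end.

Let extN (n : nat) x : ext_rep (- n%:Z) x = adj (V n) x.
Proof.
case: n => [|n]; last by rewrite -NegzE.
by rewrite oppr0 /= (toeplitz_id hVS) adj_id.
Qed.

Let V_inj p : injective (V p). Proof. exact: can_inj (VK p). Qed.

Let adjVD p q x : adj (V (p + q)%N) x = adj (V p) (adj (V q) x).
Proof. by apply: (@V_inj (p + q)%N); rewrite VKV addnC (toeplitz_addE hVS) !VKV. Qed.

Let VC p q x : V p (V q x) = V q (V p x).
Proof. by rewrite -!(toeplitz_addE hVS) addnC. Qed.

Let V_adjC p q x : V p (adj (V q) x) = adj (V q) (V p x).
Proof. by apply: (@V_inj q); rewrite VKV VC VKV. Qed.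

Let ext_sub (a b : nat) x : ext_rep (a%:Z - b%:Z) x = V a (adj (V b) x).
Proof.
case: (leqP b a) => [ba|/ltnW ab].
  by rewrite subzn //= -[in RHS](subnK ba) (toeplitz_addE hVS) VKV.
by rewrite -opprB subzn // extN V_adjC -[in RHS](subnK ab) adjVD VK.
Qed.

Let int_sub (k : int) : exists a b : nat, k = a%:Z - b%:Z.
Proof.
case: k => n; first by exists n, 0%N; rewrite subr0.
by exists 0%N, n.+1; rewrite sub0r NegzE.
Qed.

Lemma ext_rep_add g h : ext_rep (g + h) = ext_rep g \o ext_rep h.
Proof.
apply/funext => x /=; have [a [b ->]] := int_sub g; have [c [d ->]] := int_sub h.
rewrite addrACA -opprD -!PoszD !ext_sub (toeplitz_addE hVS) adjVD.
by rewrite -[in RHS]V_adjC.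
Qed.

Lemma ext_rep_unitary_ck : unitary_ck_rep (extend X) ext_rep S.
Proof.
have bE g : bounded_op (ext_rep g) by case: g => n; [exact: bV|exact: bop_adj].
have adjE g : adj (ext_rep g) = ext_rep (- g).
  case: g => n; first by apply/funext => x; rewrite extN.
  by rewrite NegzE opprK /= (adjK (bV _)).
have idE : ext_rep 0 = idfun by rewrite /= (toeplitz_id hVS).
split=> //.
- by move=> g; split; rewrite adjE -ext_rep_add ?addNr ?subrr.
- exact: ext_rep_add.
- exact: hu.2.
case=> n m; first by have := toeplitz_comm hVS n m; case: m.
(* Writing [m] as [(n+1).m'] turns the relation for a negative integer into the second Toeplitz
   relation. *)
set m' := act (extend X) (Negz n) m.
have mE : m = act X n.+1 m'.
  by rewrite /m'; case: (m) => [v|e]; congr (_ _); rewrite permKV.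
rewrite [in LHS]mE; have -> : ext_rep (Negz n) = adj (V n.+1) by [].
rewrite (toeplitz_adj hVS); apply/funext => x; rewrite /= -extN.
by [].
Qed.

End ExtendRepresentation.

Section Restricted.
Variables (R : realType) (E : graph) (X : self_similar nat E).
Variables (K : hilbert R) (u : int -> K -> K) (s : cell E -> K -> K).
Hypothesis hus : universal_unitary_ck_rep (extend X) u s.

Let uus : unitary_ck_rep (extend X) u s := hus.1.

Lemma family_cstar_nat : family_cstar (fun p : nat => u p%:Z) s = family_cstar u s.
Proof.
apply/seteqP; split.
  apply: cstar_generated_min (emb_B_cstar hus) _ => _ [[p|m] _ <-]; apply: cstar_generated_sub.
    by exists (inl p%:Z).
  by exists (inr m).
apply: (emb_generated hus).
- apply: cstar_generated_cstar => _ [[p|m] _ <-]; first exact: (uck_bounded uus).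
  exact: (tck_bounded (uck_tck uus)).
- by move=> p; apply: cstar_generated_sub; exists (inl p).
- by move=> m; apply: cstar_generated_sub; exists (inr m).
Qed.

(** Every competing family extends from N to Z by [ext_rep], so the universal property of [(u, s)]
    applies to it. *)
Lemma universal_nat : universal_unitary_ck_toeplitz_rep X (fun p : nat => u p%:Z) s.
Proof.
split=> [|L t [ht hu]].
  split; first exact: (uck_toeplitz uus).
  by split; [exact: (uck_unitary uus)|exact: (uck_ck uus)].
have h := ext_rep_unitary_ck ht hu.
have [phi [hphi phiE]] := hus.2 L (rep_family (ext_rep (fun p => t (inl p))) (fun m => t (inr m))) h.
exists phi; split.
  by have := family_cstar_nat; rewrite /family_cstar => ->.
by case=> [p|m]; [exact: (phiE (inl p%:Z))|exact: (phiE (inr m))].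
Qed.

End Restricted.

Theorem theorem5p1 (R : realType) (E : graph) (hE : source_free E)
    (X : self_similar nat E)
    (hX : forall e : edge E, exists m : nat, res X m (inr e) <> 0%N)
    (H : hilbert R) (V : nat -> H -> H) (S : cell E -> H -> H)
    (hVS : universal_toeplitz_rep X V S)
    (K : hilbert R) (u : int -> K -> K) (s : cell E -> K -> K)
    (hus : universal_unitary_ck_rep (extend X) u s) :
  (exists iota : (H -> H) -> (K -> K),
     [/\ cstar_envelope (toeplitz_algebra V S) (family_cstar u s) iota,
         forall m : cell E, iota (S m) = s m
       & forall p : nat, iota (V p) = u p%:Z]) /\
  (family_cstar (fun p : nat => u p%:Z) s = family_cstar u s /\
   universal_unitary_ck_toeplitz_rep X (fun p : nat => u p%:Z) s).
Proof.
split; last by split; [exact: (family_cstar_nat hus)|exact: (universal_nat hus)].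
exists (emb V S u s); split.
- exact: emb_envelope.
- by move=> m; apply: (emb_S hVS hus).
- by move=> p; apply: (emb_V hVS hus).
Qed.
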